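(* Let $G$ be one of the star-shaped extended Dynkin graphs $\widetilde D_4,\widetilde E_6,\widetilde E_7,\widetilde E_8$, and let $\pi$ be a non-degenerate irreducible $*$-representation of generalized dimension $v$ of $\mathcal{A}_{G,\chi}$ for some $\chi$. Put $d=M_d^{-1}v$. Then one of two possibilities holds: (a) $\chi\in h_G$ and $v=M_d\delta_G$, where $\delta_G$ is the minimal imaginary root of the root system associated with $G$; (b) there exist a positive integer $k$ and a vertex $t$ of $G$ such that either $$\overset{\bullet}{c}{}^{(k)}_d(M_f\chi)\ge_t 0\quad\text{and}\quad \overset{\circ}{c}_k(d)=e_t,$$ or $$\overset{\circ}{c}{}^{(k)}_d(M_f\chi)\ge_t 0\quad\text{and}\quad \overset{\bullet}{c}_k(d)=e_t .$$ Moreover, if $d=M_d^{-1}v$ is a non-degenerate root with $\overset{\circ}{c}_k(d)=e_t$ (respectively $\overset{\bullet}{c}_k(d)=e_t$), then the system of inequalities $\overset{\bullet}{c}{}^{(k)}_d(M_f\chi)\ge_t 0$ (respectively $\overset{\circ}{c}{}^{(k)}_d(M_f\chi)\ge_t 0$) is necessary and sufficient for the existence of an irreducible non-degenerate $*$-representation of $\mathcal{A}_{G,\chi}$ of generalized dimension $v$.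
   Context: Graphs and algebras. $G$ is a star with central vertex $g_0$ and branches of lengths $m_1,\dots,m_n$: $(1,1,1,1)$ for $\widetilde D_4$, $(2,2,2)$ for $\widetilde E_6$, $(3,3,1)$ for $\widetilde E_7$, $(5,2,1)$ for $\widetilde E_8$. The parameter is $\chi=(\alpha^{(1)}_1,\dots,\alpha^{(1)}_{m_1},\dots,\alpha^{(n)}_1,\dots,\alpha^{(n)}_{m_n},\gamma)$ with $\alpha^{(j)}_1>\dots>\alpha^{(j)}_{m_j}>0$, $\gamma\in\mathbb{R}$. $\mathcal{A}_{G,\chi}$ is the unital $*$-algebra generated by self-adjoint $A_1,\dots,A_n$ with $A_j\prod_{i=1}^{m_j}(A_j-\alpha^{(j)}_i)=0$ for all $j$ and $A_1+\dots+A_n=\gamma e$. A $*$-representation (on a Hilbert space $H$) is non-degenerate if for each $j$ all spectral projections of $\pi(A_j)$ for $\alpha^{(j)}_1,\dots,\alpha^{(j)}_{m_j}$ and $0$ are nonzero. Its generalized dimension $v$ consists of the ranks $n^{(j)}_i$ of the spectral projections for $\alpha^{(j)}_i$, followed by $n_0=\dim H$. Hyperplane $h_G$: for $\widetilde D_4$: $\sum_{j=1}^4\alpha^{(j)}_1=2\gamma$; for $\widetilde E_6$: $\sum_{j=1}^3(\alpha^{(j)}_1+\alpha^{(j)}_2)=3\gamma$; for $\widetilde E_7$: $\sum_{i=1}^3\alpha^{(1)}_i+\sum_{i=1}^3\alpha^{(2)}_i+2\alpha^{(3)}_1=4\gamma$; for $\widetilde E_8$: $\sum_{i=1}^5\alpha^{(1)}_i+2(\alpha^{(2)}_1+\alpha^{(2)}_2)+3\alpha^{(3)}_1=6\gamma$.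 Transition matrices. Vectors indexed by vertices of $G$ are listed branch by branch, each branch from its outer end to the vertex adjacent to $g_0$, with the coordinate at $g_0$ last. $M_d^{-1}$ sends $(n^{(j)}_i;n_0)$ to the vector with coordinate $n_0$ at $g_0$ and, on a branch with ranks $n_1,\dots,n_m$: $(n_1)$ if $m=1$; $(n_2,\ n_1+n_2)$ if $m=2$; $(n_2,\ n_2+n_3,\ n_1+n_2+n_3)$ if $m=3$; $(n_3,\ n_3+n_4,\ n_2+n_3+n_4,\ n_2+n_3+n_4+n_5,\ n_1+\dots+n_5)$ if $m=5$. $M_f$ sends $\chi$ to the vector with coordinate $\gamma$ at $g_0$ and, on a branch with parameters $\alpha_1,\dots,\alpha_m$: $(\alpha_1)$; $(\alpha_1-\alpha_2,\ \alpha_1)$; $(\alpha_2-\alpha_3,\ \alpha_1-\alpha_3,\ \alpha_1)$; $(\alpha_3-\alpha_4,\ \alpha_2-\alpha_4,\ \alpha_2-\alpha_5,\ \alpha_1-\alpha_5,\ \alpha_1)$, for $m=1,2,3,5$ respectively. Roots. The Tits form is $q(x)=\sum_g x_g^2-\sum_{\{g,g'\}\text{ edge}}x_gx_{g'}$. A root is a nonzero integer vector with $q\le1$; real if $q=1$, imaginary if $q=0$. The minimal imaginary roots $\delta_G$ are $(1,1,1,1,2)$, $(1,2,1,2,1,2,3)$, $(1,2,3,1,2,3,2,4)$, $(1,2,3,4,5,2,4,3,6)$. A root $d$ is non-degenerate if along each branch its coordinates, from the outer end, are positive, strictly increasing, and all strictly less than the coordinate at $g_0$. Coxeter maps. Fix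 a 2-colouring of the vertices of $G$ into even ($\circ$) and odd ($\bullet$) so that adjacent vertices have different colours. $\overset{\circ}{c}$ (resp. $\overset{\bullet}{c}$) replaces $x_g$ by $-x_g+\sum_{g'\text{ adjacent to }g}x_{g'}$ for all even (resp. odd) vertices $g$ and fixes other coordinates. $\overset{\circ}{c}_k=\cdots\overset{\circ}{c}\,\overset{\bullet}{c}\,\overset{\circ}{c}$ and $\overset{\bullet}{c}_k=\cdots\overset{\bullet}{c}\,\overset{\circ}{c}\,\overset{\bullet}{c}$ ($k$ alternating factors, the rightmost applied first). For a dimension vector $d$, $\overset{\circ}{c}_d(f)$ (resp. $\overset{\bullet}{c}_d(f)$) agrees with $\overset{\circ}{c}(f)$ (resp. $\overset{\bullet}{c}(f)$) at even (resp. odd) vertices $g$ with $d_g\neq0$ and with $f$ at all other vertices. Put $$\overset{\bullet}{c}{}^{(k)}_d(f)=\cdots\overset{\bullet}{c}_{\overset{\circ}{c}_2(d)}\,\overset{\circ}{c}_{\overset{\circ}{c}(d)}\,\overset{\bullet}{c}_d(f),\qquad \overset{\circ}{c}{}^{(k)}_d(f)=\cdots\overset{\circ}{c}_{\overset{\bullet}{c}_2(d)}\,\overset{\bullet}{c}_{\overset{\bullet}{c}(d)}\,\overset{\circ}{c}_d(f)\quad(k\text{ factors}).$$ $e_t$ is the coordinate vector at vertex $t$. $u\ge_t 0$ means $u_t=0$ and $u_j>0$ for all $j\ne t$. *)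

(* Defs.v *)
From HB Require Import structures.
From mathcomp Require Import all_boot all_order all_algebra.
From mathcomp Require Import sesquilinear.
From mathcomp Require Import reals complex.

Set Implicit Arguments.
Unset Strict Implicit.
Unset Printing Implicit Defensive.

Import Order.TTheory GRing.Theory Num.Theory.
Local Open Scope ring_scope.
Local Open Scope complex_scope.

Variant ext_dynkin := D4 | E6 | E7 | E8.

Definition lengths (G : ext_dynkin) : seq nat :=
  match G with
  | D4 => [:: 1; 1; 1; 1]
  | E6 => [:: 2; 2; 2]
  | E7 => [:: 3; 3; 1]
  | E8 => [:: 5; 2; 1]
  end.

Definition nbranches (G : ext_dynkin) : nat := size (lengths G).

Definition len (G : ext_dynkin) (j : 'I_(nbranches G)) : nat :=
  nth 0%N (lengths G) j.

(* [None] is the central vertex g_0; [vtx j i] is the vertex at position i of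
   branch j, where position 0 is the outer end and position [len j - 1] is
   adjacent to g_0. *)
Definition vertex (G : ext_dynkin) : finType :=
  option {j : 'I_(nbranches G) & 'I_(len j)}.

Definition vtx (G : ext_dynkin) (j : 'I_(nbranches G)) (i : 'I_(len j)) :
    vertex G :=
  Some (Tagged (fun j : 'I_(nbranches G) => 'I_(len j)) i).

(* Families with one entry per vertex of G. The same type also carries the
   parameters chi (entry (j, i) is alpha^(j)_(i+1), entry [None] is gamma) and
   the generalized dimensions v (entry (j, i) is n^(j)_(i+1), entry [None] is
   n_0); there (j, i) is only a double index, and the passage to functions on
   vertices is made by [Md_inv] and [Mf]. *)
Definition vec (G : ext_dynkin) (Z : Type) : Type := {ffun vertex G -> Z}.

Definition branch (G : ext_dynkin) (Z : Type) (x : vec G Z)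
    (j : 'I_(nbranches G)) : seq Z :=
  [seq x (vtx i) | i <- enum 'I_(len j)].

Definition on_branches (G : ext_dynkin) (Z : zmodType) (F : seq Z -> seq Z)
    (x : vec G Z) : vec G Z :=
  [ffun g : vertex G =>
     if g is Some u then nth 0 (F (branch x (tag u))) (tagged u) else x None].

Section TransitionMatrices.
Variable Z : zmodType.
Implicit Type s : seq Z.

(* In the three functions below only the lengths 1, 2, 3 and 5 occur. *)
Definition Md_inv_branch s : seq Z :=
  match s with
  | [:: n1] => [:: n1]
  | [:: n1; n2] => [:: n2; n1 + n2]
  | [:: n1; n2; n3] => [:: n2; n2 + n3; n1 + n2 + n3]
  | [:: n1; n2; n3; n4; n5] =>
      [:: n3; n3 + n4; n2 + n3 + n4; n2 + n3 + n4 + n5;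
          n1 + n2 + n3 + n4 + n5]
  | _ => s
  end.

Definition Md_branch s : seq Z :=
  match s with
  | [:: d1] => [:: d1]
  | [:: d1; d2] => [:: d2 - d1; d1]
  | [:: d1; d2; d3] => [:: d3 - d2; d1; d2 - d1]
  | [:: d1; d2; d3; d4; d5] => [:: d5 - d4; d3 - d2; d1; d2 - d1; d4 - d3]
  | _ => s
  end.

Definition Mf_branch s : seq Z :=
  match s with
  | [:: a1] => [:: a1]
  | [:: a1; a2] => [:: a1 - a2; a1]
  | [:: a1; a2; a3] => [:: a2 - a3; a1 - a3; a1]
  | [:: a1; a2; a3; a4; a5] => [:: a3 - a4; a2 - a4; a2 - a5; a1 - a5; a1]
  | _ => s
  end.

Variable G : ext_dynkin.

Definition Md_inv : vec G Z -> vec G Z := on_branches Md_inv_branch.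
Definition Md : vec G Z -> vec G Z := on_branches Md_branch.
Definition Mf : vec G Z -> vec G Z := on_branches Mf_branch.

Lemma size_branch (x : vec G Z) j : size (branch x j) = len j.
Proof. by rewrite size_map size_enum_ord. Qed.

Lemma nth_branch (x : vec G Z) j (i : 'I_(len j)) :
  nth 0 (branch x j) i = x (vtx i).
Proof. by rewrite (nth_map i) ?size_enum_ord // nth_ord_enum. Qed.

Lemma branch_on_branches F (x : vec G Z) j :
  size (F (branch x j)) = len j -> branch (on_branches F x) j = F (branch x j).
Proof.
move=> sF; apply: (@eq_from_nth _ 0); first by rewrite size_branch sF.
move=> i; rewrite size_branch => lt_i.
by rewrite (nth_branch _ (Ordinal lt_i)) ffunE.
Qed.

Lemma on_branchesK (F F' : seq Z -> seq Z) :
  (forall s, size (F s) = size s) -> cancel F F' ->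
  cancel (@on_branches G Z F) (@on_branches G Z F').
Proof.
move=> sF FK x; apply/ffunP => -[[j i]|]; rewrite !ffunE //=.
by rewrite branch_on_branches ?sF ?size_branch // FK nth_branch.
Qed.

Lemma Md_invK : cancel Md_inv Md.
Proof.
have DK (a b : Z) : a + b - a = b by rewrite addrC addKr.
apply: on_branchesK; case=> [|n1 [|n2 [|n3 [|n4 [|n5 [|n6 s]]]]]] //=.
- by rewrite addrK.
- by rewrite -[n1 + n2 + n3]addrA addrK DK.
- have -> : n1 + n2 + n3 + n4 + n5 = n1 + (n2 + n3 + n4 + n5).
    by rewrite !addrA.
  by rewrite addrK -[n2 + n3 + n4]addrA addrK !DK.
Qed.

Lemma MdK : cancel Md Md_inv.
Proof.
have DK (a b : Z) : a + (b - a) = b by rewrite addrC subrK.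
have DK' (a b c : Z) : c - b + a + (b - a) = c by rewrite -addrA DK subrK.
apply: on_branchesK; case=> [|d1 [|d2 [|d3 [|d4 [|d5 [|d6 s]]]]]] //=.
- by rewrite subrK.
- by rewrite DK' DK.
- have -> : d5 - d4 + (d3 - d2) + d1 + (d2 - d1) + (d4 - d3)
            = d5 - d4 + (d3 - d2 + d1 + (d2 - d1) + (d4 - d3)).
    by rewrite !addrA.
  by rewrite !DK' !DK subrK.
Qed.

End TransitionMatrices.

(* [toward g g'] : {g, g'} is an edge and g' is its endpoint closer to g_0. *)
Definition toward (G : ext_dynkin) (g g' : vertex G) : bool :=
  match g, g' with
  | Some u, Some w => (tag u == tag w) && ((tagged u).+1 == tagged w :> nat)
  | Some u, None => (tagged u).+1 == len (tag u)
  | None, _ => false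
  end.

Definition adjacent (G : ext_dynkin) (g g' : vertex G) : bool :=
  toward g g' || toward g' g.

Definition tits (G : ext_dynkin) (x : vec G int) : int :=
  \sum_g x g ^+ 2
    - \sum_(e : vertex G * vertex G | toward e.1 e.2) x e.1 * x e.2.

Definition is_root (G : ext_dynkin) (x : vec G int) : Prop :=
  (exists g, x g != 0) /\ tits x <= 1.

Definition nondegenerate_root (G : ext_dynkin) (d : vec G int) : Prop :=
  is_root d /\
  forall j : 'I_(nbranches G),
    [/\ forall i : 'I_(len j), 0 < d (vtx i),
        forall i i' : 'I_(len j), (i < i')%N -> d (vtx i) < d (vtx i')
      & forall i : 'I_(len j), d (vtx i) < d None].

Definition delta_branches (G : ext_dynkin) : seq (seq int) :=
  match G with
  | D4 => [:: [:: 1]; [:: 1]; [:: 1]; [:: 1]]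
  | E6 => [:: [:: 1; 2]; [:: 1; 2]; [:: 1; 2]]
  | E7 => [:: [:: 1; 2; 3]; [:: 1; 2; 3]; [:: 2]]
  | E8 => [:: [:: 1; 2; 3; 4; 5]; [:: 2; 4]; [:: 3]]
  end.

Definition delta_center (G : ext_dynkin) : int :=
  match G with D4 => 2 | E6 => 3 | E7 => 4 | E8 => 6 end.

Definition delta (G : ext_dynkin) : vec G int :=
  [ffun g : vertex G =>
     if g is Some u then nth 0 (nth [::] (delta_branches G) (tag u)) (tagged u)
     else delta_center G].

(* Even vertices (white) are those of colour [circ], odd vertices (black) those
   of colour [bullet]. *)
Definition circ : bool := true.
Definition bullet : bool := false.

Definition proper_colouring (G : ext_dynkin) (col : vertex G -> bool) : Prop :=
  forall g g', adjacent g g' -> col g != col g'.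

Section Coxeter.
Variables (G : ext_dynkin) (col : vertex G -> bool).

Definition reflect_at (Z : zmodType) (x : vec G Z) (g : vertex G) : Z :=
  - x g + \sum_(g' | adjacent g g') x g'.

Definition cox (Z : zmodType) (b : bool) (x : vec G Z) : vec G Z :=
  [ffun g => if col g == b then reflect_at x g else x g].

(* k alternating factors; [b] is the colour of the one applied first. *)
Fixpoint cox_iter (Z : zmodType) (b : bool) (k : nat) (x : vec G Z) : vec G Z :=
  if k is k'.+1 then cox_iter (~~ b) k' (cox b x) else x.

Definition coxd (Z : zmodType) (b : bool) (d : vec G int) (f : vec G Z) :
    vec G Z :=
  [ffun g => if (col g == b) && (d g != 0) then cox b f g else f g].

(* k factors; the one applied first is [coxd b d], and each time the dimension
   vector is moved by the Coxeter map of the other colour, so that the factor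
   number i+1 is taken at the vector [cox_iter (~~ b) i d]. *)
Fixpoint coxd_iter (Z : zmodType) (b : bool) (k : nat) (d : vec G int)
    (f : vec G Z) : vec G Z :=
  if k is k'.+1 then coxd_iter (~~ b) k' (cox (~~ b) d) (coxd b d f) else f.

End Coxeter.

Definition unit_vec (G : ext_dynkin) (t : vertex G) : vec G int :=
  [ffun g => (g == t)%:R].

Section Representations.
Variables (R : realType) (G : ext_dynkin).

Definition pos_off (t : vertex G) (u : vec G R) : Prop :=
  u t = 0 /\ forall g, g != t -> 0 < u g.

Definition parameter (chi : vec G R) : Prop :=
  forall j : 'I_(nbranches G),
    (forall i : 'I_(len j), 0 < chi (vtx i)) /\
    (forall i i' : 'I_(len j), (i < i')%N -> chi (vtx i') < chi (vtx i)).

(* The hyperplane is sum_j w_j * sum_i alpha^(j)_i = w_0 * gamma. *)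
Definition hyperplane_weights : seq nat :=
  match G with
  | D4 => [:: 1; 1; 1; 1]
  | E6 => [:: 1; 1; 1]
  | E7 => [:: 1; 1; 2]
  | E8 => [:: 1; 2; 3]
  end.

Definition hyperplane_weight0 : nat :=
  match G with D4 => 2 | E6 => 3 | E7 => 4 | E8 => 6 end.

Definition in_hyperplane (chi : vec G R) : Prop :=
  \sum_(j < nbranches G)
      (nth 0%N hyperplane_weights j)%:R * \sum_(i < len j) chi (vtx i)
    = hyperplane_weight0%:R * chi None.

(* A finite-dimensional complex Hilbert space is a [vectType] over R[i] with a
   positive definite hermitian form. The entries of a generalized dimension
   being numbers, these are the only Hilbert spaces involved: one of the
   entries is dim H. *)
Variables (H : vectType R[i]) (form : {dot H for Num.conj}).

Definition self_adjoint (A : 'End(H)) : Prop :=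
  forall x y, form (A x) y = form x (A y).

(* By the universal property of generators and relations, a unital
   *-representation of A_(G,chi) is given by the images of the generators. *)
Record star_rep (chi : vec G R) := StarRep {
  gen :> 'I_(nbranches G) -> 'End(H);
  gen_adj : forall j, self_adjoint (gen j);
  gen_poly : forall j,
    (gen j \o \big[@comp_lfun _ H H H / \1%VF]_(i < len j)
                (gen j - (chi (vtx i))%:C *: \1))%VF = 0;
  gen_sum : \sum_(j < nbranches G) gen j = (chi None)%:C *: \1%VF
}.

(* Orthogonal projection onto the eigenspace of A for a. *)
Definition spectral_proj (A : 'End(H)) (a : R[i]) : 'End(H) :=
  daddv_pi (passmx.leigenspace A a) (orthov form (passmx.leigenspace A a)).

Variables (chi : vec G R) (pi : star_rep chi).

Definition irreducible : Prop :=
  \dim {:H} != 0%N /\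
  forall U : {vspace H},
    (forall j, (pi j @: U <= U)%VS) -> U = 0%VS \/ U = fullv.

Definition nondegenerate_rep : Prop :=
  forall j : 'I_(nbranches G),
    (forall i : 'I_(len j), spectral_proj (pi j) (chi (vtx i))%:C != 0) /\
    spectral_proj (pi j) 0 != 0.

Definition gen_dim (v : vec G int) : Prop :=
  (forall (j : 'I_(nbranches G)) (i : 'I_(len j)),
     v (vtx i) = (\dim (limg (spectral_proj (pi j) (chi (vtx i))%:C)))%:Z) /\
  v None = (\dim {:H})%:Z.

End Representations.

(* Main.v *)
(* A star-representation of A_(G,chi) is the same as a unitary locally scalar
   representation of the star G: a graded Hilbert space with maps along the edges
   and their adjoints, such that at each vertex g the sum of the products
   "out and back" is the scalar f_g, with f = M_f chi and dimension d = M_d^-1 v.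
   Along a branch the spaces are the sums of all but the first few spectral
   subspaces of A_j, the eigenvalues being split off in the order 0, alpha_1,
   alpha_m, alpha_2, ...

   A Coxeter map at one colour turns an indecomposable unitary representation
   into another one, acting on d by c and on f by c_d. It changes the height
   sum delta_g d_g by -2 times the defect (the delta-weighted sum of d over one
   colour minus the other one), and alternate maps preserve the defect. Hence if
   the defect is not 0, moving in the direction which lowers the height ends at
   a simple root e_t, where f vanishes exactly at t; conversely one walks back
   from e_t.

   If the defect is 0, then d = delta. The Tits form of d is at most 1, by
   reflections at single vertices. If it is 1, then d = delta + x or d = delta - x
   for a positive root x of defect 0. In the first case d has full support all
   along the walk, so f would become negative unless its defect vanishes; then x
   is orthogonal to f, while reflections at vertices with f_g <> 0 lower x to a
   simple root e_i with f_i <> 0. In the second case an increasing d below delta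
   of defect 0 equals delta. If the form is 0, then d = m delta, and a unitary
   irreducible representation has only scalar endomorphisms as a representation
   of the bipartite quiver. Let Y be a representation of dimension delta whose
   self-extensions are spanned by one class Y'. Every X of dimension m delta is deformed linearly to Y (x) 1, and
   modulo each power of x this deformation is conjugate to Y (x) 1 + Y' (x) A,
   which has a nonscalar endomorphism if m > 1; so the linear pencil defining the
   endomorphisms of the deformation is singular, and X has nonscalar ones. *)

From HB Require Import structures.
Require Import Defs.
From mathcomp Require Import all_boot all_order all_algebra.
From mathcomp Require Import sesquilinear spectral reals complex mxtens.
From mathcomp Require Import ring lra zify.

Set Implicit Arguments.
Unset Strict Implicit.
Unset Printing Implicit Defensive.

Import Order.TTheory GRing.Theory Num.Theory.
Local Open Scope ring_scope.

(** * Coxeter maps and the Tits form *)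

(** Two notions of representation run in parallel. Reflecting a single vertex turns f_i into -f_i,
    which destroys positivity; so the bound on the Tits form and the exclusion of delta + x are
    proved for [has_rep], without any inner product, while the walk needs signs of f and uses
    [has_unitary_rep]. Both kinds of reflection come from one construction with free factors a, b
    such that a b = f'.

    The hard case is d = m delta with m > 1: f may well have defect 0 there, so neither the walk nor
    the trace identity gives a contradiction, and the maps themselves must be examined. What depends
    on the graph is compressed into one explicit Y, whose self-extensions are settled by a
    computation with matrix units. The pencil is singular because a nonzero determinant is not
    divisible by arbitrarily high powers of x, whereas each truncated conjugation supplies a kernel
    vector modulo x^n with nonzero constant term. Unitarity enters again at the end: the deformation
    sees the maps of one orientation only, but irreducibility concerns both directions. *)

Section Graph.
Variable G : ext_dynkin.
Implicit Types g h : vertex G.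

Lemma adjacentC g h : adjacent g h = adjacent h g.
Proof. by rewrite /adjacent orbC. Qed.

Lemma sum_vertex (Z : nmodType) (F : vertex G -> Z) :
  \sum_g F g = F None + \sum_(j < nbranches G) \sum_(i < len j) F (vtx i).
Proof.
rewrite (bigD1 None) //=; congr (_ + _).
rewrite (sig_big_dep (fun=> true) (fun _ _ => true)) /=.
rewrite [LHS](reindex_omap (Some : {j : 'I_(nbranches G) & 'I_(len j)} -> _) id) /=;
  last by case.
rewrite [LHS](eq_bigl xpredT); last by move=> u /=; rewrite eqxx.
by apply: eq_bigr; case.
Qed.

Lemma adjacentxx g : adjacent g g = false.
Proof. by case: g => [[j i]|] //=; rewrite /adjacent /= eqxx orbb /= gtn_eqF. Qed.

(** This is the radical condition on delta. It makes weighted sums transform linearly under Coxeter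
    maps and turns the form into a sum of squares. *)
Lemma delta_harmonic g : \sum_(h | adjacent g h) delta G h = 2%:R * delta G g.
Proof.
rewrite big_mkcond sum_vertex !ffunE.
case: g => [[j i]|]; last first.
  by case: G => /=; rewrite !big_ord_recl !big_ord0 /=; rewrite ?big_ord_recl ?big_ord0 /= ?ffunE.
case: G j i => -[[|[|[|[|j]]]] lt_j] //= -[[|[|[|[|[|i]]]]] lt_i] //=;
  rewrite !big_ord_recl !big_ord0 /=; rewrite ?big_ord_recl ?big_ord0 /=;
     rewrite /adjacent ?ffunE /=. all: by [].
Qed.

Lemma delta_gt0 g : 0 < delta G g.
Proof.
rewrite ffunE; case: g => [[j i]|]; last by case: G.
by case: G j i => -[[|[|[|[|j]]]] lt_j] //= -[[|[|[|[|[|i]]]]] lt_i].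
Qed.

Lemma vertex_neq (i : vertex G) : exists g, g != i.
Proof.
case: i => [i|]; first by exists None.
have nb : (0 < nbranches G)%N by case: (G).
have ln : (0 < len (Ordinal nb))%N by move: nb; case: (G).
by exists (vtx (Ordinal ln)).
Qed.

Lemma delta_eq1 : exists e : vertex G, delta G e = 1.
Proof.
have nb : (0 < nbranches G)%N by case: (G).
have ln : (0 < len (Ordinal nb))%N by move: nb; case: (G).
by exists (vtx (Ordinal ln)); rewrite ffunE /=; move: nb ln; case: (G).
Qed.

(** Induction outwards from the centre; this is how the connectedness of the graph is used. *)
Lemma vertex_ind (P : vertex G -> Prop) :
  P None -> (forall g h, toward g h -> P h -> P g) -> forall g, P g.
Proof.
move=> P0 Pt [[j i]|] //.
have [n le_n] := ubnP (len j - i)%N; elim: n i le_n => // n IHn i le_n.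
have [eq_i|neq_i] := eqVneq i.+1 (len j); first by apply: (Pt _ None); rewrite //= eq_i.
have lt_i : (i.+1 < len j)%N by rewrite ltn_neqAle neq_i ltn_ord.
apply: (Pt _ (vtx (Ordinal lt_i))); first by rewrite /= !eqxx.
by apply: IHn; rewrite /=; lia.
Qed.

Variable col : vertex G -> bool.
Hypothesis hcol : proper_colouring col.

Lemma adj_col g h : adjacent g h -> col h = ~~ col g.
Proof. by move/hcol; case: (col g); case: (col h). Qed.

Lemma coxE (Z : zmodType) b (x : vec G Z) g :
  cox col b x g = if col g == b then reflect_at x g else x g.
Proof. by rewrite ffunE. Qed.

Section Weights.
Variable Z : comPzRingType.
Implicit Type x : vec G Z.

Definition wsum b x : Z := \sum_(g | col g == b) (delta G g)%:~R * x g.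
(** With all edges oriented from colour [b] to the other colour, this is the Euler form with delta
    as first argument: the usual defect of an extended Dynkin quiver. *)
Definition defect b x : Z := wsum b x - wsum (~~ b) x.
Definition height x : Z := \sum_g (delta G g)%:~R * x g.

Lemma heightE b x : height x = wsum b x + wsum (~~ b) x.
Proof.
rewrite /height (bigID (fun g => col g == b)) /=; congr (_ + _).
by apply: eq_bigl => g; case: (col g); case: b.
Qed.

Lemma sum_adj_swap b (F : vertex G -> vertex G -> Z) :
  \sum_(g | col g == b) \sum_(h | adjacent g h) F g h =
  \sum_(h | col h == ~~ b) \sum_(g | adjacent h g) F g h.
Proof.
rewrite (exchange_big_dep (fun h => col h == ~~ b)) /=; last first.
  by move=> g h /eqP<- /adj_col->.
apply: eq_bigr => h /eqP hb; apply: eq_bigl => g.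
rewrite adjacentC andbC; case adj_gh: (adjacent h g) => //=.
by rewrite (adj_col adj_gh) hb negbK eqxx.
Qed.

(** By harmonicity each neighbour x_h is collected with total weight 2 delta_h. *)
Lemma wsum_cox b x : wsum b (cox col b x) = 2%:R * wsum (~~ b) x - wsum b x.
Proof.
rewrite /wsum; transitivity (\sum_(g | col g == b)
    (- ((delta G g)%:~R * x g) + \sum_(h | adjacent g h) (delta G g)%:~R * x h)).
  by apply: eq_bigr => g gb; rewrite coxE gb /reflect_at mulrDr mulrN mulr_sumr.
rewrite big_split /= sumrN addrC; congr (_ - _).
rewrite sum_adj_swap mulr_sumr; apply: eq_bigr => h _.
rewrite -mulr_suml -rmorph_sum /= delta_harmonic rmorphM /= rmorph_nat.
by rewrite mulrA.
Qed.

Lemma wsum_coxN b x : wsum (~~ b) (cox col b x) = wsum (~~ b) x.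
Proof.
by apply: eq_bigr => g /eqP gb; rewrite coxE gb; case: (b).
Qed.

Lemma defect_cox b x : defect (~~ b) (cox col b x) = defect b x.
Proof. by rewrite /defect wsum_coxN negbK wsum_cox; ring. Qed.

Lemma defectN b x : defect (~~ b) x = - defect b x.
Proof. by rewrite /defect negbK opprB. Qed.

Lemma height_cox b x : height (cox col b x) = height x - 2%:R * defect b x.
Proof. by rewrite !(heightE b) wsum_cox wsum_coxN /defect; ring. Qed.

Lemma height_cox_iter b k x :
  height (cox_iter col b k x) = height x - (2 * k)%:R * defect b x.
Proof.
elim: k b x => [|k IHk] b x /=; first by rewrite muln0 mul0r subr0.
rewrite IHk height_cox defect_cox; ring.
Qed.

Lemma defect_cox_iter b k x :
  defect (b (+) odd k) (cox_iter col b k x) = defect b x.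
Proof.
elim: k b x => [|k IHk] b x /=; first by rewrite addbF.
by rewrite -(defect_cox b x) -(IHk (~~ b)) addbN addNb.
Qed.

End Weights.

Lemma coxK (Z : zmodType) b : involutive (@cox G col Z b).
Proof.
move=> x; apply/ffunP => g; rewrite !ffunE; case: eqP => // gb.
rewrite /reflect_at ffunE gb eqxx /reflect_at opprD opprK.
rewrite [X in _ + X](eq_bigr x) ?subrK // => h /adj_col hb.
by rewrite ffunE hb gb; case: (b).
Qed.

Lemma cox_iterS (Z : zmodType) b k (x : vec G Z) :
  cox_iter col b k.+1 x = cox col (b (+) odd k) (cox_iter col b k x).
Proof.
elim: k b x => [|k IHk] b x; first by rewrite /= addbF.
by rewrite -[LHS]/(cox_iter col (~~ b) k.+1 (cox col b x)) IHk /= addbN addNb.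
Qed.

(** Undoing the walk starts with the colour applied last, which is the negation of [b (+) odd k]. *)
Lemma cox_iterK (Z : zmodType) b k (x : vec G Z) :
  cox_iter col (~~ (b (+) odd k)) k (cox_iter col b k x) = x.
Proof.
elim: k b x => [//|k IHk] b x; rewrite [cox_iter col b _ x]cox_iterS /= addbN !negbK coxK.
exact: IHk.
Qed.

Definition nbr_sum (Z : nmodType) (x : vec G Z) g : Z := \sum_(h | adjacent g h) x h.

(** Every edge has exactly one end of colour [b]; charging it to that end yields the Tits form for
    either [b]. In this shape reflections at vertices of colour [b] act term by term. *)
Definition quad_term b (x : vec G int) g : int :=
  if col g == b then x g * (x g - nbr_sum x g) else x g ^+ 2.

Definition quad (x : vec G int) : int := \sum_g quad_term true x g.

Lemma quadE b x : quad x = \sum_g quad_term b x g.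
Proof.
suff qE c : \sum_g quad_term c x g =
    \sum_g x g ^+ 2 - \sum_(g | col g == c) \sum_(h | adjacent g h) x g * x h.
  rewrite /quad !qE; congr (_ - _); case: b => //; rewrite [RHS]sum_adj_swap.
  by apply: eq_bigr => g _; apply: eq_bigr => h _; rewrite mulrC.
rewrite [X in _ - X]big_mkcond -sumrB; apply: eq_bigr => g _; rewrite /quad_term.
by case: ifP; rewrite ?subr0 // mulrBr mulr_sumr.
Qed.

Definition reflect_on (Z : zmodType) (J : pred (vertex G)) (x : vec G Z) : vec G Z :=
  [ffun g => if J g then reflect_at x g else x g].

Lemma reflect_onE (Z : zmodType) (J : pred (vertex G)) (x : vec G Z) g :
  reflect_on J x g = if J g then reflect_at x g else x g.
Proof. by rewrite ffunE. Qed.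

(** The neighbour sum s at a reflected vertex does not change, and y (y - s) is invariant under y ->
    s - y. *)
Lemma quad_reflect_on b (J : pred (vertex G)) x :
  (forall g, J g -> col g = b) -> quad (reflect_on J x) = quad x.
Proof.
move=> Jb; rewrite !(quadE b); apply: eq_bigr => g _; rewrite /quad_term ffunE.
case: eqP => [gb|/eqP gb]; last by case: ifP => // /Jb/eqP; rewrite (negPf gb).
have -> : nbr_sum (reflect_on J x) g = nbr_sum x g.
  apply: eq_bigr => h /adj_col hg; rewrite ffunE; case: ifP => // /Jb.
  by rewrite hg gb; case: (b).
by case: ifP => // _; rewrite /reflect_at -/(nbr_sum x g); ring.
Qed.

Lemma quad_cox b x : quad (cox col b x) = quad x.
Proof. by apply: (@quad_reflect_on b) => g /eqP. Qed.

Lemma quad_cox_iter b k x : quad (cox_iter col b k x) = quad x.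
Proof. by elim: k b x => //= k IHk b x; rewrite IHk quad_cox. Qed.

Let dl g : rat := (delta G g)%:~R.
Let dl_gt0 g : 0 < dl g. Proof. by rewrite ltr0z delta_gt0. Qed.

Lemma sum_adj_col (F : vertex G -> vertex G -> rat) :
  (forall g h, F g h = F h g) ->
  \sum_g \sum_(h | adjacent g h) F g h =
    2%:R * \sum_(g | col g == true) \sum_(h | adjacent g h) F g h.
Proof.
move=> symF; rewrite (bigID (fun g => col g == true)) /=.
rewrite [X in _ + X](eq_bigl (fun g => col g == ~~ true)) => [|g]; last by case: (col g).
rewrite [X in _ + X](sum_adj_swap (~~ true)) negbK mulr_natl mulr2n; congr (_ + _).
by apply: eq_bigr => g _; apply: eq_bigr => h _.
Qed.

(** Expand the squares: harmonicity turns each family of square terms into twice the sum of the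
    x_g^2. The sum runs over ordered pairs, so each edge occurs twice; hence the factor 4. *)
Lemma quad_sos (x : vec G int) :
  4%:R * (quad x)%:~R = \sum_g \sum_(h | adjacent g h)
    dl g * dl h * ((x g)%:~R / dl g - (x h)%:~R / dl h) ^+ 2.
Proof.
have dl0 g : dl g != 0 by rewrite gt_eqF.
have dlsum g : \sum_(h | adjacent g h) dl h = 2%:R * dl g.
  by rewrite -rmorph_sum /= delta_harmonic rmorphM.
have sqE : \sum_g \sum_(h | adjacent g h) dl h * ((x g)%:~R ^+ 2 / dl g) =
    2%:R * \sum_g (x g)%:~R ^+ 2.
  rewrite mulr_sumr; apply: eq_bigr => g _; rewrite -mulr_suml dlsum.
  by move: (dl g) (dl0 g) (_ ^+ 2) => D D0 X; field.
transitivity (\sum_g \sum_(h | adjacent g h) dl h * ((x g)%:~R ^+ 2 / dl g) +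
  \sum_g \sum_(h | adjacent g h) dl g * ((x h)%:~R ^+ 2 / dl h) -
  2%:R * \sum_g \sum_(h | adjacent g h) ((x g)%:~R * (x h)%:~R : rat)); last first.
  rewrite mulr_sumr -big_split -sumrB; apply: eq_bigr => g _ /=.
  rewrite mulr_sumr -big_split -sumrB; apply: eq_bigr => h _ /=.
  move: (dl g) (dl h) (dl0 g) (dl0 h) => D E D0 E0.
  by field; apply/andP.
rewrite [X in _ + X - _](_ : _ = 2%:R * \sum_g (x g)%:~R ^+ 2); last first.
  rewrite -sqE (exchange_big_dep predT) //=; apply: eq_bigr => h _.
  by apply: eq_bigl => g; rewrite adjacentC.
rewrite sqE sum_adj_col => [|g h]; last exact: mulrC.
suff -> : (quad x)%:~R = \sum_g (x g)%:~R ^+ 2 -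
    \sum_(g | col g == true) \sum_(h | adjacent g h) (x g)%:~R * (x h)%:~R :> rat.
  by ring.
rewrite rmorph_sum [X in _ - X]big_mkcond -sumrB; apply: eq_bigr => g _.
rewrite /quad_term; case: ifP => _; rewrite ?subr0 /= ?rmorphXn //=.
rewrite mulrBr rmorphB !rmorphM rmorph_sum /= -mulr_sumr.
by rewrite expr2.
Qed.

Lemma quad_ge0 x : 0 <= quad x.
Proof.
rewrite -(ler_int rat) -(pmulr_rge0 _ (_ : 0 < 4%:R)) // quad_sos.
apply: sumr_ge0 => g _; apply: sumr_ge0 => h _.
by rewrite mulr_ge0 ?sqr_ge0 // mulr_ge0 // ltW.
Qed.

(** All squares vanish, so x is proportional to delta along edges, hence everywhere. A vertex where
    delta is 1 makes the factor an integer. *)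
Lemma quad_eq0 x : quad x = 0 -> exists c : int, forall g, x g = c * delta G g.
Proof.
move=> q0; have edge g h : adjacent g h -> (x g)%:~R * dl h = (x h)%:~R * dl g.
  move=> adj_gh.
  have term_ge0 u v : 0 <= dl u * dl v * ((x u)%:~R / dl u - (x v)%:~R / dl v) ^+ 2.
    by rewrite mulr_ge0 ?sqr_ge0 // mulr_ge0 // ltW.
  have /esym := quad_sos x; rewrite q0 mulr0.
  move/(psumr_eq0P (fun u _ => sumr_ge0 _ (fun v _ => term_ge0 u v)))/(_ g isT).
  move/(psumr_eq0P (fun v _ => term_ge0 g v))/(_ h adj_gh)/eqP.
  rewrite mulf_eq0 sqrf_eq0 (gt_eqF (mulr_gt0 (dl_gt0 g) (dl_gt0 h))) /= subr_eq0 => /eqP /(congr1 (fun z => z * dl g * dl h)).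
  by rewrite divfK ?gt_eqF // -mulrA [dl g * _]mulrC mulrA divfK ?gt_eqF.
have centre g : (x g)%:~R * dl None = (x None)%:~R * dl g.
  elim/vertex_ind: g => // g h gh IHh.
  have/edge gh' : adjacent g h by rewrite /adjacent gh.
  apply: (mulIf (_ : dl h != 0)); first by rewrite gt_eqF.
  by rewrite mulrAC gh' mulrAC IHh mulrAC.
have [e de1] := delta_eq1; exists (x e) => g.
apply/eqP; rewrite -(eqr_int rat) rmorphM /=.
have := centre e; rewrite /dl de1 mulr1 -/(dl None) -/(dl g) => ce.
have dN0 : dl None != 0 by rewrite gt_eqF.
by apply/eqP/(mulIf dN0); rewrite centre -ce; ring.
Qed.

(** If both signs occur, the positive and negative parts are nonzero but vanish somewhere, so
    neither is a multiple of delta and each has form at least 1. Their supports are disjoint and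
    edges between them only increase the form, so the form of x is at least 2. *)
Lemma root_sign x : quad x <= 1 -> (forall g, 0 <= x g) \/ (forall g, x g <= 0).
Proof.
move=> q1; case: (boolP [forall g, 0 <= x g]) => [/forallP|]; first by left.
rewrite negb_forall => /existsP[h]; rewrite -ltNge => xh; right=> g.
rewrite leNgt; apply/negP => xg.
pose xp : vec G int := [ffun u => Num.max (x u) 0].
pose xm : vec G int := [ffun u => Num.max (- x u) 0].
have q_gt0 (y : vec G int) u v : y u = 0 -> 0 < y v -> 1 <= quad y.
  move=> yu yv; have := quad_ge0 y; rewrite le_eqVlt => /orP[/eqP/esym/quad_eq0[c yE]|] //.
  have c0 : c = 0 by move: yu; rewrite yE => /eqP;
    rewrite mulf_eq0 (gt_eqF (delta_gt0 u)) orbF => /eqP.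
  by move: yv; rewrite yE c0 mul0r ltxx.
have qp : 1 <= quad xp by apply: (q_gt0 _ h g); rewrite ffunE; lia.
have qm : 1 <= quad xm by apply: (q_gt0 _ g h); rewrite ffunE; lia.
suff : quad xp + quad xm <= quad x by lia.
rewrite /quad -big_split; apply: ler_sum => u _ /=; rewrite /quad_term.
have xE v : x v = xp v - xm v by rewrite !ffunE; lia.
have xp0 v : 0 <= xp v by rewrite ffunE; lia.
have xm0 v : 0 <= xm v by rewrite ffunE; lia.
have xpm : xp u * xm u = 0.
  by rewrite !ffunE; case: (leP (x u) 0) => ?;
    [rewrite mul0r | rewrite (_ : Num.max (- x u) 0 = 0) ?mulr0 //; lia].
have -> : nbr_sum x u = nbr_sum xp u - nbr_sum xm u.
  by rewrite /nbr_sum -sumrB; apply: eq_bigr => v _.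
have : 0 <= nbr_sum xp u by apply: sumr_ge0.
have : 0 <= nbr_sum xm u by apply: sumr_ge0.
rewrite xE; move: xpm (xp0 u) (xm0 u); case: ifP => _ => pm p0 m0 M0 P0.
  have : 0 <= xp u * nbr_sum xm u + xm u * nbr_sum xp u by rewrite addr_ge0 ?mulr_ge0.
  by nia.
by nia.
Qed.

End Graph.

(** * Single reflections, shifts by delta, heights of roots *)

Section RootCombinatorics.
Variables (G : ext_dynkin) (col : vertex G -> bool).
Hypothesis hcol : proper_colouring col.
Implicit Types (x : vec G int) (g h : vertex G).

Lemma quad_bilinear x : 2%:R * quad col x = \sum_g x g * (2%:R * x g - nbr_sum x g).
Proof.
rewrite mulr_natl mulr2n [X in X + _](quadE hcol true) (quadE hcol false) -big_split.
apply: eq_bigr => g _; rewrite /quad_term.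
by case: (col g) => /=; ring.
Qed.

Lemma delta_orth x : \sum_g delta G g * (2%:R * x g - nbr_sum x g) = 0.
Proof.
rewrite (eq_bigr (fun g => 2%:R * delta G g * x g - \sum_(h | adjacent g h) delta G g * x h)).
  rewrite sumrB [X in _ - X](exchange_big_dep predT) //= -sumrB big1 // => h _.
  rewrite -mulr_suml -delta_harmonic -mulrBl [X in (_ - X) * _](eq_bigl (adjacent h)) ?subrr ?mul0r //.
  by move=> g; rewrite adjacentC.
by move=> g _; rewrite mulrBr mulr_sumr; ring.
Qed.

Definition shift x (c : int) : vec G int := [ffun g => x g + c * delta G g].

Lemma shiftE x c g : shift x c g = x g + c * delta G g.
Proof. by rewrite ffunE. Qed.

Lemma nbr_shift x c g :
  2%:R * shift x c g - nbr_sum (shift x c) g = 2%:R * x g - nbr_sum x g.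
Proof.
rewrite /nbr_sum ffunE (eq_bigr (fun h => x h + c * delta G h)) => [|h _]; last by rewrite ffunE.
by rewrite big_split /= -mulr_sumr delta_harmonic; ring.
Qed.

Lemma quad_shift x c : quad col (shift x c) = quad col x.
Proof.
apply: (mulfI (_ : 2%:R != 0)) => //; rewrite !quad_bilinear.
under eq_bigr => g _ do rewrite nbr_shift ffunE mulrDl -mulrA.
by rewrite big_split /= -mulr_sumr delta_orth mulr0 addr0.
Qed.

Lemma unit_vecE (g h : vertex G) : unit_vec g h = (h == g)%:R.
Proof. by rewrite ffunE. Qed.

Lemma height_int x : height x = \sum_g delta G g * x g.
Proof. by apply: eq_bigr => g _; rewrite intz. Qed.

Lemma height_reflect1 x i :
  height (reflect_on (pred1 i) x) = height x - delta G i * (2%:R * x i - nbr_sum x i).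
Proof.
rewrite !height_int (bigD1 i) //= [in RHS](bigD1 i) //= [reflect_on _ _ _]ffunE /= eqxx.
rewrite (eq_bigr (fun g => delta G g * x g)); last first.
  by move=> g /negPf gi; rewrite [reflect_on _ _ _]ffunE /= gi.
by rewrite /reflect_at /nbr_sum; ring.
Qed.

Lemma height_ge0 x : (forall g, 0 <= x g) -> 0 <= height x.
Proof.
by move=> x0; rewrite height_int; apply: sumr_ge0 => g _; rewrite mulr_ge0 // ltW // delta_gt0.
Qed.

Lemma height_le0 x : (forall g, x g <= 0) -> height x <= 0.
Proof.
by move=> x0; rewrite height_int; apply: sumr_le0 => g _; rewrite mulr_ge0_le0 // ltW // delta_gt0.
Qed.

Lemma quad_unit_vec t : quad col (unit_vec t) = 1.
Proof.
apply: (mulfI (_ : 2%:R != 0)) => //; rewrite quad_bilinear (bigD1 t) //= unit_vecE eqxx.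
rewrite big1 => [|g /negPf gt]; last by rewrite unit_vecE gt mul0r.
rewrite /nbr_sum big1 ?subr0 // => h th; rewrite unit_vecE.
by case: eqP th => // ->; rewrite adjacentxx.
Qed.

Lemma height_unit_vec t : height (unit_vec t) = delta G t.
Proof.
rewrite height_int (bigD1 t) //= unit_vecE eqxx mulr1 big1 ?addr0 // => g /negPf gt.
by rewrite unit_vecE gt mulr0.
Qed.

Lemma wsum_unit_vec b t : wsum col b (unit_vec t) = if col t == b then delta G t else 0.
Proof.
rewrite /wsum big_mkcond (bigD1 t) //= unit_vecE eqxx mulr1 intz big1 ?addr0 // => g /negPf gt.
by rewrite unit_vecE gt mulr0; case: ifP.
Qed.

Lemma defect_unit_vec b t :
  defect col b (unit_vec t) = if col t == b then delta G t else - delta G t.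
Proof.
rewrite /defect !wsum_unit_vec; case: b; case: (col t) => /=;
  rewrite ?eqxx /=. all: by rewrite ?subr0 ?sub0r.
Qed.

(* Moving away from a simple root never meets a simple root again: the height
   grows linearly while the defect keeps its absolute value. *)
Lemma cox_away b t k : col t = ~~ b -> (0 < k)%N ->
  (forall g, 0 <= cox_iter col b k (unit_vec t) g) /\
  forall s, cox_iter col b k (unit_vec t) <> unit_vec s.
Proof.
move=> tb k_gt0; have dt := delta_gt0 t.
have defE : defect col b (unit_vec t) = - delta G t.
  by rewrite defect_unit_vec tb; case: (b).
have hgtE : height (cox_iter col b k (unit_vec t)) = delta G t + (2 * k)%:R * delta G t.
  by rewrite height_cox_iter // height_unit_vec defE mulrN opprK.
have hgt_gt : delta G t < height (cox_iter col b k (unit_vec t)).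
  by rewrite hgtE ltrDl mulr_gt0 // ltr0n muln_gt0.
split.
  have : quad col (cox_iter col b k (unit_vec t)) <= 1 by rewrite quad_cox_iter // quad_unit_vec.
  case/(root_sign hcol) => // neg.
  by have := lt_trans dt (lt_le_trans hgt_gt (height_le0 neg)); rewrite ltxx.
move=> s Es; have := defect_cox_iter hcol b k (unit_vec t).
have := hgt_gt; rewrite Es height_unit_vec defE defect_unit_vec => lt_ts.
have ds := delta_gt0 s.
by case: ifP => _; lia.
Qed.

End RootCombinatorics.

(** * Locally scalar representations *)

Section LocallyScalar.
Local Open Scope sesquilinear_scope.
Variables (G : ext_dynkin) (C : numClosedFieldType).
Implicit Types (d : vec G int) (f : vec G C).

(* Matrices act on row vectors: [w g h] maps the space at g, which is the row
   space of the idempotent [S g], to the space at h. *)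
Definition simple_rep n (S : vertex G -> 'M[C]_n) (w : vertex G -> vertex G -> 'M[C]_n) :=
  (exists g, S g != 0) /\
  forall U : vertex G -> 'M[C]_n,
    (forall g, (U g <= S g)%MS) ->
    (forall g h, adjacent g h -> (U g *m w g h <= U h)%MS) ->
    (forall g, U g = 0) \/ (forall g, (S g <= U g)%MS).

(** Dimensions are recorded as traces of idempotents: a trace is additive, which gives the dimension
    of a complement at once, and in characteristic 0 it determines the rank. *)
Record scalar_rep n (S : vertex G -> 'M[C]_n) (w : vertex G -> vertex G -> 'M[C]_n)
    d f : Prop := ScalarRep {
  rep_idem : forall g, S g *m S g = S g;
  rep_srcK : forall g h, adjacent g h -> S g *m w g h = w g h;
  rep_tgtK : forall g h, adjacent g h -> w g h *m S h = w g h;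
  rep_scal : forall g, \sum_(h | adjacent g h) w g h *m w h g = f g *: S g;
  rep_dim : forall g, \tr (S g) = (d g)%:~R;
  rep_simple : simple_rep S w
}.

Definition hermitian_rep n (S : vertex G -> 'M[C]_n) (w : vertex G -> vertex G -> 'M[C]_n) :=
  (forall g, (S g)^t* = S g) /\ (forall g h, adjacent g h -> (w g h)^t* = w h g).

Lemma trmxC_mul m n p (A : 'M[C]_(m, n)) (B : 'M[C]_(n, p)) :
  (A *m B)^t* = B^t* *m A^t*.
Proof. by rewrite trmx_mul map_mxM. Qed.

Lemma trmxC_scale m n (a : C) (A : 'M[C]_(m, n)) : (a *: A)^t* = a^* *: A^t*.
Proof. by rewrite linearZ /= map_mxZ. Qed.

Lemma trmxC_sum m n (I : finType) (P : pred I) (F : I -> 'M[C]_(m, n)) :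
  (\sum_(i | P i) F i)^t* = \sum_(i | P i) (F i)^t*.
Proof. by rewrite raddf_sum raddf_sum. Qed.

Lemma trmxCB m n (A B : 'M[C]_(m, n)) : (A - B)^t* = A^t* - B^t*.
Proof. by rewrite raddfB raddfB. Qed.

(** A reflected space lies in the direct sum of the neighbouring spaces. This provides one ambient
    space, the sum of #|I| copies of the old one, in which all new spaces live. *)
Lemma orthogonal_embeddings (I : finType) n :
  exists N (e : I -> 'M[C]_(N, n)) (t : I -> 'M[C]_(n, N)),
    (forall i j, t i *m e j = if i == j then 1%:M else 0) /\ forall i, (e i)^t* = t i.
Proof.
pose e (i : I) : 'M[C]_(#|I| * n, n) :=
  \matrix_(x, y) (x == mxvec_index (enum_rank i) y)%:R.
exists _, e, (fun i => (e i)^t*); split=> // i j; apply/matrixP=> x y.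
rewrite mxE (bigD1 (mxvec_index (enum_rank i) x)) //= !mxE eqxx rmorph1 mul1r big1 ?addr0.
  have eqE : (mxvec_index (enum_rank i) x == mxvec_index (enum_rank j) y) = (i == j) && (x == y).
    apply/eqP/andP => [eq_xy|[/eqP-> /eqP->]] //.
    by have [/enum_rank_inj-> ->] := enum_rank_inj (cast_ord_inj eq_xy).
  by rewrite eqE; case: eqP => _; rewrite !mxE.
by move=> z /negPf zi; rewrite !mxE zi rmorph0 mul0r.
Qed.

(** * Reflection functors at an independent set of vertices *)

Section Flip.
Variables (n : nat) (S : vertex G -> 'M[C]_n) (w : vertex G -> vertex G -> 'M[C]_n).
Variables (d : vec G int) (f f' : vec G C) (J : pred (vertex G)) (a b : vertex G -> C).
Hypothesis repw : scalar_rep S w d f.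
Hypothesis indepJ : forall g h, adjacent g h -> J g -> J h = false.
Hypothesis f_neq0 : forall g, J g -> f g != 0.
Hypothesis a_neq0 : forall g, J g -> a g != 0.
Hypothesis b_neq0 : forall g, J g -> b g != 0.
Hypothesis f'J : forall g, J g -> f' g = a g * b g.
Hypothesis f'N : forall h, J h = false ->
  \sum_(g | adjacent h g) (if J g then (a g * b g) *: (S h - (f g)^-1 *: (w h g *m w g h))
                           else w h g *m w g h) = f' h *: S h.

Variables (N : nat) (e : vertex G -> 'M[C]_(N, n)) (t : vertex G -> 'M[C]_(n, N)).
Hypothesis te : forall g h, t g *m e h = if g == h then 1%:M else 0.

Let p h := e h *m S h *m t h.
Let Sg g := \sum_(h | adjacent g h) p h.
Let Gm g := \sum_(h | adjacent g h) w g h *m t h.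
Let Gt g := \sum_(h | adjacent g h) e h *m w h g.

(** Going from g into the sum of its neighbours and back is f_g, so the opposite composite divided
    by f_g is idempotent with image a copy of the space at g. The new space at g is the complement
    of that copy, and the new maps are its inclusion and projection, scaled by a and b. *)
Definition flip_S g := if J g then Sg g - (f g)^-1 *: (Gt g *m Gm g) else p g.
Definition flip_w g h :=
  if J g then a g *: (flip_S g *m flip_S h)
  else if J h then b h *: (flip_S g *m flip_S h) else e g *m w g h *m t h.

Let SS g : S g *m S g = S g. Proof. exact: (rep_idem repw). Qed.
Let Sw g h : adjacent g h -> S g *m w g h = w g h. Proof. exact: (rep_srcK repw). Qed.
Let wS g h : adjacent g h -> w g h *m S h = w g h. Proof. exact: (rep_tgtK repw). Qed.
Let wS' g h : adjacent g h -> w h g *m S g = w h g.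
Proof. by rewrite adjacentC; apply: wS. Qed.
Let Sw' g h : adjacent g h -> S h *m w h g = w h g.
Proof. by rewrite adjacentC; apply: Sw. Qed.

Let teh h m (X : 'M[C]_(n, m)) : t h *m (e h *m X) = X.
Proof. by rewrite mulmxA te eqxx mul1mx. Qed.

Let pe h k : p h *m e k = if h == k then e h *m S h else 0.
Proof. by rewrite /p -mulmxA te; case: eqP; rewrite ?mulmx1 ?mulmx0. Qed.

Let tp h k : t h *m p k = if h == k then S h *m t h else 0.
Proof. by rewrite /p !mulmxA te; case: eqP => [->|]; rewrite ?mul1mx ?mul0mx. Qed.

Let pp h k : p h *m p k = if h == k then p h else 0.
Proof.
rewrite {2}/p !mulmxA pe; case: eqP => [<-|]; last by rewrite !mul0mx.
by rewrite -(mulmxA (e h)) SS.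
Qed.

Let sum_if g h m q (F : vertex G -> 'M[C]_(m, q)) : adjacent g h ->
  \sum_(k | adjacent g k) (if h == k then F k else 0) = F h.
Proof.
move=> gh; rewrite (bigD1 h) //= eqxx big1 ?addr0 // => k /andP[_ /negPf].
by rewrite eq_sym => ->.
Qed.

Let sum_if' g h m q (F : vertex G -> 'M[C]_(m, q)) : adjacent g h ->
  \sum_(k | adjacent g k) (if k == h then F k else 0) = F h.
Proof.
by move=> gh; rewrite -(sum_if F gh); apply: eq_bigr => k _; rewrite eq_sym.
Qed.

Let pSg g h : adjacent g h -> p h *m Sg g = p h.
Proof.
move=> gh; rewrite mulmx_sumr -[RHS](sum_if p gh).
by apply: eq_bigr => k _; rewrite pp; case: eqP => [->|].
Qed.

Let Sgp g h : adjacent g h -> Sg g *m p h = p h.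
Proof.
move=> gh; rewrite mulmx_suml -[RHS](sum_if' p gh).
by apply: eq_bigr => k _; rewrite pp.
Qed.

Let SgSg g : Sg g *m Sg g = Sg g.
Proof. by rewrite {1}/Sg mulmx_suml; apply: eq_bigr => h /pSg. Qed.

Let tGt g h : adjacent g h -> t h *m Gt g = w h g.
Proof.
move=> gh; rewrite mulmx_sumr -[RHS](sum_if (w^~ g) gh); apply: eq_bigr => k _.
by rewrite mulmxA te; case: eqP => _; rewrite ?mul1mx ?mul0mx.
Qed.

Let Gme g h : adjacent g h -> Gm g *m e h = w g h.
Proof.
move=> gh; rewrite mulmx_suml -[RHS](sum_if' (w g) gh); apply: eq_bigr => k _.
by rewrite -mulmxA te; case: eqP => _; rewrite ?mulmx1 ?mulmx0.
Qed.

Let SgGt g : Sg g *m Gt g = Gt g.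
Proof.
rewrite mulmx_suml; apply: eq_bigr => h gh.
by rewrite /p -!mulmxA tGt // Sw'.
Qed.

Let GmSg g : Gm g *m Sg g = Gm g.
Proof.
rewrite mulmx_sumr; apply: eq_bigr => h gh.
by rewrite /p !mulmxA Gme // wS.
Qed.

Let GmGt g : Gm g *m Gt g = f g *: S g.
Proof.
rewrite -(rep_scal repw) mulmx_suml; apply: eq_bigr => h gh.
by rewrite -mulmxA tGt.
Qed.

Let SGm g : S g *m Gm g = Gm g.
Proof. by rewrite mulmx_sumr; apply: eq_bigr => h gh; rewrite mulmxA Sw. Qed.

Let P_J g : J g -> flip_S g = Sg g - (f g)^-1 *: (Gt g *m Gm g).
Proof. by rewrite /flip_S => ->. Qed.

Let P_N g : J g = false -> flip_S g = p g.
Proof. by rewrite /flip_S => ->. Qed.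

Let SgP g : J g -> Sg g *m flip_S g = flip_S g.
Proof. by move=> gJ; rewrite P_J // mulmxBr SgSg -scalemxAr mulmxA SgGt. Qed.

Let PSg g : J g -> flip_S g *m Sg g = flip_S g.
Proof. by move=> gJ; rewrite P_J // mulmxBl SgSg -scalemxAl -mulmxA GmSg. Qed.

Lemma flip_idem g : flip_S g *m flip_S g = flip_S g.
Proof.
case gJ: (J g); last by rewrite P_N // pp eqxx.
rewrite {1}P_J // mulmxBl SgP // -scalemxAl P_J // mulmxBr.
rewrite -[_ *m Sg g]mulmxA GmSg -scalemxAr -[Gt g *m Gm g *m _]mulmxA.
rewrite [Gm g *m (Gt g *m _)]mulmxA GmGt -scalemxAl SGm -scalemxAr scalerA.
by rewrite mulVf ?f_neq0 // scale1r subrr scaler0 subr0.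
Qed.

Lemma flip_srcK g h : adjacent g h -> flip_S g *m flip_w g h = flip_w g h.
Proof.
move=> gh; rewrite /flip_w; case gJ: (J g); first by rewrite -scalemxAr mulmxA flip_idem.
case hJ: (J h); first by rewrite -scalemxAr mulmxA flip_idem.
by rewrite P_N // /p -!mulmxA teh [S g *m (_ *m _)]mulmxA Sw.
Qed.

Lemma flip_tgtK g h : adjacent g h -> flip_w g h *m flip_S h = flip_w g h.
Proof.
move=> gh; rewrite /flip_w; case gJ: (J g); first by rewrite -scalemxAl -mulmxA flip_idem.
case hJ: (J h); first by rewrite -scalemxAl -mulmxA flip_idem.
by rewrite P_N // /p -!mulmxA teh [w g h *m (_ *m _)]mulmxA wS.
Qed.

Let wJ g h : adjacent g h -> J g -> flip_w g h *m flip_w h g = (a g * b g) *: (flip_S g *m p h *m flip_S g).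
Proof.
move=> gh gJ; have hJ := indepJ gh gJ; rewrite /flip_w gJ hJ (P_N hJ).
by rewrite -scalemxAl -scalemxAr scalerA mulmxA -(mulmxA (flip_S g) (p h) (p h)) pp eqxx.
Qed.

Let wN g h : adjacent g h -> J g -> flip_w h g *m flip_w g h =
  e h *m ((a g * b g) *: (S h - (f g)^-1 *: (w h g *m w g h))) *m t h.
Proof.
move=> gh gJ; have hJ := indepJ gh gJ; rewrite /flip_w gJ hJ (P_N hJ).
rewrite -scalemxAl -scalemxAr scalerA [b g * _]mulrC -scalemxAr -scalemxAl; congr (_ *: _).
rewrite -mulmxA [flip_S g *m (_ *m _)]mulmxA flip_idem P_J // mulmxBl mulmxBr.
rewrite Sgp // pp eqxx mulmxBr mulmxBl -[e h *m S h *m t h]/(p h); congr (_ - _).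
rewrite -!(scalemxAl, scalemxAr); congr (_ *: _).
rewrite /p -!mulmxA [Gm g *m (e h *m _)]mulmxA Gme // [w g h *m (S h *m _)]mulmxA wS //.
by rewrite [t h *m (Gt g *m _)]mulmxA tGt // [S h *m (w h g *m _)]mulmxA Sw'.
Qed.

Lemma flip_scal g : \sum_(h | adjacent g h) flip_w g h *m flip_w h g = f' g *: flip_S g.
Proof.
case gJ: (J g).
  under eq_bigr => h gh do rewrite wJ //.
  by rewrite -scaler_sumr -mulmx_suml -mulmx_sumr -/(Sg g) PSg // flip_idem f'J.
rewrite (P_N gJ) /p [RHS](_ : _ = e g *m (f' g *: S g) *m t g); last first.
  by rewrite -scalemxAr -scalemxAl.
rewrite -(f'N gJ) mulmx_sumr mulmx_suml; apply: eq_bigr => h gh.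
case hJ: (J h); first by rewrite wN // adjacentC.
by rewrite /flip_w gJ hJ -!mulmxA teh.
Qed.

Lemma flip_dim g : \tr (flip_S g) = (reflect_on J d g)%:~R.
Proof.
have trp h : \tr (p h) = (d h)%:~R.
  by rewrite /p mxtrace_mulC mulmxA te eqxx mul1mx (rep_dim repw).
rewrite ffunE; case: ifP => gJ; last by rewrite P_N.
rewrite P_J // linearB linearZ /= mxtrace_mulC GmGt linearZ /= mulrA mulVf ?f_neq0 // mul1r.
rewrite (rep_dim repw) /reflect_at addrC rmorphD rmorphN; congr (_ + _).
by rewrite /Sg raddf_sum rmorph_sum; apply: eq_bigr => h _; apply: trp.
Qed.

(** A subrepresentation U' of the reflected representation is kept at the fixed vertices; at a
    reflected vertex it is replaced by the sum of the images of its neighbours. This yields a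
    subrepresentation U of the original one. *)
Lemma flip_simple : simple_rep flip_S flip_w.
Proof.
have [[g0 Sg0] simpS] := rep_simple repw; split.
  apply/existsP; apply: contraT => /existsPn P0; case/eqP: Sg0.
  have S0 h : J h = false -> S h = 0.
    move=> hJ; have := P0 h; rewrite negbK P_N // => /eqP ph0.
    have : t h *m p h *m e h = 0 by rewrite ph0 mulmx0 mul0mx.
    by rewrite tp eqxx -mulmxA te eqxx mulmx1.
  case gJ: (J g0); last exact: S0.
  apply: (scalerI (f_neq0 gJ)); rewrite scaler0 -(rep_scal repw) big1 // => h gh.
  by rewrite -(wS gh) (S0 _ (indepJ gh gJ)) mulmx0 mul0mx.
move=> U' leU U'w.
pose U h : 'M[C]_n := if J h then (\sum_(k | adjacent h k) <<U' k *m e k *m w k h>>)%MS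
            else <<U' h *m e h>>%MS.
have UN h : J h = false -> (U h :=: U' h *m e h)%MS.
  by rewrite /U => ->; exact: genmxE.
have U'p h : J h = false -> U' h *m e h *m t h = U' h.
  move=> hJ; have := leU h; rewrite P_N // => /submxP[X ->].
  by rewrite -(mulmxA X) pe eqxx -mulmxA.
have U'ek h k : J h = false -> (U' h *m e k <= U' k *m e k)%MS.
  move=> hJ; have [->//|/negPf hk] := eqVneq h k.
  by rewrite -(U'p _ hJ) -!mulmxA te hk !mulmx0 sub0mx.
have U'S h : J h = false -> U' h *m p h = U' h.
  move=> hJ; have := leU h; rewrite P_N // => /submxP[X ->].
  by rewrite -mulmxA pp eqxx.
(* The old path h, g, k is a combination of the embedding of U' h and the new path h, g, k, under
   both of which U' is stable. *)
have JU g k : adjacent g k -> J g -> (U g *m w g k <= U k)%MS.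
  move=> gk gJ; have kJ := indepJ gk gJ; rewrite (UN _ kJ) /U gJ sumsmxMr.
  apply/sumsmx_subP => h gh; have hJ := indepJ gh gJ.
  rewrite (eqmxMr _ (genmxE _)).
  have UP : U' h *m flip_S g *m e k =
      U' h *m e k - (f g)^-1 *: (U' h *m e h *m w h g *m w g k).
    have USg : U' h *m Sg g = U' h by rewrite -{1}(U'S _ hJ) -mulmxA pSg // U'S.
    rewrite P_J // mulmxBr mulmxBl USg.
    congr (_ - _); rewrite -scalemxAr -scalemxAl; congr (_ *: _).
    rewrite -{1}(U'S _ hJ) /p -!mulmxA Gme // [t h *m (Gt g *m _)]mulmxA tGt //.
    by rewrite [S h *m (w h g *m _)]mulmxA Sw'.
  have PP : U' h *m flip_w h g *m flip_w g k *m e k =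
      (a g * b g) *: (U' h *m flip_S g *m e k).
    rewrite /flip_w gJ hJ (P_N hJ) (P_N kJ) -!scalemxAr -!scalemxAl scalerA; congr (_ *: _).
    rewrite (mulmxA (U' h) (p h)) U'S // (mulmxA _ _ (p k)) -(mulmxA (U' h)) flip_idem.
    have PSe : Sg g *m e k = p k *m e k.
      by rewrite mulmx_suml (bigD1 k) //= big1 ?addr0 // => l /andP[_ /negPf lk]; rewrite pe lk.
    rewrite -[in RHS](PSg gJ) -(mulmxA (U' h) (_ *m Sg g)) -(mulmxA _ (Sg g)) PSe.
    by move: (p k) => P; rewrite !mulmxA.
  have -> : U' h *m e h *m w h g *m w g k = f g *: (U' h *m e k) -
      (f g / (a g * b g)) *: (U' h *m flip_w h g *m flip_w g k *m e k).
    rewrite PP scalerA divfK ?mulf_neq0 ?a_neq0 ?b_neq0 // UP scalerBr opprB addrCA subrr addr0.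
    by rewrite scalerA mulfV ?f_neq0 // scale1r.
  rewrite addmx_sub ?scalemx_sub ?U'ek // eqmx_opp scalemx_sub // submxMr //.
  apply: submx_trans (U'w _ _ gk); apply: submxMr; apply: U'w.
  by rewrite adjacentC.
have [] := simpS U.
- move=> g; case gJ: (J g); last first.
    rewrite (UN _ gJ); have := leU g; rewrite P_N // => /submxP[X ->].
    by rewrite -mulmxA pe eqxx mulmxA submxMl.
  rewrite /U gJ; apply/sumsmx_subP => k gk; rewrite genmxE -(wS' gk).
  by rewrite mulmxA submxMl.
- move=> g h gh; case gJ: (J g); first exact: JU.
  rewrite (eqmxMr _ (UN _ gJ)); case hJ: (J h).
    rewrite /U hJ (sumsmx_sup g) 1?adjacentC //.
    by rewrite genmxE.
  have -> : U' g *m e g *m w g h = U' g *m (e g *m w g h *m t h) *m e h.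
    by rewrite -!mulmxA te eqxx mulmx1.
  rewrite (UN _ hJ); apply: submxMr.
  by have := U'w _ _ gh; rewrite /flip_w gJ hJ.
- move=> U0; left; have U'0 h : J h = false -> U' h = 0.
    move=> hJ; rewrite -(U'p _ hJ).
    have /eqP -> : U' h *m e h == 0 by rewrite -submx0 -(UN h hJ) U0.
    by rewrite mul0mx.
  move=> g; case gJ: (J g); last exact: U'0.
  have /submxP[X U'X] := leU g.
  (* At a reflected vertex the new scalar is a b, which is nonzero, so U' there is determined by
     what passes through the neighbours. *)
  have cg : a g * b g != 0 by rewrite mulf_neq0 ?a_neq0 ?b_neq0.
  have : U' g *m (f' g *: flip_S g) = 0.
    rewrite -flip_scal mulmx_sumr big1 // => h gh; rewrite mulmxA.
    suff -> : U' g *m flip_w g h = 0 by rewrite mul0mx.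
    by apply/eqP; rewrite -submx0 -(U'0 _ (indepJ gh gJ)) U'w.
  rewrite f'J // -scalemxAr U'X -mulmxA flip_idem => /eqP.
  by rewrite scaler_eq0 (negPf cg) => /eqP.
- move=> Ufull; right; have U'full h : J h = false -> (flip_S h <= U' h)%MS.
    move=> hJ; rewrite P_N // -(U'p _ hJ) /p -mulmxA mulmx_sub // submxMr //.
    by rewrite -(UN h hJ) Ufull.
  move=> g; case gJ: (J g); last exact: U'full.
  have cg : a g * b g != 0 by rewrite mulf_neq0 ?a_neq0 ?b_neq0.
  rewrite -[flip_S g]scale1r -(mulVf cg) -scalerA -f'J // -flip_scal scalemx_sub //.
  apply: summx_sub => h gh; rewrite -(flip_tgtK gh) -mulmxA mulmx_sub //.
  have hg : adjacent h g by rewrite adjacentC.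
  apply: submx_trans (submxMr _ (U'full _ (indepJ gh gJ))) _.
  exact: U'w.
Qed.

Lemma flip_hermitian : (forall g, (e g)^t* = t g) -> (forall g, J g -> (a g)^* = b g) ->
  (forall g, J g -> f g \is Num.real) ->
  hermitian_rep S w -> hermitian_rep flip_S flip_w.
Proof.
move=> et ab freal [hS hw].
have te' g : (t g)^t* = e g by rewrite -et trmxCK.
have hp g : (p g)^t* = p g by rewrite /p !trmxC_mul et te' hS mulmxA.
have hSg g : (Sg g)^t* = Sg g.
  by rewrite /Sg trmxC_sum; apply: eq_bigr => h _; rewrite hp.
have hGm g : (Gm g)^t* = Gt g.
  by rewrite /Gm trmxC_sum; apply: eq_bigr => h gh; rewrite trmxC_mul te' hw.
have hGt g : (Gt g)^t* = Gm g by rewrite -hGm trmxCK.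
have hP g : (flip_S g)^t* = flip_S g.
  rewrite /flip_S; case: ifP => gJ; last exact: hp.
  rewrite trmxCB hSg trmxC_scale trmxC_mul hGm hGt fmorphV /=.
  by rewrite (CrealP (freal g gJ)).
split=> // g h gh; rewrite /flip_w; case gJ: (J g).
  by rewrite (indepJ gh gJ) trmxC_scale ab // trmxC_mul !hP.
case hJ: (J h); first by rewrite trmxC_scale -ab // conjCK trmxC_mul !hP.
by rewrite !trmxC_mul et te' hw // mulmxA.
Qed.

Lemma flip_rep : scalar_rep flip_S flip_w (reflect_on J d) f'.
Proof.
split; [exact: flip_idem | exact: flip_srcK | exact: flip_tgtK | exact: flip_scal
  | exact: flip_dim | exact: flip_simple].
Qed.

End Flip.
End LocallyScalar.

(** Replaces the image of an idempotent by a coordinate space of dimension [r]. *)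
Lemma idem_factor (F : fieldType) n (A : 'M[F]_n) r : A *m A = A -> \rank A = r ->
  exists (u : 'M_(n, r)) (v : 'M_(r, n)), u *m v = A /\ v *m u = 1%:M.
Proof.
move=> AA <-; exists (col_base A), (row_base A); split; first exact: mulmx_base.
apply: (row_free_inj (row_base_free A)).
apply: (row_full_inj (col_base_full A)).
rewrite mul1mx (mulmxA (col_base A)) (mulmxA (col_base A) (row_base A)).
by rewrite mulmx_base -mulmxA mulmx_base AA.
Qed.

(** * Consequences of simplicity *)

Section RepTheory.
Local Open Scope sesquilinear_scope.
Variables (G : ext_dynkin) (col : vertex G -> bool) (C : numClosedFieldType).
Hypothesis hcol : proper_colouring col.
Implicit Types (d : vec G int) (f : vec G C).

Lemma mxtrace_idem n (A : 'M[C]_n) : A *m A = A -> \tr A = (\rank A)%:R.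
Proof.
move=> AA; have [u [v [uv vu]]] := idem_factor AA (erefl _).
by rewrite -{1}uv mxtrace_mulC vu mxtrace1.
Qed.

Lemma mxtrace_mulC_ge0 m n (A : 'M[C]_(m, n)) : 0 <= \tr (A *m A^t*).
Proof.
apply: sumr_ge0 => i _; rewrite mxE; apply: sumr_ge0 => j _.
by rewrite !mxE mul_conjC_ge0.
Qed.

Lemma mxtrace_mulC_eq0 m n (A : 'M[C]_(m, n)) : \tr (A *m A^t*) = 0 -> A = 0.
Proof.
move=> trA; apply/matrixP => i j; rewrite mxE.
have ge0 k l : 0 <= A k l * (A^t*) l k by rewrite !mxE mul_conjC_ge0.
have ge0' k : 0 <= (A *m A^t*) k k by rewrite mxE sumr_ge0.
have /(_ i isT) := psumr_eq0P (fun k _ => ge0' k) trA; rewrite mxE.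
move/(psumr_eq0P (fun l _ => ge0 i l))/(_ j isT)/eqP.
by rewrite !mxE mul_conjC_eq0 => /eqP.
Qed.

Section OneRep.
Variables (n : nat) (S : vertex G -> 'M[C]_n) (w : vertex G -> vertex G -> 'M[C]_n).
Variables (d : vec G int) (f : vec G C).
Hypothesis repw : scalar_rep S w d f.

Lemma rep_rank g : d g = (\rank (S g))%:Z.
Proof.
apply: (mulrIz (oner_neq0 C)); rewrite -(rep_dim repw) mxtrace_idem //.
exact: (rep_idem repw).
Qed.

Lemma rep_dim_ge0 g : 0 <= d g. Proof. by rewrite rep_rank. Qed.

Lemma rep_dim_eq0 g : (d g == 0) = (S g == 0).
Proof. by rewrite rep_rank -mxrank_eq0. Qed.

Lemma rep_submx g h : adjacent g h -> (w g h <= S h)%MS.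
Proof. by move=> gh; rewrite -(rep_tgtK repw gh) submxMl. Qed.

(** The trace of a path along an edge and back is the same seen from either end; sum over all
    edges. *)
Lemma rep_trace b :
  \sum_(g | col g == b) f g * (d g)%:~R = \sum_(g | col g == ~~ b) f g * (d g)%:~R.
Proof.
have fd g : f g * (d g)%:~R = \sum_(h | adjacent g h) \tr (w g h *m w h g).
  by rewrite -(rep_dim repw) -linear_sum /= (rep_scal repw) linearZ.
under eq_bigr => g _ do rewrite fd.
rewrite (sum_adj_swap hcol) ?negbK; apply: eq_bigr => h _.
by rewrite fd; apply: eq_bigr => g _; rewrite mxtrace_mulC.
Qed.

(** All maps vanish, so any line in the space at g is a subrepresentation. *)
Lemma rep_concentrated g : (forall h, h != g -> S h = 0) -> d = unit_vec g.
Proof.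
move=> S0; have [[g0 Sg0] simpS] := rep_simple repw.
have {}Sg0 : S g != 0 by move: Sg0; have [->|/S0->] := eqVneq g0 g; rewrite ?eqxx.
pose U h : 'M[C]_n := if h == g then <<nz_row (S g)>>%MS else 0.
have rank1 : \rank (U g) = 1%N.
  by rewrite /U eqxx genmxE rank_rV nz_row_eq0 Sg0.
have [h|h k hk|U0|Ufull] := simpS U.
- by rewrite /U; case: eqP => [->|_]; rewrite ?sub0mx // genmxE nz_row_sub.
- suff -> : w h k = 0 by rewrite mulmx0 sub0mx.
  have [kg|/S0 Sk] := eqVneq k g; last by rewrite -(rep_tgtK repw hk) Sk mulmx0.
  have hg : h != g by apply: contraTneq hk => ->; rewrite kg adjacentxx.
  by rewrite -(rep_srcK repw hk) S0 // mul0mx.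
- by move: rank1; rewrite U0 mxrank0.
apply/ffunP => h; rewrite unit_vecE rep_rank.
have [->|/S0->] := eqVneq h g; last by rewrite mxrank0.
suff -> : \rank (S g) = 1%N by [].
apply/eqP; rewrite eqn_leq lt0n mxrank_eq0 Sg0 andbT -rank1.
exact: mxrankS.
Qed.

(** Let A go from g into the sum P of its neighbours and B go back; f_g = 0 says A B = 0. If A were
    injective and B surjective, then 2 d_g would be at most the dimension of P. Otherwise the kernel
    of A, or the image of B at g together with everything elsewhere, is a subrepresentation that
    forces all other spaces to vanish. *)
Lemma rep_scal_eq0 g : f g = 0 -> nbr_sum d g < 2%:R * d g -> d = unit_vec g.
Proof.
move=> fg0 lt_d; have [_ simpS] := rep_simple repw.
have [N [e [t [te _]]]] := orthogonal_embeddings C (vertex G) n.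
pose P := \sum_(h | adjacent g h) e h *m S h *m t h.
pose A := \sum_(h | adjacent g h) w g h *m t h.
pose B := \sum_(h | adjacent g h) e h *m w h g.
have sum_if h m q (F : vertex G -> 'M[C]_(m, q)) : adjacent g h ->
    \sum_(k | adjacent g k) (if h == k then F k else 0) = F h.
  move=> gh; rewrite (bigD1 h) //= eqxx big1 ?addr0 // => k /andP[_ /negPf].
  by rewrite eq_sym => ->.
have tB h : adjacent g h -> t h *m B = w h g.
  move=> gh; rewrite mulmx_sumr -[RHS](sum_if _ _ _ (w^~ g) gh); apply: eq_bigr => k _.
  by rewrite mulmxA te; case: eqP => _; rewrite ?mul1mx ?mul0mx.
have Ae h : adjacent g h -> A *m e h = w g h.
  move=> gh; rewrite mulmx_suml -[RHS](sum_if _ _ _ (w g) gh); apply: eq_bigr => k _.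
  by rewrite -mulmxA te eq_sym; case: eqP => _; rewrite ?mulmx1 ?mulmx0.
have PB : P *m B = B.
  rewrite mulmx_suml; apply: eq_bigr => h gh.
  by rewrite -!mulmxA tB // (rep_srcK repw) // adjacentC.
have AP : A *m P = A.
  rewrite mulmx_sumr; apply: eq_bigr => h gh.
  by rewrite !mulmxA Ae // (rep_tgtK repw).
have AB : A *m B = 0.
  transitivity (f g *: S g); last by rewrite fg0 scale0r.
  rewrite -(rep_scal repw) mulmx_suml; apply: eq_bigr => h gh.
  by rewrite -mulmxA tB.
have SA : S g *m A = A.
  by rewrite mulmx_sumr; apply: eq_bigr => h gh; rewrite mulmxA (rep_srcK repw).
have PP : P *m P = P.
  rewrite mulmx_suml; apply: eq_bigr => h gh; rewrite -!mulmxA mulmx_sumr.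
  rewrite (eq_bigr (fun k => if h == k then S h *m t h else 0)) ?sum_if //; last first.
    move=> k _; rewrite !mulmxA te; case: eqP => [->|]; by rewrite ?mul1mx ?mul0mx.
  by rewrite (mulmxA (S h)) (rep_idem repw).
have rankP : (\rank P)%:Z = nbr_sum d g.
  apply/eqP; rewrite -(eqr_int C) -[(\rank P)%:~R]mxtrace_idem //; apply/eqP.
  rewrite [LHS]raddf_sum rmorph_sum /=.
  apply: eq_bigr => h _; rewrite -(rep_dim repw) -mulmxA mxtrace_mulC -mulmxA te eqxx.
  by rewrite mulmx1.
have conc : (forall h, h != g -> S h = 0) -> d = unit_vec g by exact: rep_concentrated.
have [injA|/eqP nInj] := eqVneq (S g :&: kermx A)%MS 0; last first.
  pose U h : 'M[C]_n := if h == g then (S g :&: kermx A)%MS else 0.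
  have [h|h k hk|U0|Ufull] := simpS U.
  - by rewrite /U; case: eqP => [->|_]; rewrite ?sub0mx // capmxSl.
  - rewrite /U; case: (eqVneq h g) hk => [->|_] hk; last by rewrite mul0mx sub0mx.
    suff -> : (S g :&: kermx A)%MS *m w g k = 0 by rewrite sub0mx.
    rewrite -Ae // mulmxA; have /sub_kermxP -> : (S g :&: kermx A <= kermx A)%MS := capmxSr _ _.
    by rewrite mul0mx.
  - by case: nInj; have := U0 g; rewrite /U eqxx => ->.
  apply: conc => h hg; have := Ufull h; rewrite /U (negPf hg) submx0.
  by move/eqP.
have [surB|nSur] := boolP (S g <= B)%MS; last first.
  pose U h : 'M[C]_n := if h == g then <<B>>%MS else S h.
  have BSg : (B <= S g)%MS.
    by apply: summx_sub => h gh; rewrite mulmx_sub // rep_submx // adjacentC.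
  have [h|h k hk|U0|Ufull] := simpS U.
  - by rewrite /U; case: eqP => [->|_]; rewrite ?submx_refl // genmxE.
  - rewrite {2}/U; case: (eqVneq k g) hk => [->|_] hk; last first.
      by rewrite -(rep_tgtK repw hk) mulmxA submxMl.
    have gh : adjacent g h by rewrite adjacentC.
    by rewrite genmxE -tB // mulmxA submxMl.
  - by apply: conc => h hg; have := U0 h; rewrite /U (negPf hg).
  by case/negP: nSur; have := Ufull g; rewrite /U eqxx genmxE.
have rankA : \rank A = \rank (S g).
  have := mxrank_mul_ker (S g) A; rewrite SA => <-.
  by rewrite injA mxrank0 addn0.
have rankAB : (\rank A + \rank B <= \rank P)%N.
  rewrite -(mxrank_mul_ker P B) PB addnC leq_add2l; apply: mxrankS.
  by rewrite sub_capmx -{1}AP submxMl /= sub_kermx AB eqxx.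
have := mxrankS surB; move: lt_d; rewrite -rankP rep_rank.
move: rankAB; rewrite rankA => h1 h2 h3; exfalso; move: h1 h2 h3; lia.
Qed.

End OneRep.
End RepTheory.

(** * Dimension vectors and scalars that admit representations *)

Section Existence.
Local Open Scope sesquilinear_scope.
Variables (G : ext_dynkin) (col : vertex G -> bool) (C : numClosedFieldType).
Hypothesis hcol : proper_colouring col.
Implicit Types (d : vec G int) (f : vec G C).

Definition has_rep d f : Prop := exists n S w, @scalar_rep G C n S w d f.

Definition has_unitary_rep d f : Prop :=
  exists n S w, @scalar_rep G C n S w d f /\ hermitian_rep S w.

Lemma unitary_has_rep d f : has_unitary_rep d f -> has_rep d f.
Proof. by move=> [n [S [w [repw _]]]]; exists n, S, w. Qed.

Lemma has_rep_dim_ge0 d f : has_rep d f -> forall g, 0 <= d g.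
Proof. by move=> [n [S [w repw]]] g; exact: rep_dim_ge0 repw g. Qed.

Lemma has_rep_trace d f b : has_rep d f ->
  \sum_(g | col g == b) f g * (d g)%:~R = \sum_(g | col g == ~~ b) f g * (d g)%:~R.
Proof. by move=> [n [S [w repw]]]; exact: (rep_trace hcol repw). Qed.

(** The choice a b = -f_i lowers the scalar by f_i at each neighbour and leaves the other vertices
    alone. With signs +f and -f on the two colours, f undergoes the simple reflection dual to that
    of d. *)
Lemma has_rep_reflect d f i : has_rep d f -> f i != 0 ->
  has_rep (reflect_on (pred1 i) d)
    [ffun g => if g == i then - f i else if adjacent i g then f g - f i else f g].
Proof.
move=> [n [S [w repw]]] fi0.
have [N [e [t [te _]]]] := orthogonal_embeddings C (vertex G) n.
eexists _, _, _; apply: (flip_rep (J := pred1 i) (a := fun _ => 1) (b := fun g => - f g) repw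
  _ _ _ _ _ _ te) => //=.
- by move=> g h gh /eqP eg; apply: contraTF gh => /eqP->; rewrite eg adjacentxx.
- by move=> g /eqP->.
- by move=> g _; rewrite oner_neq0.
- by move=> g /eqP->; rewrite oppr_eq0.
- by move=> g /eqP->; rewrite ffunE eqxx mul1r.
move=> h hi; rewrite ffunE hi.
transitivity (\sum_(g | adjacent h g) w h g *m w g h -
   \sum_(g | adjacent h g) (if g == i then f i *: S h else 0)).
  rewrite -sumrB; apply: eq_bigr => g _; case: eqP => [->|_]; last by rewrite subr0.
  by rewrite mul1r scalerBr scalerA mulNr mulfV // !scaleNr scale1r opprK addrC.
rewrite (rep_scal repw) -big_mkcondr /=; case: ifP => ih.
  rewrite (big_pred1 i) ?scalerBl // => g /=.
  by case: eqP => [->|]; rewrite ?andbF // adjacentC ih.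
rewrite big_pred0 ?subr0 // => g.
by case: eqP => [->|]; rewrite ?andbF // adjacentC ih.
Qed.

Lemma has_rep_scal_eq0 d f g : has_rep d f -> f g = 0 ->
  nbr_sum d g < 2%:R * d g -> d = unit_vec g.
Proof. by move=> [n [S [w repw]]] fg lt_d; exact (rep_scal_eq0 repw fg lt_d). Qed.

Lemma unitary_scal_ge0 d f g : has_unitary_rep d f -> d g != 0 -> 0 <= f g.
Proof.
move=> [n [S [w [repw [_ hw]]]]] dg.
have dg_gt0 : 0 < (d g)%:~R :> C by rewrite ltr0z lt_def dg (rep_dim_ge0 repw).
rewrite -(pmulr_lge0 _ dg_gt0) -(rep_dim repw) -linearZ /= -(rep_scal repw) linear_sum.
by apply: sumr_ge0 => h gh; rewrite /= -(hw g h) // mxtrace_mulC_ge0.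
Qed.

(** Unlike [rep_scal_eq0] this needs no inequality on dimensions: f_g = 0 is a sum of squared norms
    of the maps leaving g, so these vanish and the space at g is a subrepresentation. *)
Lemma unitary_scal_eq0 d f g : has_unitary_rep d f -> d g != 0 -> f g = 0 ->
  d = unit_vec g.
Proof.
move=> [n [S [w [repw [_ hw]]]]] dg fg0.
have w0 h : adjacent g h -> w g h = 0.
  move=> gh; apply: mxtrace_mulC_eq0; rewrite hw //.
  have /(congr1 mxtrace) := rep_scal repw g; rewrite fg0 scale0r linear0 linear_sum /=.
  by move/psumr_eq0P => -> // k gk; rewrite -(hw g k) // mxtrace_mulC_ge0.
apply: (rep_concentrated repw) => h hg.
have [_ simpS] := rep_simple repw.
have [k|k l kl|U0|Ufull] := simpS (fun k => if k == g then S k else 0).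
- by case: eqP => _; rewrite ?sub0mx.
- case: (eqVneq k g) kl => [->|_] kl; last by rewrite mul0mx sub0mx.
  by rewrite w0 // mulmx0 sub0mx.
- by have /eqP := U0 g; rewrite eqxx -(rep_dim_eq0 repw) (negPf dg).
by have := Ufull h; rewrite (negPf hg) submx0 => /eqP.
Qed.

(** The factors a = b = sqrt f keep adjointness and leave f unchanged at the reflected vertices.
    Hence d moves at colour [b] while f moves at the opposite colour. *)
Lemma unitary_cox b d f : has_unitary_rep d f -> (forall g, col g = b -> 0 < f g) ->
  has_unitary_rep (cox col b d) (coxd col (~~ b) d f).
Proof.
move=> [n [S [w [repw hermw]]]] f_gt0.
have [N [e [t [te et]]]] := orthogonal_embeddings C (vertex G) n.
pose a g := sqrtC (f g).
have aa g : col g == b -> a g * a g = f g by move=> _; rewrite -expr2 sqrtCK.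
have a_gt0 g : col g == b -> 0 < a g by move=> /eqP gb; rewrite sqrtC_gt0 f_gt0.
eexists _, _, _; split.
  apply: (flip_rep (J := fun g => col g == b) (a := a) (b := a) repw _ _ _ _ _ _ te).
  - by move=> g h gh /eqP gb; rewrite (adj_col hcol gh) gb; case: (b).
  - by move=> g /eqP gb; rewrite gt_eqF ?f_gt0.
  - by move=> g gb; rewrite gt_eqF ?a_gt0.
  - by move=> g gb; rewrite gt_eqF ?a_gt0.
  - by move=> g gb; rewrite ffunE aa // (eqP gb); case: (b).
  move=> h hb; rewrite ffunE.
  have hNb : col h == ~~ b by move: hb; case: (b); case: (col h).
  rewrite hNb /=; have nbrb g : adjacent h g -> col g == b.
    by move=> hg; rewrite (adj_col hcol hg) (eqP hNb) negbK.
  case: eqP => /= [dh|dh]; last first.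
    rewrite coxE hNb /reflect_at addrC scalerDl scaleNr -(rep_scal repw) scaler_suml -sumrB.
    apply: eq_bigr => g hg; rewrite nbrb // aa ?nbrb // scalerBr scalerA mulfV ?scale1r //.
    by rewrite gt_eqF // f_gt0 //; apply/eqP/nbrb.
  have Sh : S h = 0 by apply/eqP; rewrite -(rep_dim_eq0 repw); apply/eqP; rewrite dh.
  rewrite Sh scaler0 big1 // => g hg; rewrite nbrb // aa ?nbrb //.
  by rewrite -(rep_srcK repw hg) Sh !mul0mx scaler0 subr0 scaler0.
apply: flip_hermitian => //.
- by move=> g h gh /eqP gb; rewrite (adj_col hcol gh) gb; case: (b).
- by move=> g gb; rewrite geC0_conj // ltW // a_gt0.
- by move=> g /eqP gb; rewrite ger0_real // ltW // f_gt0.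
Qed.

Lemma quad_pos_dir (x : vec G int) : 0 < quad col x -> (forall g, 0 <= x g) ->
  exists i, nbr_sum x i < 2%:R * x i.
Proof.
move=> q_gt0 x0; apply/existsP; apply: contraT => /existsPn le_nbr.
suff : 2%:R * quad col x <= 0 by lia.
rewrite quad_bilinear //; apply: sumr_le0 => g _.
by have := le_nbr g; rewrite -leNgt => le_g; rewrite mulr_ge0_le0 // subr_le0.
Qed.

(* Reflections at vertices where the scalar does not vanish lower the dimension
   until it is a simple root or lies in the fundamental region. *)
Lemma has_rep_quad d f : has_rep d f -> quad col d <= 1.
Proof.
move=> repd; have d0 := has_rep_dim_ge0 repd.
have [k] := ubnP `|height d|%N; elim: k d f repd d0 => // k IHk d f repd d0 lt_k.
have [|q_gt0] := leP (quad col d) 0; first by lia.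
have [i lt_i] := quad_pos_dir q_gt0 d0.
have [fi0|fi0] := eqVneq (f i) 0.
  by rewrite (has_rep_scal_eq0 repd fi0 lt_i) quad_unit_vec.
have repd' := has_rep_reflect repd fi0; have d'0 := has_rep_dim_ge0 repd'.
rewrite -(quad_reflect_on hcol (b := col i) (J := pred1 i)) => [|g /eqP->] //.
apply: (IHk _ _ repd' d'0); have := height_ge0 d'0.
have := height_ge0 d0; rewrite height_reflect1.
have : 0 < delta G i * (2%:R * d i - nbr_sum d i) by rewrite mulr_gt0 ?delta_gt0 // subr_gt0.
by lia.
Qed.

(** This is invariant under simultaneous reflection of f and x, and by the trace identity it
    vanishes when x is the dimension vector. *)
Definition pairing f (x : vec G int) : C :=
  \sum_g (if col g then f g else - f g) * (x g)%:~R.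

Lemma pairing_reflect f x i :
  pairing [ffun g => if g == i then - f i else if adjacent i g then f g - f i else f g]
    (reflect_on (pred1 i) x) = pairing f x.
Proof.
pose l g := if col g then f g else - f g.
rewrite /pairing (bigD1 i) //= [RHS](bigD1 i) //= !ffunE /= eqxx.
have -> : (if col i then - f i else - - f i) = - l i by rewrite /l; case: ifP.
rewrite (eq_bigr (fun g => l g * (x g)%:~R + (if adjacent i g then l i * (x g)%:~R else 0))).
  rewrite big_split /= -big_mkcondr [X in _ + (_ + X)](eq_bigl (adjacent i)) /=; last first.
    by move=> g; case: eqP => [->|]; rewrite ?adjacentxx ?andbF ?andbT.
  rewrite -mulr_sumr -rmorph_sum -/(nbr_sum x i) /reflect_at -/(nbr_sum x i) -/(l i).
  rewrite rmorphD rmorphN /=; ring.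
move=> g /negPf gi; rewrite !ffunE /= gi; case ig: (adjacent i g); last by rewrite addr0.
by rewrite -mulrDl /l (adj_col hcol ig); case: (col i) => /=; congr (_ * _); ring.
Qed.

(** Reflections lower x, and delta is fixed by them, so d keeps the form x + delta. Since d is
    positive everywhere it is not simple, which forbids f_i = 0 at a lowering vertex i. *)
Lemma no_shifted_real_root d f (x : vec G int) : has_rep d f -> d = shift x 1 ->
  (forall g, 0 <= x g) -> quad col x = 1 -> pairing f x = 0 -> False.
Proof.
have [k] := ubnP `|height x|%N; elim: k d f x => // k IHk d f x lt_k repd dE x0 q1 fx0.
have q_gt0 : 0 < quad col x by rewrite q1.
have [i lt_i] := quad_pos_dir q_gt0 x0.
have lt_i' : nbr_sum d i < 2%:R * d i.
  by rewrite -subr_gt0 dE nbr_shift // subr_gt0.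
have [fi0|fi0] := eqVneq (f i) 0.
  have d_gt0 g : 0 < d g.
    rewrite dE ffunE; have := delta_gt0 g; have := x0 g; lia.
  have [g gi] := vertex_neq i.
  by have := d_gt0 g; rewrite (has_rep_scal_eq0 repd fi0 lt_i') unit_vecE (negPf gi) ltxx.
have repd' := has_rep_reflect repd fi0.
have q' : quad col (reflect_on (pred1 i) x) = 1.
  by rewrite (quad_reflect_on hcol (b := col i)) // => g /eqP->.
have q'1 : quad col (reflect_on (pred1 i) x) <= 1 by rewrite q'.
have hx' : height (reflect_on (pred1 i) x) < height x.
  by rewrite height_reflect1 ltrBlDr ltrDl mulr_gt0 ?delta_gt0 // subr_gt0.
have [x'0|x'0] := root_sign hcol q'1.
  apply: (IHk _ _ _ _ repd' _ x'0 q'); last by rewrite pairing_reflect.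
    by have := height_ge0 x'0; have := height_ge0 x0; lia.
  apply/ffunP => g; rewrite shiftE !reflect_onE; case: ifP => [/eqP->|_]; last by rewrite dE shiftE.
  have := nbr_shift x 1 i; rewrite -dE /reflect_at -/(nbr_sum d i) -/(nbr_sum x i) dE shiftE.
  by rewrite -dE !mul1r; move: (x i) (delta G i) (nbr_sum d i) (nbr_sum x i) => ? ? ? ?; lia.
(* The reflection changed x only at i, yet x became nonpositive; so x lives at i alone, and its
   pairing with f is f_i x_i up to sign. *)
have xi g : g != i -> x g = 0.
  move=> /negPf gi; have := x'0 g; rewrite ffunE /= gi => xg.
  by apply/eqP; rewrite eq_le xg x0.
have xi0 : x i = 0.
  move: fx0; rewrite /pairing (bigD1 i) //= big1 => [|g /xi->]; last by rewrite mulr0.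
  move/eqP; rewrite addr0 mulf_eq0 intr_eq0 => /orP[|/eqP//].
  by case: (col i); rewrite ?oppr_eq0 (negPf fi0).
suff q0 : quad col x = 0 by rewrite q0 in q1.
rewrite /quad big1 // => g _; rewrite /quad_term.
have -> : x g = 0 by have [->|/xi] := eqVneq g i.
by rewrite mul0r expr0n if_same.
Qed.

End Existence.

(** * Coxeter walks *)

Section CoxeterWalk.
Local Open Scope complex_scope.
Variables (R : realType) (G : ext_dynkin) (col : vertex G -> bool).
Hypothesis hcol : proper_colouring col.
Implicit Types (d : vec G int) (f : vec G R) (b : bool) (t : vertex G).

Definition cvec f : vec G R[i] := [ffun g => (f g)%:C].

Lemma cvecE f g : cvec f g = (f g)%:C.
Proof. by rewrite ffunE. Qed.

Lemma coxdE (Z : zmodType) b d (f : vec G Z) g :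
  coxd col b d f g = if (col g == b) && (d g != 0) then reflect_at f g else f g.
Proof. by rewrite ffunE coxE; case: ifP => // /andP[->]. Qed.

Lemma coxd_cvec b d f : coxd col b d (cvec f) = cvec (coxd col b d f).
Proof.
apply/ffunP => g; rewrite cvecE !coxdE !cvecE; case: ifP => // _.
rewrite /reflect_at cvecE rmorphD rmorphN rmorph_sum /=; congr (_ + _).
by apply: eq_bigr => h _; rewrite cvecE.
Qed.

Lemma unit_rep_scal d (f : vec G R[i]) t : has_rep d f -> d = unit_vec t -> f t = 0.
Proof.
move=> [n [S [w repw]]] dt.
have St : S t != 0 by rewrite -(rep_dim_eq0 repw) dt unit_vecE eqxx.
apply/eqP; have /eqP := rep_scal repw t; rewrite big1 => [|h th].
  by rewrite eq_sym scaler_eq0 (negPf St) orbF.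
suff Sh : S h = 0 by rewrite -(rep_tgtK repw th) Sh mulmx0 mul0mx.
apply/eqP; rewrite -(rep_dim_eq0 repw) dt unit_vecE.
by have [ht|//] := eqVneq h t; rewrite ht adjacentxx in th.
Qed.

Definition positive f := forall g, 0 < f g.

(** Unitarity makes the new scalars nonnegative on the support of d'. A zero there forces a simple
    d', so the walk either stays positive or has just ended. *)
Lemma unitary_step b d f : has_unitary_rep d (cvec f) -> positive f ->
  has_unitary_rep (cox col b d) (cvec (coxd col (~~ b) d f)) /\
  (positive (coxd col (~~ b) d f) \/
   exists t, [/\ cox col b d = unit_vec t, col t = ~~ b
     & pos_off t (coxd col (~~ b) d f)]).
Proof.
move=> repd f_gt0; set d' := cox col b d; set f' := coxd col (~~ b) d f.
have repd' : has_unitary_rep d' (cvec f').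
  by rewrite -coxd_cvec; apply: unitary_cox => // g _; rewrite cvecE ltcR.
split=> //.
have d'E g : col g = ~~ b -> d' g = d g by rewrite coxE => ->; case: (b).
have f'_gt0 g : ~~ ((col g == ~~ b) && (d g != 0)) -> 0 < f' g.
  by rewrite coxdE => /negPf->.
have f'_ge0 g : 0 <= f' g.
  have [/andP[/eqP gb dg]|/f'_gt0/ltW//] := boolP ((col g == ~~ b) && (d g != 0)).
  have := unitary_scal_ge0 repd' (g := g); rewrite d'E // => /(_ dg).
  by rewrite cvecE lecR.
case: (boolP [forall g, 0 < f' g]) => [/forallP|]; first by left.
rewrite negb_forall => /existsP[t ft]; right; exists t.
have [/eqP tb dt] : col t == ~~ b /\ d t != 0.
  by apply/andP; apply: contraNT ft; apply: f'_gt0.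
have ft0 : f' t = 0 by apply/eqP; move: ft; rewrite lt_def f'_ge0 andbT negbK.
have d'_unit : d' = unit_vec t.
  by apply: unitary_scal_eq0 repd' _ _; rewrite ?cvecE ?ft0 // d'E.
split=> //; split=> // g gt; apply: f'_gt0; apply/negP => /andP[/eqP gb].
by rewrite -d'E // d'_unit unit_vecE (negPf gt).
Qed.

Lemma height_unit_cox b k t : col t = b -> (0 < k)%N ->
  height (cox_iter col b k (unit_vec t)) < 0.
Proof.
move=> tb k_gt0; have dt := delta_gt0 t.
rewrite height_cox_iter // height_unit_vec defect_unit_vec tb eqxx.
rewrite subr_lt0; have : 1 * delta G t < (2 * k)%:R * delta G t by rewrite ltr_pM2r //; lia.
by rewrite mul1r.
Qed.

(** The point is that the scalars stay positive up to the last step, and that their first zero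
    occurs exactly when d becomes e_t. *)
Lemma unitary_walk b k d f t : has_unitary_rep d (cvec f) -> positive f ->
  (0 < k)%N -> cox_iter col b k d = unit_vec t -> pos_off t (coxd_iter col (~~ b) k d f).
Proof.
elim: k b d f => // k IHk b d f repd f_gt0 _ /=; rewrite negbK.
have [repd' f'P] := unitary_step b repd f_gt0.
case: f'P => [f'_gt0|[h [d'E hb f'P]]] eq_t; last first.
  case: k {IHk} eq_t => /= [|k] eq_t.
    suff -> : t = h by [].
    move/ffunP/(_ t): eq_t; rewrite d'E !unit_vecE eqxx.
    by case: eqP.
  have := @height_unit_cox (~~ b) k.+1 h hb isT.
  by rewrite -[cox_iter _ _ _ _]/(cox_iter col (~~ ~~ b) k _) -d'E eq_t height_unit_vec ltNge ltW // delta_gt0.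
case: k IHk eq_t => [|k] IHk eq_t; last first.
  by have := IHk _ _ _ repd' f'_gt0 isT eq_t; rewrite negbK.
have := f'_gt0 t; have := unit_rep_scal (unitary_has_rep repd') eq_t.
by rewrite cvecE => /(congr1 (@complex.Re R)) /= ->; rewrite ltxx.
Qed.

Lemma unit_vec_unitary_rep t f : f t = 0 -> has_unitary_rep (unit_vec t) (cvec f).
Proof.
move=> ft; pose S g : 'M[R[i]]_1 := (g == t)%:R%:M.
pose w (_ _ : vertex G) : 'M[R[i]]_1 := 0; exists 1%N, S, w; split; last first.
  split=> [g|g h _]; last by rewrite /w trmx0 map_mx0.
  by rewrite /S tr_scalar_mx map_scalar_mx /= rmorph_nat.
split=> //.
- by move=> g; rewrite -scalar_mxM -natrM mulnb andbb.
- by move=> g h _; rewrite mulmx0.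
- by move=> g h _; rewrite mul0mx.
- move=> g; rewrite big1 => [|h _]; last by rewrite mulmx0.
  rewrite cvecE /S; case: eqP => [->|_]; first by rewrite ft scale0r.
  by rewrite raddf0 scaler0.
- by move=> g; rewrite /S mxtrace_scalar unit_vecE mulr1n; case: eqP.
split; first by exists t; apply/eqP => /matrixP/(_ 0 0)/eqP; rewrite /S !mxE !eqxx oner_eq0.
move=> U leU _; have [Ut|Ut] := eqVneq (U t) 0; [left|right] => g.
  have [->//|gt] := eqVneq g t; apply/eqP; rewrite -submx0.
  by have := leU g; rewrite /S (negPf gt) raddf0.
rewrite /S; case: eqP => [->|_]; last by rewrite raddf0 sub0mx.
by rewrite sub1mx /row_full eqn_leq rank_leq_col lt0n mxrank_eq0.
Qed.

Lemma coxdK b d (f : vec G R) : coxd col (~~ b) (cox col b d) (coxd col (~~ b) d f) = f.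
Proof.
apply/ffunP => g; rewrite coxdE; have [gb|gb] := eqVneq (col g) (~~ b); last first.
  by rewrite coxdE (negPf gb).
have -> : cox col b d g = d g by rewrite coxE gb; case: (b).
case: eqP => dg /=; first by rewrite coxdE gb dg !eqxx.
rewrite /reflect_at coxdE gb eqxx /=; case: eqP => //= _.
rewrite /reflect_at opprD opprK [X in _ + X](eq_bigr f) ?subrK // => h gh.
by rewrite coxdE (adj_col hcol gh) gb; case: (b).
Qed.

(** Start from the one-dimensional representation at t and reflect backwards. Positivity must be
    carried along, because each reflection needs f > 0 at its colour. *)
Lemma unitary_walk_back b k d f t : col t = b (+) odd k ->
  cox_iter col b k d = unit_vec t -> pos_off t (coxd_iter col (~~ b) k d f) ->
  has_unitary_rep d (cvec f) /\ forall g, g != t \/ (0 < k)%N -> 0 < f g.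
Proof.
elim: k b d f => [|k IHk] b d f tb /=.
  move=> -> [ft f_gt0]; split; first exact: unit_vec_unitary_rep.
  by move=> g [/f_gt0|].
rewrite negbK => d't f'P.
have [||repd' f'_gt0] := IHk (~~ b) (cox col b d) (coxd col (~~ b) d f) _ d't _.
- by rewrite tb /= addbN addNb.
- by rewrite negbK; exact: f'P.
(* When no steps remain, the zero of f' sits at t, which has the other colour. *)
have f'b_gt0 g : col g = b -> 0 < coxd col (~~ b) d f g.
  move=> gb; apply: f'_gt0; case: k tb {IHk d't f'P repd'} => [|k] tb; [left|by right].
  by apply: contra_eqN gb => /eqP ->; rewrite tb /= addbT; case: (b).
have repd : has_unitary_rep d (cvec f).
  rewrite -[d](coxK hcol b) -[f](coxdK b d) -coxd_cvec; apply: unitary_cox => // g gb.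
  by rewrite cvecE ltcR f'b_gt0.
split=> // g _; have [gb|gNb] := eqVneq (col g) b.
  by have := f'b_gt0 g gb; rewrite coxdE gb; case: (b).
have gb : col g = ~~ b by case: (col g) gNb; case: (b).
have [dg|dg] := eqVneq (d g) 0.
  have : 0 < coxd col (~~ b) d f g; last by rewrite coxdE dg eqxx andbF.
  apply: f'_gt0; case: k d't {tb IHk f'P repd' f'b_gt0} => [|k] d't; [left|by right].
  apply: contra_eqN dg => /eqP gt; have /= := d't.
  move/ffunP/(_ g); rewrite coxE gb unit_vecE gt eqxx; case: (b) => /= ->; by rewrite oner_neq0.
have f_ge0 : 0 <= f g by have := unitary_scal_ge0 repd dg; rewrite cvecE lecR.
rewrite lt_def f_ge0 andbT; apply/eqP => fg0.
have dE : d = unit_vec g by apply: unitary_scal_eq0 repd dg _; rewrite cvecE fg0.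
(* A zero of f would make d simple, but d is reached from e_t by walking away. *)
have := @cox_away _ _ hcol (~~ (b (+) odd k.+1)) t k.+1; rewrite negbK => /(_ tb isT)[_ /(_ g)].
have := cox_iterK hcol b k.+1 d; rewrite [cox_iter _ b _ _]/= d't => -> []; exact: dE.
Qed.

Lemma walk_terminates b d f : has_unitary_rep d (cvec f) -> positive f ->
  0 < defect col b d -> exists k t, (0 < k)%N /\ cox_iter col b k d = unit_vec t.
Proof.
move=> repd; have d0 := has_rep_dim_ge0 (unitary_has_rep repd).
have [n] := ubnP `|height d|%N; elim: n b d f repd d0 => // n IHn b d f repd d0 lt_n f_gt0 def_gt0.
have [repd' [f'_gt0|[t [d'E _ _]]]] := unitary_step b repd f_gt0; last by exists 1%N, t.
have d'0 := has_rep_dim_ge0 (unitary_has_rep repd').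
have [||k [t [_ d't]]] := IHn (~~ b) _ _ repd' d'0 _ f'_gt0 _; last by exists k.+1, t.
  by have := height_ge0 d'0; have := height_ge0 d0; rewrite height_cox //; lia.
by rewrite defect_cox.
Qed.

(** With x of defect 0 the vector d = x + delta keeps full support for ever. Then the restricted map
    c_d is the full Coxeter map on f, whose height changes by the same amount at every step but
    stays nonnegative. *)
Lemma height_linear n b d f (x : vec G int) : has_unitary_rep d (cvec f) -> positive f ->
  d = shift x 1 -> (forall g, 0 <= x g) -> quad col x <= 1 -> defect col b x = 0 ->
  0 <= height f - (2 * n)%:R * defect col (~~ b) f.
Proof.
elim: n b d f x => [|n IHn] b d f x repd f_gt0 dE x0 q1 def0.
  rewrite muln0 mul0r subr0; apply: sumr_ge0 => g _.
  by apply: mulr_ge0; [rewrite ler0z ltW // delta_gt0 | rewrite ltW].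
have d_gt0 g : 0 < d g.
  by rewrite dE shiftE; have := delta_gt0 g; have := x0 g; lia.
have d'E : cox col b d = shift (cox col b x) 1.
  apply/ffunP => u; rewrite shiftE !coxE; case: ifP => _; last by rewrite dE shiftE.
  have := nbr_shift x 1 u; rewrite -dE /reflect_at -/(nbr_sum d u) -/(nbr_sum x u) dE shiftE.
  by rewrite -dE !mul1r; move: (x u) (delta G u) (nbr_sum d u) (nbr_sum x u) => ? ? ? ?; lia.
(* A root has one sign, and x' has the same height as x; if x' is nonpositive, both heights are 0
   and x' = 0. *)
have x'0 g : 0 <= cox col b x g.
  have : quad col (cox col b x) <= 1 by rewrite quad_cox.
  case/(root_sign hcol) => // x'0; have : height (cox col b x) = height x.
    by rewrite height_cox // def0 mulr0 subr0.
  rewrite !height_int => hx; have le_x' u : delta G u * cox col b x u <= 0.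
    by rewrite mulr_ge0_le0 // ltW // delta_gt0.
  have ge_x u : 0 <= delta G u * x u by rewrite mulr_ge0 // ltW // delta_gt0.
  have /eqP : \sum_u - (delta G u * cox col b x u) = 0.
    apply/eqP; rewrite eq_le; apply/andP; split.
      by rewrite sumrN hx oppr_le0 sumr_ge0.
    by apply: sumr_ge0 => u _; rewrite oppr_ge0.
  rewrite psumr_eq0 => [/allP /(_ g (mem_index_enum _))|u _]; last by rewrite oppr_ge0.
  by rewrite /= oppr_eq0 mulf_eq0 (gt_eqF (delta_gt0 g)) => /eqP->.
have [repd' [f'_gt0|[t [d't _ _]]]] := unitary_step b repd f_gt0; last first.
  have [g gt] := vertex_neq t; have := congr1 (fun y : vec G int => y g) d't.
  rewrite /= d'E shiftE unit_vecE (negPf gt); have := x'0 g; have := delta_gt0 g.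
  by move: (cox col b x g) (delta G g) => ? ?; lia.
have := IHn (~~ b) _ _ _ repd' f'_gt0 d'E x'0 _ _; rewrite quad_cox // defect_cox // negbK.
have -> : coxd col (~~ b) d f = cox col (~~ b) f.
  by apply/ffunP => g; rewrite coxdE coxE (gt_eqF (d_gt0 g)) andbT.
move=> /(_ q1 def0); rewrite height_cox //.
have := defect_cox hcol (~~ b) f; rewrite negbK => ->.
by rewrite mulnS natrD mulrDl; lra.
Qed.

End CoxeterWalk.

(** * Deformations *)

Section Pencil.
Variable F : fieldType.
Implicit Types p q n : nat.

Lemma dvdXn_coprime n (a b : {poly F}) : a`_0 != 0 -> 'X^n %| a * b -> 'X^n %| b.
Proof.
move=> a0; rewrite Gauss_dvdpr //; apply: coprimep_expl.
by rewrite coprimep_sym coprimepX rootE horner_coef0.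
Qed.

(** A right inverse K at one value t makes the determinant of (L0 + x L1) K a nonzero polynomial.
    Multiplying an approximate kernel vector by the adjugate shows that x^n divides this
    determinant, since some entry of the vector is nonzero at x = 0. *)
Lemma pencil_singular p q (L0 L1 : 'M[F]_(p, q)) :
  (forall n, exists (phi : 'rV[{poly F}]_p) psi, map_mx (coefp 0) phi != 0 /\
    phi *m (map_mx polyC L0 + 'X *: map_mx polyC L1) = 'X^n *: psi) ->
  forall t, ~~ row_free (L0 + t *: L1).
Proof.
move=> chain t; apply/negP => /row_freeP[K LK].
pose M := (map_mx polyC L0 + 'X *: map_mx polyC L1) *m map_mx polyC K.
have Mt : map_mx (horner_eval t) M = 1%:M.
  have hC a b (A : 'M[F]_(a, b)) : map_mx (horner_eval t) (map_mx polyC A) = A.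
    by apply/matrixP => i j; rewrite !mxE /= /horner_eval hornerC.
  rewrite map_mxM hC -LK map_mxD map_mxZ !hC.
  by congr ((_ + _ *: _) *m _); rewrite /= /horner_eval hornerX.
have detM : \det M != 0.
  apply: contraTneq (oner_neq0 F) => dM; rewrite -(det1 F p) -Mt det_map_mx dM.
  by rewrite rmorph0 eqxx.
have [phi [psi [phi0 phiM]]] := chain (size (\det M)).
have [j phij] : exists j, (phi 0 j)`_0 != 0.
  apply/existsP; apply: contraNT phi0 => /existsPn phi0; apply/eqP/rowP => j.
  by rewrite !mxE; have := phi0 j; rewrite negbK => /eqP.
have : 'X^(size (\det M)) %| phi 0 j * \det M.
  have /matrixP/(_ 0 j) : phi *m M *m \adj M = 'X^(size (\det M)) *: (psi *m map_mx polyC K *m \adj M).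
    by rewrite mulmxA phiM -!scalemxAl.
  by rewrite -mulmxA mul_mx_adj mul_mx_scalar !mxE mulrC => ->; rewrite dvdp_mulIl.
move/(dvdXn_coprime phij).
by move=> /(dvdp_leq detM); rewrite size_polyXn ltnn.
Qed.
End Pencil.

Section Commutant.
Variables (F : fieldType) (m : nat).

Lemma mx_valuation (a b : nat) (M : 'M[{poly F}]_(a, b)) : M != 0 ->
  exists r M', M = 'X^r *: M' /\ map_mx (coefp 0) M' != 0.
Proof.
case/matrix0Pn=> i [j Mij].
have [k] := ubnP (size (M i j)); elim: k M Mij => // k IHk M Mij lt_k.
have [M00|] := eqVneq (map_mx (coefp 0) M) 0; last by exists 0%N, M; rewrite expr0 scale1r.
pose M1 : 'M[{poly F}]_(a, b) := \matrix_(u, v) (M u v %/ 'X).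
have ME : M = 'X *: M1.
  apply/matrixP => u v;
    rewrite !mxE mulrC divpK // -['X]subr0 -polyC0 dvdp_XsubCl rootE horner_coef0.
  by have /matrixP/(_ u v) := M00; rewrite !mxE => /eqP.
have M1ij : M1 i j != 0 by apply: contra_neq Mij => M1ij; rewrite ME mxE M1ij mulr0.
have [|r [M' [M1E M'0]]] := IHk M1 M1ij.
  by move: lt_k; rewrite ME mxE mulrC size_mulX.
by exists r.+1, M'; rewrite exprS -scalerA -M1E.
Qed.

(** Subtract the (0, 0) entry from A and divide by the largest power of x: the quotient B commutes
    with A, and its constant term is nonzero with zero (0, 0) entry. If A is scalar, any nonscalar
    matrix will do; the size is at least 2. *)
Lemma nonscalar_commutant (A : 'M[{poly F}]_m.+2) : exists B : 'M[{poly F}]_m.+2,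
  A *m B = B *m A /\ ~~ is_scalar_mx (map_mx (coefp 0) B).
Proof.
have [AE|A0] := eqVneq (A - (A 0 0)%:M) 0.
  exists (delta_mx 0 0); move/eqP: AE; rewrite subr_eq0 => /eqP ->.
  rewrite scalar_mxC; split=> //; apply/negP => /is_scalar_mxP[a /matrixP aE].
  have := aE 0 0; have := aE ord_max ord_max; rewrite !mxE !eqxx /= !mulr1n => <-.
  by rewrite coef0 coef1 /= => /eqP; rewrite oner_eq0.
have [r [B [AE B0]]] := mx_valuation A0; exists B.
have comAB : 'X^r *: (A *m B - B *m A) = 0.
  rewrite scalerBr scalemxAr scalemxAl -AE mulmxBr mulmxBl.
  by rewrite scalar_mxC opprB addrA subrK subrr.
have X0 : 'X^r != 0 :> {poly F} by rewrite monic_neq0 // monicXn.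
split.
  apply/eqP; rewrite -subr_eq0; apply/eqP/matrixP => i j.
  have /matrixP/(_ i j)/eqP := comAB; rewrite !mxE mulf_eq0 (negPf X0) => /eqP.
  by rewrite ?mxE.
apply: contraNN B0 => /is_scalar_mxP[a Ba].
suff a0 : a = 0 by rewrite Ba a0 raddf0.
have /matrixP/(_ 0 0) := Ba; rewrite !mxE eqxx mulr1n /= => <-.
have /matrixP/(_ 0 0)/eqP := AE; rewrite !mxE eqxx mulr1n subrr eq_sym mulf_eq0.
by rewrite (negPf X0) => /eqP ->; rewrite coef0.
Qed.
End Commutant.

(** * Graded matrices and matrices supported on edges *)

Section Graded.
Variables (R : comNzRingType) (N : nat) (T : eqType) (gr : 'I_N -> T) (edge : rel T).
Implicit Types A B : 'M[R]_N.

Definition graded A := forall i j, gr i != gr j -> A i j = 0.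
Definition arrowed A := forall i j, ~~ edge (gr i) (gr j) -> A i j = 0.

Lemma gradedD A B : graded A -> graded B -> graded (A + B).
Proof. by move=> gA gB i j ij; rewrite mxE gA // gB // addr0. Qed.

Lemma gradedZ a A : graded A -> graded (a *: A).
Proof. by move=> gA i j ij; rewrite mxE gA // mulr0. Qed.

Lemma graded1 : graded 1%:M.
Proof. by move=> i j ij; rewrite mxE; have [eij|//] := eqVneq i j; rewrite eij eqxx in ij. Qed.

Lemma gradedM A B : graded A -> graded B -> graded (A *m B).
Proof.
move=> gA gB i j ij; rewrite mxE big1 // => k _.
have [ik|/gA->] := eqVneq (gr i) (gr k); last by rewrite mul0r.
by rewrite gB ?mulr0 // -ik.
Qed.

Lemma arrowedD A B : arrowed A -> arrowed B -> arrowed (A + B).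
Proof. by move=> gA gB i j ij; rewrite mxE gA // gB // addr0. Qed.

Lemma arrowedN A : arrowed A -> arrowed (- A).
Proof. by move=> gA i j ij; rewrite mxE gA // oppr0. Qed.

Lemma arrowed_gradedl A B : graded A -> arrowed B -> arrowed (A *m B).
Proof.
move=> gA aB i j ij; rewrite mxE big1 // => k _.
have [ik|/gA->] := eqVneq (gr i) (gr k); last by rewrite mul0r.
by rewrite aB ?mulr0 // -ik.
Qed.

Lemma arrowed_gradedr A B : arrowed A -> graded B -> arrowed (A *m B).
Proof.
move=> aA gB i j ij; rewrite mxE big1 // => k _.
have [kj|/gB->] := eqVneq (gr k) (gr j); last by rewrite mulr0.
by rewrite aA ?mul0r // kj.
Qed.

Definition grade_proj t : 'M[R]_N := diag_mx (\row_i (gr i == t)%:R).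

Lemma grade_projE t A i j : (grade_proj t *m A) i j = (gr i == t)%:R * A i j.
Proof. by rewrite mul_diag_mx !mxE. Qed.

Lemma mul_grade_projE t A i j : (A *m grade_proj t) i j = A i j * (gr j == t)%:R.
Proof. by rewrite mul_mx_diag !mxE. Qed.

Lemma gradedP A : graded A <-> forall t, grade_proj t *m A = A *m grade_proj t.
Proof.
split=> [gA t|comA i j /negPf ij].
  apply/matrixP => i j; rewrite grade_projE mul_grade_projE mulrC.
  by have [->//|/gA->] := eqVneq (gr i) (gr j); rewrite !mul0r.
have /matrixP/(_ i j) := comA (gr i).
by rewrite grade_projE mul_grade_projE eqxx mul1r eq_sym ij mulr0.
Qed.

End Graded.

Lemma graded_adj (R : idomainType) (N : nat) (T : eqType) (gr : 'I_N -> T) (A : 'M[R]_N) :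
  \det A != 0 -> graded gr A -> graded gr (\adj A).
Proof.
move=> dA /gradedP gA; apply/gradedP => t; set e := grade_proj _ _ _.
have dZ (B : 'M[R]_N) : \det A *: B = 0 -> B = 0.
  move=> dB; apply/matrixP => i j; have /matrixP/(_ i j)/eqP := dB.
  by rewrite !mxE mulf_eq0 (negPf dA) => /eqP.
have comA : A *m (e *m \adj A - \adj A *m e) = 0.
  by rewrite mulmxBr !mulmxA -gA mul_mx_adj -mulmxA mul_mx_adj scalar_mxC subrr.
apply/eqP; rewrite -subr_eq0; apply/eqP/dZ.
by rewrite -mul_scalar_mx -mul_adj_mx -mulmxA comA mulmx0.
Qed.

Section CommutatorMap.
Variables (R : comNzRingType) (N : nat) (T : eqType) (gr : 'I_N -> T) (k0 : 'I_N) (X : 'M[R]_N).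

(* Besides the commutator with [X], records the entries that must vanish in a
   graded matrix with zero entry at [k0]. *)
Definition commutator_map (phi : 'M[R]_N) : 'M[R]_(N, N + (N + N)) :=
  row_mx (phi *m X - X *m phi)
    (row_mx (\matrix_(i, j) (if gr i == gr j then 0 else phi i j)) (phi k0 k0)%:M).

(** The padding by zeros makes [commutator_map] at Y1 + x Z equal to its value at Y1 plus x times
    this map at Z: the constraints do not depend on x. *)
Definition commutator_map0 (phi : 'M[R]_N) : 'M[R]_(N, N + (N + N)) :=
  row_mx (phi *m X - X *m phi) 0.

Fact commutator_map_linear : linear commutator_map.
Proof.
move=> a u v; rewrite /commutator_map scale_row_mx add_row_mx; congr row_mx.
  by rewrite mulmxDl mulmxDr -scalemxAl -scalemxAr scalerBr opprD addrACA.
rewrite scale_row_mx add_row_mx; congr row_mx.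
  by apply/matrixP => i j; rewrite !mxE; case: ifP; rewrite ?mulr0 ?addr0.
by apply/matrixP => i j; rewrite !mxE mulrnDl -mulrnAr.
Qed.
HB.instance Definition _ := GRing.isLinear.Build R 'M[R]_N 'M[R]_(N, N + (N + N)) _
  commutator_map commutator_map_linear.

Fact commutator_map0_linear : linear commutator_map0.
Proof.
move=> a u v; rewrite /commutator_map0 scale_row_mx add_row_mx scaler0 addr0; congr row_mx.
by rewrite mulmxDl mulmxDr -scalemxAl -scalemxAr scalerBr opprD addrACA.
Qed.
HB.instance Definition _ := GRing.isLinear.Build R 'M[R]_N 'M[R]_(N, N + (N + N)) _
  commutator_map0 commutator_map0_linear.

End CommutatorMap.

Lemma map_commutator_map (R S : comNzRingType) (f : {rmorphism R -> S}) N (T : eqType)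
    (gr : 'I_N -> T) k0 (X A : 'M[R]_N) :
  map_mx f (commutator_map gr k0 X A) = commutator_map gr k0 (map_mx f X) (map_mx f A).
Proof.
rewrite /commutator_map !map_row_mx map_mxB !map_mxM map_scalar_mx mxE; congr row_mx.
congr row_mx; apply/matrixP => i j; rewrite !mxE.
by case: ifP; rewrite ?rmorph0.
Qed.

Lemma map_commutator_map0 (R S : comNzRingType) (f : {rmorphism R -> S}) N (X A : 'M[R]_N) :
  map_mx f (commutator_map0 X A) = commutator_map0 (map_mx f X) (map_mx f A).
Proof. by rewrite /commutator_map0 !map_row_mx map_mxB !map_mxM map_mx0. Qed.

Section Deformation.
Variables (F : fieldType) (D m : nat) (T : eqType) (gr : 'I_(D * m.+2) -> T) (edge : rel T).
Local Notation N := (D * m.+2)%N.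
Local Notation P := {poly F}.
Variables (Y Y' : 'M[F]_D).
Let Y1 : 'M[F]_N := Y *t (1%:M : 'M_m.+2).
Hypothesis arrowedY1 : arrowed gr edge Y1.
Hypothesis arrowedY' : forall B : 'M[F]_m.+2, arrowed gr edge (Y' *t B : 'M_N).
Hypothesis graded_right : forall B : 'M[F]_m.+2, graded gr ((1%:M : 'M_D) *t B : 'M_N).
Hypothesis solve : forall x : 'M[F]_N, arrowed gr edge x ->
  exists phi (B : 'M_m.+2), graded gr phi /\ x = Y1 *m phi - phi *m Y1 + Y' *t B.
Variable X : 'M[F]_N.
Hypothesis arrowedX : arrowed gr edge X.

Local Notation lift := (map_mx (@polyC F)).
Let Z := X - Y1.
Let W : 'M[P]_N := lift Y1 + 'X *: lift Z.
Let ta (B : 'M[P]_m.+2) : 'M[P]_N := lift Y' *t B.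

Let lift_graded A : graded gr A -> graded gr (lift A).
Proof. by move=> gA i j ij; rewrite mxE gA. Qed.

Let lift_arrowed A : arrowed gr edge A -> arrowed gr edge (lift A).
Proof. by move=> gA i j ij; rewrite mxE gA. Qed.

Let ta_arrowed B : arrowed gr edge (ta B).
Proof.
move=> i j ij; apply/polyP => k; rewrite coef0.
have := arrowedY' (map_mx (coefp k) B) ij.
by rewrite !mxE coefCM.
Qed.

(** Normal form modulo increasing powers of x: W = Y1 + x Z is conjugated to Y1 plus a multiple of
    the single extension class, with coefficients in matrices over polynomials. *)
Lemma deformation_lift n : exists (g' : 'M[P]_N) (A' : 'M[P]_m.+2) (E : 'M[P]_N),
  [/\ graded gr g', arrowed gr edge E
    & W *m (1%:M + 'X *: g') = (1%:M + 'X *: g') *m (lift Y1 + ta ('X *: A')) + 'X^(n.+1) *: E].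
Proof.
have arrowedZ1 : arrowed gr edge (lift Z).
  by apply: lift_arrowed; apply: arrowedD => //; apply: arrowedN.
have taD A B : ta (A + B) = ta A + ta B.
  by apply/matrixP => i j; rewrite !mxE mulrDr.
have taZ a A : ta (a *: A) = a *: ta A.
  by apply/matrixP => i j; rewrite !mxE mulrCA.
elim: n => [|n [g' [A' [E [gg' aE eqW]]]]].
  exists 0, 0, (lift Z); split=> //; first by move=> i j _; rewrite mxE.
  rewrite !scaler0 !addr0 mulmx1 mul1mx expr1.
  by rewrite -[0]/(0 : 'M_m.+2) -(scale0r 0) taZ scale0r addr0.
pose E0 := map_mx (coefp 0) E.
pose E1 : 'M[P]_N := \matrix_(i, j) \poly_(k < size (E i j)) (E i j)`_k.+1.
have EE : E = lift E0 + 'X *: E1.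
  apply/matrixP => i j; rewrite !mxE /=; apply/polyP => -[|k].
    by rewrite coefD coefC coefXM addr0.
  rewrite coefD coefC coefXM add0r /= coef_poly; case: ltnP => // le_k.
  by rewrite nth_default // (leq_trans le_k).
have aE0 : arrowed gr edge (- E0).
  by apply: arrowedN => i j ij; rewrite mxE aE //= coef0.
have aE1 : arrowed gr edge E1.
  move=> i j ij; rewrite mxE aE //; apply/polyP => k.
  by rewrite coef_poly size_poly0 !coef0.
(* The constant term of the error is removed: phi corrects the conjugating matrix and B the normal
   form. *)
have [phi [B [gphi E0E]]] := solve aE0.
exists (g' + 'X^n *: lift phi), (A' - 'X^n *: lift B).
pose A2 := A' - 'X^n *: lift B.
exists (E1 + lift Z *m lift phi + g' *m ta (lift B) - lift phi *m ta A2).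
have gphi' := lift_graded gphi.
split.
- by apply: gradedD => //; apply: gradedZ.
- apply: arrowedD; last by apply: arrowedN; apply: arrowed_gradedl.
  apply: arrowedD; last exact: arrowed_gradedl.
  by apply: arrowedD => //; apply: arrowed_gradedr.
have E0E' : lift E0 + (lift Y1 *m lift phi - lift phi *m lift Y1 + ta (lift B)) = 0.
  have -> : ta (lift B) = lift (Y' *t B) by rewrite /ta map_mxT.
  rewrite -!map_mxM -map_mxB -map_mxD -E0E -map_mxD subrr.
  by rewrite map_mx0.
have taA2 : ta ('X *: A2) = ta ('X *: A') - 'X^(n.+1) *: ta (lift B).
  by rewrite /A2 !taZ -scaleN1r taD -!scaleN1r !taZ scalerDr !scalerA exprS; congr (_ + _ *: _);
    ring.
rewrite -/A2 (_ : _ + _ = (1%:M + 'X *: g') + 'X^(n.+1) *: lift phi); last first.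
  by rewrite scalerDr scalerA -exprS addrA.
rewrite mulmxDr eqW mulmxDl taA2 {1}EE /W.
have VE : 'X *: (lift phi *m ta A2) =
    lift phi *m ta ('X *: A') - 'X^(n.+1) *: (lift phi *m ta (lift B)).
  by rewrite scalemxAr -taZ taA2 mulmxBr -scalemxAr.
have := E0E'; have := VE.
rewrite !(mulmxDl, mulmxDr, mulmxBr, mulmxBl, mul1mx, mulmxN) -!(scalemxAl, scalemxAr).
move: (lift Y1 *m lift phi) (lift phi *m lift Y1) (lift Z *m lift phi) (g' *m lift Y1) (g' *m ta ('X *: A')).
move: (g' *m ta (lift B)) (lift phi *m ta ('X *: A')) (lift phi *m ta (lift B)) (lift phi *m ta A2).
move: (ta ('X *: A')) (ta (lift B)) (lift E0) (lift Y1).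
move=> T1 T2 E2 T0 U1 U2 U3 U4 V1 V2 V3 V4 V5 V'E E2E.
apply/matrixP => i j; have /matrixP/(_ i j) := V'E; have /matrixP/(_ i j) := E2E.
rewrite !mxE !exprS => /eqP; rewrite addr_eq0 => /eqP-> v4.
apply: subr0_eq.
transitivity ('X * 'X^n * ('X * U4 i j - (U2 i j - 'X * 'X^n * U3 i j))); last first.
  by rewrite v4 subrr mulr0.
by move: (\poly_(k < _) _) => p; ring.
Qed.

Lemma tens_comm (R : comPzRingType) (a b : nat) (A : 'M[R]_a) (B : 'M[R]_b) :
  (A *t 1%:M : 'M_(a * b)) *m (1%:M *t B) = (1%:M *t B) *m (A *t 1%:M).
Proof. by rewrite !tensmx_mul !mulmx1 !mul1mx. Qed.

(** If the endomorphisms of X were scalar, the pencil would be row free at x = 1, where W is X. But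
    conjugating 1 (x) B, for B commuting with A', gives endomorphisms of W modulo any power of x. *)
Lemma deformation_not_brick (i0 : 'I_D) : ~ (forall phi : 'M[F]_N, graded gr phi ->
  phi *m X = X *m phi -> is_scalar_mx phi).
Proof.
move=> brickX; pose k0 : 'I_N := mxtens_index (i0, ord0).
pose L0 := lin_mx (commutator_map gr k0 Y1); pose L1 := lin_mx (commutator_map0 Z).
have /negP[] : ~~ row_free (L0 + 1 *: L1).
  apply: pencil_singular => n.
  have [g' [A' [E [gg' _ eqW]]]] := deformation_lift n.
  pose g : 'M[P]_N := 1%:M + 'X *: g'; pose Q := lift Y1 + ta ('X *: A').
  have [W1 W1E] : exists W1, W1 = W by exists W.
  have {}eqW : W1 *m g = g *m Q + 'X^(n.+1) *: E by rewrite W1E.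
  have [B [comAB B0]] := nonscalar_commutant A'.
  pose b : 'M[P]_N := 1%:M *t B.
  have comQb : Q *m b = b *m Q.
    have l1 : lift (1%:M : 'M[F]_m.+2) = 1%:M by rewrite map_mx1.
    rewrite mulmxDl mulmxDr map_mxT l1 tens_comm; congr (_ + _).
    rewrite /ta !tensmx_mul mul1mx mulmx1 -!(scalemxAl, scalemxAr) comAB.
    by [].
  have g0 : map_mx (coefp 0) g = 1%:M.
    by apply/matrixP => i j; rewrite !mxE /= coefD coefXM addr0 -polyC_natr coefC.
  have gg : graded gr g by apply: gradedD; [apply: graded1 | apply: gradedZ].
  have dg : \det g != 0.
    apply: contraTneq (oner_neq0 F) => dg.
    by rewrite -(det1 F N) -g0 det_map_mx dg rmorph0 eqxx.
  have gb : graded gr b.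
    move=> i j ij; apply/polyP => k; rewrite coef0.
    have := graded_right (map_mx (coefp k) B) ij.
    by rewrite !mxE -!polyC_natr coefCM.
  have b0 : map_mx (coefp 0) b = (1%:M : 'M[F]_D) *t map_mx (coefp 0) B.
    by rewrite map_mxT map_mx1.
  clearbody g Q b.
  (* This is the conjugate of b by g times (det g)^2. The adjugate avoids inverting g, and the extra
     determinant makes commutation with W a polynomial identity; at x = 0 nothing changes, since g
     is 1 there. *)
  have [Psi PsiE] : exists Psi, Psi = \det g *: (g *m b *m \adj g) by eexists.
  have gPsi : graded gr Psi.
    by rewrite PsiE; apply: gradedZ; apply: gradedM; [apply: gradedM | apply: graded_adj].
  have WPsi : W1 *m Psi = \det g *: (g *m b *m Q *m \adj g) + 'X^(n.+1) *: (\det g *: (E *m b *m \adj g)).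
    rewrite PsiE -scalemxAr !mulmxA eqW !mulmxDl -!scalemxAl scalerDr -(mulmxA g Q) comQb mulmxA.
    by rewrite !scalerA mulrC.
  have adjW : \det g *: (\adj g *m W1) = \det g *: (Q *m \adj g) + 'X^(n.+1) *: (\adj g *m E *m \adj g).
    have : \adj g *m (W1 *m g) *m \adj g = \adj g *m (g *m Q + 'X^(n.+1) *: E) *m \adj g.
      by rewrite eqW.
    rewrite mulmxDr mulmxDl !mulmxA mul_adj_mx -!mulmxA mul_mx_adj mul_scalar_mx !mulmxA.
    by rewrite mul_mx_scalar -scalemxAr -!scalemxAl.
  have PsiW : Psi *m W1 = \det g *: (g *m b *m Q *m \adj g) + 'X^(n.+1) *: (g *m b *m (\adj g *m E *m \adj g)).
    have -> : Psi *m W1 = g *m b *m (\det g *: (\adj g *m W1)).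
      by rewrite PsiE -scalemxAr -scalemxAl !mulmxA.
    rewrite adjW mulmxDr -!scalemxAr !mulmxA.
    by [].
  (* Subtracting a scalar meets the constraint at [k0] and does not affect commutators. The constant
     term stays nonzero because that of B is not scalar. *)
  pose Phi := Psi - (Psi k0 k0)%:M.
  have gPhi : graded gr Phi.
    apply: gradedD => //; rewrite -scaleN1r; apply: gradedZ.
    by rewrite -scalemx1; apply/gradedZ/graded1.
  have Psi0 : map_mx (coefp 0) Psi = (1%:M : 'M[F]_D) *t map_mx (coefp 0) B.
    rewrite PsiE map_mxZ !map_mxM map_mx_adj -det_map_mx g0 b0 det1 scale1r mul1mx.
    by rewrite -[\adj _]mul1mx mul_mx_adj det1 mulmx1.
  have Phi0 : map_mx (coefp 0) Phi != 0.
    apply: contraNneq B0 => Phi0; apply/is_scalar_mxP; exists (coefp 0 (Psi k0 k0)).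
    have : map_mx (coefp 0) Psi = (coefp 0 (Psi k0 k0))%:M.
      by apply/eqP; rewrite -subr_eq0 -map_scalar_mx -map_mxB Phi0.
    rewrite Psi0 => PsiS; apply/matrixP => i j.
    have /matrixP/(_ (mxtens_index (i0, i)) (mxtens_index (i0, j))) := PsiS.
    rewrite tensmxE mxE eqxx mul1r => ->.
    by rewrite !mxE (inj_eq (can_inj (@mxtens_indexK _ _))) xpair_eqE eqxx.
  have comPhi : Phi *m W1 - W1 *m Phi = 'X^n *: ('X *: (g *m b *m (\adj g *m E *m \adj g)
      - \det g *: (E *m b *m \adj g))).
    rewrite /Phi mulmxBl mulmxBr scalar_mxC opprB addrA subrK PsiW WPsi opprD addrACA subrr add0r.
    by rewrite scalerA -exprSr -scalerBr.
  have Phik0 : Phi k0 k0 = 0 by rewrite /Phi !mxE eqxx mulr1n subrr.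
  clearbody Phi.
  exists (mxvec Phi), (mxvec (row_mx ('X *: (g *m b *m (\adj g *m E *m \adj g)
      - \det g *: (E *m b *m \adj g))) 0)); split.
    by rewrite map_mxvec mxvec_eq0.
  rewrite (map_lin_mx (map_commutator_map _ gr k0 Y1)) (map_lin_mx (map_commutator_map0 _ Z)).
  rewrite mulmxDr -scalemxAr !mul_vec_lin; apply: (can_inj vec_mxK).
  rewrite linearD /= [vec_mx ('X *: mxvec _)]linearZ /= [vec_mx ('X^n *: _)]linearZ /= !mxvecK.
  rewrite /commutator_map /commutator_map0 !scale_row_mx add_row_mx !scaler0 addr0.
  congr row_mx.
    rewrite -comPhi W1E mulmxDr mulmxDl -scalemxAl -scalemxAr scalerBr.
    by rewrite opprD addrACA.
  rewrite -row_mx0; congr row_mx.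
    by apply/matrixP => i j; rewrite !mxE; case: eqP => // /eqP ij; exact: gPhi.
  by rewrite Phik0 raddf0.
(* At x = 1 the kernel consists of graded endomorphisms of X with zero entry at [k0]; a scalar one
   is zero. *)
rewrite -kermx_eq0; apply: contraT => ker0.
pose v := nz_row (kermx (L0 + 1 *: L1)); pose phi := vec_mx v.
have : v *m (L0 + 1 *: L1) = 0 by apply/sub_kermxP; rewrite nz_row_sub.
rewrite -[v]vec_mxK -/phi scale1r mulmxDr !mul_vec_lin -linearD => /eqP.
rewrite mxvec_eq0 /commutator_map /commutator_map0 add_row_mx addr0 => /eqP eq0.
have [com0 /eq_row_mx[off0 d0]] : phi *m Y1 - Y1 *m phi + (phi *m Z - Z *m phi) = 0 /\
   row_mx (\matrix_(i, j) (if gr i == gr j then 0 else phi i j)) (phi k0 k0)%:M = row_mx (0 : 'M_N) (0 : 'M_N).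
  by apply: eq_row_mx; rewrite row_mx0 row_mx0.
have /is_scalar_mxP[a phiE] : is_scalar_mx phi.
  apply: brickX.
    move=> i j /negPf ij; have /matrixP/(_ i j) := off0.
    by rewrite !mxE ij.
  apply/eqP; rewrite -subr_eq0 -com0 -(subrK Y1 X) -/Z mulmxDl mulmxDr.
  by apply/eqP; rewrite opprD addrACA addrC.
have a0 : a = 0.
  by have /matrixP/(_ k0 k0) := d0; rewrite phiE !mxE eqxx !mulr1n.
have v0 : v = 0 by rewrite -[v]vec_mxK -/phi phiE a0 raddf0 linear0.
by move: ker0; rewrite -nz_row_eq0 -/v v0 eqxx.
Qed.
End Deformation.

(** * A computable certificate for self-extensions *)

Section Peeling.
Variables (F : fieldType) (T : eqType) (t0 : T) (cs : seq T) (edge : rel T).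
Variables (ys : seq (nat * nat)) (y' : nat * nat).
Local Notation D := (size cs).
Local Notation grade := (nth t0 cs).

(* The commutator of [Y] with the matrix unit at [k, l], as a signed sum of
   matrix units. *)
Definition comm_terms (kl : nat * nat) : seq (bool * (nat * nat)) :=
  [seq (false, (p.1, kl.2)) | p <- ys & p.2 == kl.1] ++
  [seq (true, (kl.1, p.2)) | p <- ys & p.1 == kl.2].

(** Elimination reduced to bookkeeping: when exactly one term of a commutator is not yet solved, it
    becomes solved, its coefficient being 1 or -1. This is valid over every field. *)
Definition peel_step s kl : seq (nat * nat) :=
  if [seq t <- comm_terms kl | t.2 \notin s] is [:: t] then t.2 :: s else s.

Definition peel n : seq (nat * nat) :=
  let pairs := [seq kl <- [seq (k, l) | k <- iota 0 D, l <- iota 0 D] | grade kl.1 == grade kl.2] in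
  iter n (fun s => foldl peel_step s pairs) [:: y'].

(** The 12 rounds are fuel: too few could only make the check fail. *)
Definition certified : bool :=
  [&& all (fun p => edge (grade p.1) (grade p.2)) (y' :: ys)
    & let s := peel 12 in
      all (fun p => edge (grade p.1) (grade p.2) ==> (p \in s))
        [seq (k, l) | k <- iota 0 D, l <- iota 0 D]].

Variable m : nat.
Definition tgrade (k : 'I_(D * m)) : T := grade (mxtens_unindex k).1.

Definition munit (p : nat * nat) : 'M[F]_D :=
  \matrix_(i, j) ((i == p.1 :> nat) && (j == p.2 :> nat))%:R.
Definition cert_Y : 'M[F]_D := \sum_(p <- ys) munit p.

Lemma munit_mul p k l : (k < D)%N ->
  munit p *m munit (k, l) = if p.2 == k then munit (p.1, l) else 0.
Proof.
move=> lt_k; apply/matrixP => i j; rewrite mxE (bigD1 (Ordinal lt_k)) //= big1 ?addr0.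
  rewrite (fun_if (fun A : 'M_D => A i j)) !mxE /= eqxx -natrM mulnb [k == p.2]eq_sym.
  by case: (p.2 == k); rewrite ?andbT ?andbF.
move=> x /eqP xk; rewrite !mxE /= [x == k :> nat](_ : _ = false) ?mulr0 //.
by apply/eqP => xk'; apply: xk; apply: val_inj.
Qed.

Lemma tr_munit p : (munit p)^T = munit (p.2, p.1).
Proof. by apply/matrixP => i j; rewrite !mxE andbC. Qed.

Lemma munit_mulr k l p : (l < D)%N ->
  munit (k, l) *m munit p = if p.1 == l then munit (k, p.2) else 0.
Proof.
move=> lt_l; rewrite -[LHS]trmxK trmx_mul !tr_munit munit_mul //=.
by case: ifP => _; rewrite ?tr_munit ?trmx0.
Qed.

Local Notation N := (D * m)%N.
Let Y1 : 'M[F]_N := cert_Y *t (1%:M : 'M_m).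
Let solvable (x : 'M[F]_N) : Prop := exists phi (B : 'M_m),
  graded tgrade phi /\ x = Y1 *m phi - phi *m Y1 + munit y' *t B.

Let solvableD x z : solvable x -> solvable z -> solvable (x + z).
Proof.
move=> [p [B [gp ->]]] [q [B' [gq ->]]]; exists (p + q), (B + B'); split.
  exact: gradedD.
have -> : munit y' *t (B + B') = munit y' *t B + munit y' *t B'.
  by apply/matrixP => i j; rewrite !mxE mulrDr.
rewrite mulmxDr mulmxDl opprD.
move: (munit y' *t B) (munit y' *t B') (Y1 *m p) (Y1 *m q) (p *m Y1) (q *m Y1) => u1 u2 u3 u4 u5 u6.
by apply/matrixP => i j; rewrite !mxE; ring.
Qed.

Let solvableN x : solvable x -> solvable (- x).
Proof.
move=> [p [B [gp ->]]]; exists (- p), (- B); split.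
  by rewrite -scaleN1r; apply: gradedZ.
have -> : munit y' *t (- B) = - (munit y' *t B).
  by apply/matrixP => i j; rewrite !mxE mulrN.
by rewrite mulmxN mulNmx opprD opprB opprK [- (Y1 *m p) + _]addrC.
Qed.

Let solvable0 : solvable 0.
Proof.
exists 0, 0; split; first by move=> i j _; rewrite mxE.
have -> : munit y' *t (0 : 'M_m) = 0 by apply/matrixP => i j; rewrite !mxE mulr0.
by rewrite mulmx0 mul0mx subrr addr0.
Qed.

Let solvable_sum (I : Type) (r : seq I) (P : pred I) (E : I -> 'M[F]_N) :
  (forall i, P i -> solvable (E i)) -> solvable (\sum_(i <- r | P i) E i).
Proof. by move=> sE; elim/big_ind: _ => //; exact: solvableD. Qed.

Let solved (p : nat * nat) := forall B : 'M[F]_m, solvable (munit p *t B).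

Let term B (t : bool * (nat * nat)) : 'M[F]_N := (-1) ^+ t.1 *: (munit t.2 *t B).

Let tens_sum (I : Type) (r : seq I) (P : pred I) (E : I -> 'M[F]_D) (B : 'M[F]_m) :
  (\sum_(i <- r | P i) E i) *t B = \sum_(i <- r | P i) (E i *t B).
Proof.
apply/matrixP => i j; rewrite mxE summxE mulr_suml summxE.
by apply: eq_bigr => k _; rewrite mxE.
Qed.

Let solvable_comm kl B : (kl.1 < D)%N -> (kl.2 < D)%N -> grade kl.1 == grade kl.2 ->
  solvable (\sum_(t <- comm_terms kl) term B t).
Proof.
case: kl => k l /= lt_k lt_l /eqP gkl.
exists (munit (k, l) *t B), 0; split.
  move=> i j /eqP ij; rewrite !mxE; case: eqP => [ik|_]; last by rewrite mul0r.
  case: eqP => [jl|_]; last by rewrite mul0r.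
  by case: ij; rewrite /tgrade ik jl.
have -> : munit y' *t (0 : 'M_m) = 0 by apply/matrixP => i j; rewrite !mxE mulr0.
rewrite addr0 !tensmx_mul mul1mx mulmx1 /cert_Y mulmx_suml mulmx_sumr !tens_sum.
rewrite /comm_terms big_cat !big_map !big_filter /= -sumrN; congr (_ + _).
  rewrite big_mkcond; apply: eq_bigr => p _; rewrite munit_mul //= /term expr0 scale1r.
  by case: ifP => // _; apply/matrixP => i j; rewrite !mxE mul0r.
rewrite big_mkcond; apply: eq_bigr => -[p q] _; rewrite /term expr1 scaleN1r /=.
rewrite munit_mulr //=; case: ifP => // _.
by apply/matrixP => i j; rewrite !mxE mul0r oppr0.
Qed.

Let peel_step_solved s kl : (kl.1 < D)%N -> (kl.2 < D)%N -> grade kl.1 == grade kl.2 ->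
  (forall p, p \in s -> solved p) -> forall p, p \in peel_step s kl -> solved p.
Proof.
move=> lt_k lt_l gkl ss p; rewrite /peel_step.
case E: [seq t <- comm_terms kl | t.2 \notin s] => [|t [|? ?]]; try exact: ss.
rewrite inE => /orP[/eqP->|]; last exact: ss.
move=> B; have sol := solvable_comm B lt_k lt_l gkl.
rewrite (bigID (fun t => t.2 \in s)) /= -[X in _ + X]big_filter E big_seq1 in sol.
have : solvable (term B t).
  rewrite -[term B t](addKr (\sum_(t <- comm_terms kl | t.2 \in s) term B t)).
  apply: solvableD => //; apply/solvableN/solvable_sum => u us; rewrite /term.
  by case: (u.1); rewrite ?expr1 ?expr0 ?scaleN1r ?scale1r; [apply: solvableN|]; apply: ss.
by rewrite /term; case: (t.1); rewrite ?expr1 ?expr0 ?scaleN1r ?scale1r // => /solvableN;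
  rewrite opprK.
Qed.

Let peel_solved n p : p \in peel n -> solved p.
Proof.
rewrite /peel; set prs := [seq _ <- _ | _].
have prsP kl : kl \in prs -> [/\ (kl.1 < D)%N, (kl.2 < D)%N & grade kl.1 == grade kl.2].
  rewrite mem_filter => /andP[-> /allpairsP[[k l] /= [kI lI ->]]].
  by rewrite !mem_iota in kI lI.
elim: n p => [|n IHn] /= p.
  rewrite inE => /eqP-> B; exists 0, B; split; first by move=> i j _; rewrite mxE.
  by rewrite mulmx0 mul0mx subrr add0r.
elim: (prs) prsP (iter n _ _) IHn p => [|kl r IHr] prsP s //= ss p.
apply: IHr => [q qr|]; first by apply: prsP; rewrite inE qr orbT.
have [lk ll gkl] := prsP kl (mem_head _ _).
exact: peel_step_solved.
Qed.

Hypothesis cert : certified.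

(** Cut x into blocks. Each block on an edge is a peeled matrix unit tensored with an arbitrary
    matrix, and the other blocks vanish. *)
Lemma certified_solvable x : arrowed tgrade edge x -> exists phi (B : 'M_m),
  graded tgrade phi /\ x = Y1 *m phi - phi *m Y1 + munit y' *t B.
Proof.
move=> ax; pose blk (i j : 'I_D) : 'M[F]_m :=
  \matrix_(a, b) x (mxtens_index (i, a)) (mxtens_index (j, b)).
have -> : x = \sum_(i < D) \sum_(j < D) munit (i : nat, j : nat) *t blk i j.
  apply/matrixP => a b; rewrite summxE.
  case: (mxtens_indexP a) => i u; case: (mxtens_indexP b) => j v.
  rewrite (bigD1 i) // summxE [X in _ = X + _](bigD1 j) // tensmxE 2!mxE !eqxx mul1r.
  rewrite big1 => [|k kj].
    rewrite big1 => [|k ki]; first by rewrite /= !addr0.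
    rewrite summxE big1 // => l _.
    by rewrite tensmxE mxE [_ == _ :> nat](_ : _ = false) ?mul0r // eq_sym; apply/negbTE.
  by rewrite tensmxE mxE andbC [_ == _ :> nat](_ : _ = false) ?mul0r // eq_sym; apply/negbTE.
apply: solvable_sum => i _; apply: solvable_sum => j _.
have [ij|ij] := boolP (edge (grade i) (grade j)).
  apply: peel_solved (12%N) _ _ _; case/andP: cert => _ /allP/(_ (i : nat, j : nat)).
  rewrite ij /=; apply; apply/allpairsP; exists (i : nat, j : nat).
  by rewrite !mem_iota /= !ltn_ord.
have -> : blk i j = 0.
  by apply/matrixP => a b; rewrite !mxE ax // /tgrade !mxtens_indexK.
have -> : munit (i : nat, j : nat) *t (0 : 'M_m) = 0 by apply/matrixP => a b; rewrite !mxE mulr0.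
exact: solvable0.
Qed.

Lemma certified_arrowed_munit p (B : 'M[F]_m) : p \in y' :: ys ->
  arrowed tgrade edge (munit p *t B : 'M_N).
Proof.
move=> py i j ij; case/andP: cert => /allP/(_ p py) ep _; rewrite !mxE.
case: eqP => [ip|_]; last by rewrite mul0r.
case: eqP => [jp|_]; last by rewrite mul0r.
by move: ij; rewrite /tgrade ip jp ep.
Qed.

Lemma certified_arrowed_Y : arrowed tgrade edge (cert_Y *t (1%:M : 'M_m) : 'M_N).
Proof.
rewrite /cert_Y tens_sum => i j ij; rewrite summxE big_seq big1 // => p py.
by rewrite certified_arrowed_munit // inE py orbT.
Qed.

Lemma graded_tens_right (B : 'M[F]_m) : graded tgrade ((1%:M : 'M_D) *t B : 'M_N).
Proof.
move=> i j ij; rewrite !mxE; case: eqP => [eq_ij|_]; last by rewrite mul0r.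
by move: ij; rewrite /tgrade eq_ij eqxx.
Qed.
End Peeling.

(** * Unitary representations of dimension a multiple of delta *)

Section Brick.
Local Open Scope sesquilinear_scope.
Variables (G : ext_dynkin) (col : vertex G -> bool) (C : numClosedFieldType).
Hypothesis hcol : proper_colouring col.
Variables (n : nat) (S : vertex G -> 'M[C]_n) (w : vertex G -> vertex G -> 'M[C]_n).
Variables (d : vec G int) (f : vec G C).
Hypotheses (repw : scalar_rep S w d f) (hermw : hermitian_rep S w).
Variable phi : vertex G -> 'M[C]_n.
Hypothesis phiS : forall g, phi g *m S g = phi g.
Hypothesis Sphi : forall g, S g *m phi g = phi g.

(** Schur's lemma: an eigenvalue a at one nonzero space makes the kernels of phi - a a nonzero
    subrepresentation. *)
Lemma intertwiner_scalar :
  (forall g h, adjacent g h -> phi g *m w g h = w g h *m phi h) ->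
  exists a, forall g, phi g = a *: S g.
Proof.
move=> comw; have [[g Sg] simpS] := rep_simple repw.
have [r [u [v [r_gt0 uv vu]]]] : exists r (u : 'M_(n, r)) v,
    [/\ (0 < r)%N, u *m v = S g & v *m u = 1%:M].
  have [u [v [uv vu]]] := idem_factor (rep_idem repw g) (erefl _).
  by exists _, u, v; split; rewrite ?lt0n ?mxrank_eq0.
have [a /eigenvalueP[x xphi x0]] := eigenvalue_closed (v *m phi g *m u) r_gt0.
have xv0 : x *m v != 0.
  by apply: contraNneq x0 => xv; rewrite -[x]mulmx1 -vu mulmxA xv mul0mx.
have xvS : x *m v *m S g = x *m v by rewrite -uv -!mulmxA (mulmxA v) vu mul1mx.
exists a => h.
pose U k := (S k :&: kermx (phi k - a%:M))%MS.
have [k|k l kl|U0|Ufull] := simpS U; first exact: capmxSl.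
- rewrite sub_capmx; apply/andP; split.
    by rewrite -(rep_tgtK repw kl) mulmxA submxMl.
  apply/sub_kermxP; rewrite -mulmxA mulmxBr mul_mx_scalar -comw // -mul_scalar_mx -mulmxBl mulmxA.
  by have /sub_kermxP -> : (U k <= kermx (phi k - a%:M))%MS := capmxSr _ _; rewrite mul0mx.
- have : (x *m v <= U g)%MS.
    rewrite sub_capmx -{1}xvS submxMl; apply/sub_kermxP.
    rewrite mulmxBr mul_mx_scalar -{1}(phiS g) -uv !mulmxA.
    by rewrite -2!(mulmxA x) xphi -scalemxAl subrr.
  by rewrite U0 submx0 (negPf xv0).
have : (S h <= kermx (phi h - a%:M))%MS by apply: submx_trans (Ufull h) (capmxSr _ _).
by move/sub_kermxP; rewrite mulmxBr Sphi mul_mx_scalar => /eqP; rewrite subr_eq0 => /eqP.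
Qed.

(* For a bipartite orientation a one-sided intertwiner commutes with the adjoint
   maps too: summing squared norms of the defects telescopes to zero. *)
Lemma unitary_brick :
  (forall g h, col g -> adjacent g h -> phi g *m w g h = w g h *m phi h) ->
  exists a, forall g, phi g = a *: S g.
Proof.
move=> comw; apply: intertwiner_scalar.
have [hS hw] := hermw.
have phiS' g : S g *m (phi g)^t* = (phi g)^t* by rewrite -{1}(hS g) -trmxC_mul phiS.
have Sphi' g : (phi g)^t* *m S g = (phi g)^t* by rewrite -{1}(hS g) -trmxC_mul Sphi.
pose q g := f g * \tr (phi g *m (phi g)^t*).
have sumq g : q g = \sum_(h | adjacent g h) \tr (phi g *m w g h *m w h g *m (phi g)^t*).
  rewrite -raddf_sum -mulmx_suml; under eq_bigr => h _ do rewrite -mulmxA.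
  rewrite -mulmx_sumr (rep_scal repw) -scalemxAr -scalemxAl phiS.
  by rewrite /q /= mxtraceZ.
have sumq1 g : q g = \sum_(h | adjacent g h) \tr (phi g *m (phi g)^t* *m w g h *m w h g).
  under eq_bigr => h _ do rewrite -mulmxA.
  rewrite -raddf_sum -mulmx_sumr (rep_scal repw) -scalemxAr -mulmxA Sphi'.
  by rewrite /q /= mxtraceZ.
have sumq2 g : q g = \sum_(h | adjacent g h) \tr ((phi g)^t* *m phi g *m w g h *m w h g).
  under eq_bigr => h _ do rewrite -mulmxA.
  rewrite -raddf_sum -mulmx_sumr (rep_scal repw) -scalemxAr -mulmxA phiS.
  by rewrite /q /= mxtraceZ mxtrace_mulC.
have comw' g h : col g -> adjacent g h -> w h g *m (phi g)^t* = (phi h)^t* *m w h g.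
  by move=> gc gh; rewrite -(hw g h) // -!trmxC_mul comw.
have swap (E : vertex G -> vertex G -> C) :
    \sum_(g | col g == true) \sum_(h | adjacent g h) E g h =
    \sum_(h | col h == false) \sum_(g | adjacent h g) E g h.
  exact: (sum_adj_swap hcol true).
have wcol g : (col g == true) = col g by case: (col g).
(* Moving phi and its adjoint across every edge exchanges the weighted squared norms of the two
   colours. *)
have qE : \sum_(g | col g == true) q g = \sum_(h | col h == false) q h.
  under eq_bigr => g _ do rewrite sumq.
  rewrite swap; apply: eq_bigr => h hb; rewrite sumq1; apply: eq_bigr => g hg.
  have gc : col g by rewrite (adj_col hcol hg) (eqP hb).
  have gh : adjacent g h by rewrite adjacentC.
  rewrite comw // -mulmxA comw' // mulmxA mxtrace_mulC !mulmxA mxtrace_mulC !mulmxA.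
  by rewrite mxtrace_mulC !mulmxA.
pose M g h := w h g *m phi g - phi h *m w h g.
(* With Q the common value in [qE], the four traces add up to Q - Q - Q + Q. *)
have sumM : \sum_(g | col g == true) \sum_(h | adjacent g h) \tr (M g h *m (M g h)^t*) = 0.
  transitivity (\sum_(g | col g == true) \sum_(h | adjacent g h)
     (\tr (phi g *m (phi g)^t* *m w g h *m w h g)
      - \tr (phi h *m (phi h)^t* *m w h g *m w g h) - \tr (phi h *m (phi h)^t* *m w h g *m w g h)
      + \tr ((phi h)^t* *m phi h *m w h g *m w g h))).
    apply: eq_bigr => g gc; apply: eq_bigr => h gh; rewrite wcol in gc.
    have hwg : (w h g)^t* = w g h by rewrite hw // adjacentC.
    rewrite /M trmxCB !trmxC_mul hwg mulmxBl !mulmxBr !linearB /= opprB.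
    have -> : \tr (w h g *m phi g *m ((phi g)^t* *m w g h)) =
        \tr (phi g *m (phi g)^t* *m w g h *m w h g).
      by rewrite -mulmxA mxtrace_mulC !mulmxA.
    have -> : \tr (w h g *m phi g *m (w g h *m (phi h)^t*)) =
        \tr (phi h *m (phi h)^t* *m w h g *m w g h).
      by rewrite -mulmxA (mulmxA (phi g)) comw // !mulmxA -(mulmxA _ (phi h)) mxtrace_mulC !mulmxA.
    have -> : \tr (phi h *m w h g *m ((phi g)^t* *m w g h)) =
        \tr (phi h *m (phi h)^t* *m w h g *m w g h).
      by rewrite -mulmxA (mulmxA (w h g)) comw' // !mulmxA.
    have -> : \tr (phi h *m w h g *m (w g h *m (phi h)^t*)) =
        \tr ((phi h)^t* *m phi h *m w h g *m w g h).
      by rewrite -(mulmxA (phi h)) (mulmxA (w h g)) mulmxA mxtrace_mulC !mulmxA.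
    ring.
  under eq_bigr => g _ do rewrite !(big_split, sumrN) /= -sumq1.
  have s1 : \sum_(g | col g == true) \sum_(h | adjacent g h)
      \tr (phi h *m (phi h)^t* *m w h g *m w g h) = \sum_(h | col h == false) q h.
    by rewrite swap; apply: eq_bigr => h _; rewrite sumq1.
  have s2 : \sum_(g | col g == true) \sum_(h | adjacent g h)
      \tr ((phi h)^t* *m phi h *m w h g *m w g h) = \sum_(h | col h == false) q h.
    by rewrite swap; apply: eq_bigr => h _; rewrite sumq2.
  rewrite !(big_split, sumrN) /= s1 s2 qE; ring.
have M0 g h : col g -> adjacent g h -> M g h = 0.
  move=> gc gh; apply: mxtrace_mulC_eq0; rewrite -wcol in gc.
  have ge0 k l : 0 <= \tr (M k l *m (M k l)^t*) by exact: mxtrace_mulC_ge0.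
  have /(_ g gc) := psumr_eq0P (fun k _ => sumr_ge0 _ (fun l _ => ge0 k l)) sumM.
  by move/(psumr_eq0P (fun l _ => ge0 g l)) => /(_ h gh).
move=> g h gh; case gc: (col g); first exact: comw.
have hc : col h by rewrite (adj_col hcol gh) gc.
have hg : adjacent h g by rewrite adjacentC.
by have /eqP := M0 h g hc hg; rewrite subr_eq0 => /eqP.
Qed.
End Brick.

(* A vertex is encoded by its branch and its position; [(4, 0)] is the centre. *)
Definition code (G : ext_dynkin) (g : vertex G) : nat * nat :=
  if g is Some u then (tag u : nat, tagged u : nat) else (4, 0)%N.

(* [delta g] basis vectors at each vertex [g], in the order of the branches, the
   centre coming last. *)
Definition basis_codes (G : ext_dynkin) : seq (nat * nat) :=
  flatten [seq flatten [seq nseq `|nth (0 : int)%R (nth [::] (delta_branches G) j) i|%N (j, i)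
                       | i <- iota 0 (nth 0%N (lengths G) j)]
          | j <- iota 0 (nbranches G)] ++ nseq `|delta_center G|%N (4, 0)%N.

Definition code_white (G : ext_dynkin) (a : nat * nat) : bool :=
  (a.1 == 4) || ~~ odd (nth 0%N (lengths G) a.1 - a.2).

Definition code_toward (G : ext_dynkin) (a b : nat * nat) : bool :=
  if a.1 == 4 then false
  else if b.1 == 4 then a.2.+1 == nth 0%N (lengths G) a.1
  else (a.1 == b.1) && (a.2.+1 == b.2).

Definition code_edge (G : ext_dynkin) (a b : nat * nat) : bool :=
  code_white G a && (code_toward G a b || code_toward G b a).

(* A bipartite representation [Y] of dimension [delta] with scalar endomorphisms,
   given by its entries equal to 1, and an entry which spans its self-extensions. *)
Definition brick_entries (G : ext_dynkin) : seq (nat * nat) :=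
  match G with
  | D4 =>
    [:: (4, 2); (4, 3); (5, 0); (5, 1); (5, 3)]%N
  | E6 =>
    [:: (0, 1); (3, 5); (6, 8); (9, 4); (9, 7); (10, 2); (10, 4); (10, 8);
      (11, 1); (11, 5); (11, 7)]%N
  | E7 =>
    [:: (1, 0); (1, 4); (2, 3); (7, 6); (7, 9); (8, 6); (8, 10); (14, 11);
      (14, 12); (15, 4); (15, 12); (15, 13); (16, 3); (16, 10); (16, 13);
      (17, 5); (17, 9)]%N
  | E8 =>
    [:: (1, 5); (2, 0); (2, 3); (6, 3); (6, 14); (7, 10); (8, 5); (8, 11);
      (9, 4); (9, 12); (15, 17); (16, 19); (24, 13); (24, 17); (25, 10);
      (25, 12); (25, 13); (25, 21); (26, 12); (26, 20); (27, 11); (27, 18);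
      (27, 23); (28, 13); (28, 14); (28, 23); (29, 10); (29, 19); (29, 22)]%N
  end.

Definition extension_entry (G : ext_dynkin) : nat * nat :=
  match G with
  | D4 => (4, 1) | E6 => (9, 2) | E7 => (15, 9) | E8 => (29, 18)
  end%N.

Lemma brick_certified (G : ext_dynkin) :
  certified (4, 0)%N (basis_codes G) (code_edge G) (brick_entries G) (extension_entry G).
Proof. by case: G; vm_compute. Qed.

Section Codes.
Variable G : ext_dynkin.

Lemma branch_neq4 (j : 'I_(nbranches G)) : (j == 4 :> nat) = false.
Proof. by apply/ltn_eqF/(leq_trans (ltn_ord j)); case: (G). Qed.

Lemma code_inj : injective (@code G).
Proof.
case=> [[j i]|] [[j' i']|] //= [].
- move=> /val_inj jj; case: _ / jj i' => i' /val_inj ->.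
  by [].
- by move=> /eqP; rewrite branch_neq4.
by move=> /esym/eqP; rewrite branch_neq4.
Qed.

Definition white (g : vertex G) : bool := code_white G (code g).

Lemma code_edgeE g h : code_edge G (code g) (code h) = white g && adjacent g h.
Proof.
congr (_ && _); rewrite /adjacent; case: g h => [[j i]|] [[j' i']|] //=.
- by rewrite /code_toward /= !branch_neq4.
- by rewrite /code_toward /= branch_neq4.
by rewrite /code_toward /= branch_neq4.
Qed.

Lemma white_colouring : proper_colouring white.
Proof.
have tw g h : toward g h -> white g != white h.
  rewrite /white /code_white; case: g h => [[j i]|] [[j' i']|] //=; rewrite !branch_neq4 /=.
    case/andP=> /eqP jj; case: _ / jj i' => i' /eqP ii; rewrite -ii.
    have lt_i : (i.+1 < len j)%N by rewrite ii ltn_ord.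
    have -> : (nth 0 (lengths G) j - i = (len j - i.+1).+1)%N by rewrite -subSn // subSS.
    by rewrite /= -/(len j); case: odd.
  move=> /eqP ii; have -> : (nth 0 (lengths G) j - i = 1)%N by rewrite -[nth _ _ _]ii subSnn.
  by [].
by move=> g h /orP[/tw//|/tw]; rewrite eq_sym.
Qed.

Lemma count_basis g : count_mem (code g) (basis_codes G) = `|delta G g|%N.
Proof.
rewrite ffunE /basis_codes; case: g => [[j i]|]; last by case: (G).
by case: G j i => -[[|[|[|[|j]]]] lt_j] //= -[[|[|[|[|[|i]]]]] lt_i].
Qed.

Lemma basis_codeP a : a \in (basis_codes G) -> exists g : vertex G, a = code g.
Proof.
rewrite mem_cat => /orP[/flatten_mapP[j]|]; last first.
  by rewrite mem_nseq => /andP[_ /eqP->]; exists None.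
rewrite mem_iota => lt_j /flattenP[s sI].
case: (@mapP _ _ _ _ _ sI) => i; rewrite mem_iota => lt_i ->.
rewrite mem_nseq => /andP[_ /eqP->].
by exists (vtx (Ordinal (lt_i : (i < len (Ordinal lt_j))%N))).
Qed.

Lemma sum_mxtens (Z : nmodType) (a b : nat) (F : 'I_a -> 'I_b -> Z) :
  \sum_k F (mxtens_unindex k).1 (mxtens_unindex k).2 = \sum_i \sum_j F i j.
Proof.
rewrite pair_bigA (reindex (@mxtens_index a b)).
  by apply: eq_bigr => ij _; rewrite mxtens_indexK.
by exists (@mxtens_unindex a b) => k _; rewrite (mxtens_indexK, mxtens_unindexK).
Qed.

Section MinimalImaginary.
Local Open Scope sesquilinear_scope.
Variables (C : numClosedFieldType) (d : vec G int) (f : vec G C).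

(** For c at least 2 the representation is transported to a graded space with c delta_g basis
    vectors in degree g. There the deformation argument produces a nonscalar endomorphism, which
    unitarity excludes. *)
Lemma unitary_delta_multiple (c : int) : has_unitary_rep d f ->
  (forall g, d g = c * delta G g) -> c = 1.
Proof.
move=> [n [S [w [repw hermw]]]] dE.
have [e de1] := delta_eq1 G.
have c_ge0 : 0 <= c by have := rep_dim_ge0 repw e; rewrite dE de1 mulr1.
have [m cE] : exists m : nat, c = m by case: (c) c_ge0 => // m; exists m.
case: m cE => [|[|m]] cE //.
  have [[g Sg] _] := rep_simple repw; case/eqP: Sg; apply/eqP.
  by rewrite -(rep_dim_eq0 repw) dE cE mul0r.
exfalso; pose cs := basis_codes G; pose D := size cs; pose N := (D * m.+2)%N.
pose gr : 'I_N -> nat * nat := tgrade (4, 0)%N (m := m.+2).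
pose E (g : vertex G) : 'M[C]_N := grade_proj _ gr (code g).
have EE g : E g *m E g = E g.
  by apply/matrixP => i j; rewrite grade_projE !mxE; case: eqP => _; rewrite ?mul1r ?mul0r ?mul0rn.
have trE g : \tr (E g) = (m.+2 * `|delta G g|)%:R.
  rewrite /E /grade_proj mxtrace_diag (eq_bigr (fun k =>
    (nth (4, 0)%N cs (mxtens_unindex k).1 == code g)%:R)) => [|k _]; last by rewrite mxE.
  rewrite (sum_mxtens (fun i _ => (nth (4, 0)%N cs i == code g)%:R)).
  rewrite (eq_bigr (fun i : 'I_D => m.+2%:R * (nth (4, 0)%N cs i == code g)%:R)) => [|i _];
    last first.
    by rewrite sumr_const card_ord mulr_natl.
  rewrite -mulr_sumr natrM; congr (_ * _).
  rewrite -count_basis -sum1_count natr_sum [RHS]big_mkcond (big_nth (4, 0)%N) big_mkord.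
  by apply: eq_bigr => i _; rewrite /=; case: eqP.
have rankE g : \rank (E g) = \rank (S g).
  apply/eqP; rewrite -(eqr_nat C) -!mxtrace_idem ?(rep_idem repw) // trE (rep_dim repw) dE cE.
  have dabs : delta G g = `|delta G g|%N by rewrite gez0_abs // ltW // delta_gt0.
  by rewrite {2}dabs -PoszM.
(* Mutually inverse isomorphisms between the space at g and the homogeneous part of degree [code g];
   they exist as the dimensions agree. *)
have /fin_all_exists[RK RKP] (g : vertex G) : exists RK : 'M[C]_(N, n) * 'M[C]_(n, N),
    [/\ RK.2 *m RK.1 = S g, RK.1 *m RK.2 = E g, E g *m RK.1 = RK.1 & RK.2 *m E g = RK.2].
  have [u [v [uv vu]]] := idem_factor (rep_idem repw g) (erefl _).
  have [u' [v' [uv' vu']]] := idem_factor (EE g) (rankE g).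
  move: (\rank (S g)) u v uv vu u' v' uv' vu' => r u v uv vu u' v' uv' vu'.
  exists (u' *m v, u *m v'); rewrite /= -uv -uv'; split.
  - by rewrite !mulmxA -(mulmxA u) vu' mulmx1.
  - by rewrite !mulmxA -(mulmxA u') vu mulmx1.
  - by rewrite !mulmxA -(mulmxA u') vu' mulmx1.
  - by rewrite !mulmxA -(mulmxA u) vu' mulmx1.
pose R g := (RK g).1; pose K g := (RK g).2.
have KR g : K g *m R g = S g by have [] := RKP g.
have RKE g : R g *m K g = E g by have [] := RKP g.
have ER g : E g *m R g = R g by have [] := RKP g.
have KE g : K g *m E g = K g by have [] := RKP g.
clearbody R K.
(* Only maps leaving white vertices are kept, as in the bipartite brick. *)
pose X : 'M[C]_N := \sum_(g | white g) \sum_(h | adjacent g h) R g *m w g h *m K h.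
have arrX : arrowed gr (code_edge G) X.
  move=> i j ij; rewrite /X summxE big1 // => g wg; rewrite summxE big1 // => h gh.
  rewrite -ER -(KE h) -!mulmxA grade_projE !mulmxA mul_grade_projE.
  case: eqP => [gi|_]; last by rewrite mul0r.
  case: eqP => [gj|_]; last by rewrite mulr0 mulr0.
  by move: ij; rewrite gi gj code_edgeE wg gh.
have D_gt0 : (0 < D)%N by rewrite /D /cs; case: (G).
apply: (@deformation_not_brick C D m _ gr (code_edge G) (cert_Y C cs (brick_entries G))
  (munit C cs (extension_entry G)) _ _ _ _ X arrX (Ordinal D_gt0)).
- by apply: certified_arrowed_Y; exact: brick_certified.
- by move=> B; apply: (certified_arrowed_munit (brick_certified G)); rewrite mem_head.
- exact: graded_tens_right.
- exact: (certified_solvable (brick_certified G)).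
move=> Phi gPhi comPhi.
have EPhi g : E g *m Phi = Phi *m E g by have /gradedP := gPhi; apply.
pose phi g := K g *m Phi *m R g.
have EEh g h : E g *m E h = if g == h then E g else 0.
  case: eqP => [<-|gh]; first exact: EE.
  apply/matrixP => i j; rewrite grade_projE !mxE.
  case: eqP => [gi|_]; last by rewrite mul0r.
  case: eqP => [gi'|_]; last by rewrite mul0rn mulr0.
  by case: gh; apply: code_inj; rewrite -gi.
have RR g h : E g *m R h = if g == h then R h else 0.
  by rewrite -(ER h) mulmxA EEh; case: eqP => [->|_]; rewrite ?mul0mx // !ER.
have KEh g h : K g *m E h = if g == h then K g else 0.
  by rewrite -(KE g) -mulmxA EEh; case: eqP => [_|_]; rewrite ?mulmx0 // !KE.
have EXE g h : white g -> adjacent g h -> E g *m X *m E h = R g *m w g h *m K h.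
  move=> wg gh; rewrite /X mulmx_sumr (bigD1 g) //= [X in _ + X]big1 ?addr0; last first.
    move=> k /andP[_ /negPf kg]; rewrite mulmx_sumr big1 // => l _.
    by rewrite !mulmxA RR eq_sym kg !mul0mx.
  rewrite mulmx_sumr mulmx_suml (bigD1 h) //= [X in _ + X]big1 ?addr0; last first.
    by move=> l /andP[_ /negPf lh]; rewrite -!mulmxA KEh lh !mulmx0.
  by rewrite !mulmxA RR eqxx -mulmxA KE.
have [a phiE] : exists a, forall g, phi g = a *: S g.
  apply: (unitary_brick white_colouring repw hermw).
  - by move=> g; rewrite /phi -(KR g) !mulmxA -(mulmxA _ (R g) (K g)) RKE -(mulmxA _ (E g)) ER.
  - by move=> g; rewrite /phi -(KR g) !mulmxA -(mulmxA _ (R g) (K g)) RKE KE.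
  move=> g h wg gh; have Kw : K g *m X *m E h = w g h *m K h.
    by rewrite -{1}(KE g) -(mulmxA (K g)) -(mulmxA (K g)) EXE // !mulmxA KR (rep_srcK repw).
  have wR : E g *m X *m R h = R g *m w g h.
    by rewrite -(ER h) mulmxA EXE // -mulmxA KR -mulmxA (rep_tgtK repw).
  rewrite /phi -mulmxA -wR !mulmxA -(mulmxA (K g)) -EPhi mulmxA KE -(mulmxA (K g)) comPhi.
  by rewrite mulmxA -Kw -(mulmxA _ (E h)) EPhi -!mulmxA ER.
apply/is_scalar_mxP; exists a; apply/matrixP => i j.
have [g gi] : exists g : vertex G, gr i = code g.
  by apply: basis_codeP; rewrite mem_nth.
have [ij|ij] := eqVneq (gr i) (gr j); last first.
  rewrite gPhi // mxE; have [eij|//] := eqVneq i j.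
  by rewrite eij eqxx in ij.
have : E g *m Phi *m E g = a *: E g.
  have -> : E g *m Phi *m E g = R g *m phi g *m K g by rewrite /phi -RKE !mulmxA.
  by rewrite phiE -scalemxAr -scalemxAl -KR !mulmxA RKE -mulmxA RKE EE.
move/matrixP/(_ i j).
rewrite mul_grade_projE grade_projE !mxE -ij gi eqxx mul1r mulr1 => ->.
by rewrite mulrnAr mulr1.
Qed.
End MinimalImaginary.
End Codes.

(** * Vanishing defect *)

Section ZeroDefect.
Variable G : ext_dynkin.

(** By connectedness a colouring is fixed by its value at the centre, so changing it at most changes
    the sign of the defect. *)
Lemma colouring_white (col : vertex G -> bool) : proper_colouring col ->
  forall g, col g = (white g == col None).
Proof.
move=> hcol g; elim/vertex_ind: g => [|g h gh IHh].
  by case: (col None).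
have adj_gh : adjacent h g by rewrite /adjacent gh orbT.
rewrite (adj_col hcol adj_gh) (adj_col (@white_colouring G) adj_gh) IHh.
by case: (white h); case: (col None).
Qed.

Lemma defect_white (Z : comPzRingType) (col : vertex G -> bool) b (x : vec G Z) :
  proper_colouring col ->
  defect col b x = if b == col None then defect (@white G) true x else - defect (@white G) true x.
Proof.
move=> hcol; transitivity (defect (@white G) (b == col None) x).
  rewrite /defect /wsum; congr (_ - _); apply: eq_bigl => g;
    by rewrite (colouring_white hcol); case: (white g); case: (col None); case: (b).
by case: (b == col None); rewrite // -defectN.
Qed.

(** The default value matters: position [len j] is out of range and gives the centre, so each branch
    becomes a chain from its outer end up to and including the centre. *)
Definition vof (j i : nat) : vertex G :=
  if insub j : option 'I_(nbranches G) is Some j' then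
    if insub i : option 'I_(len j') is Some i' then vtx i' else None
  else None.

Lemma vofE (j : 'I_(nbranches G)) (i : 'I_(len j)) : vof j i = vtx i.
Proof. by rewrite /vof valK valK. Qed.

Lemma vof_ord j i (lt_j : (j < nbranches G)%N) (lt_i : (i < nth 0%N (lengths G) j)%N) :
  vof j i = vtx (Ordinal (lt_i : (i < len (Ordinal lt_j))%N)).
Proof. by rewrite -vofE. Qed.

Lemma delta_vof j i : (j < nbranches G)%N -> (i < nth 0%N (lengths G) j)%N ->
  delta G (vof j i) = nth 0 (nth [::] (delta_branches G) j) i.
Proof. by move=> lt_j lt_i; rewrite (vof_ord lt_j lt_i) ffunE. Qed.

Lemma white_vof j i : (j < nbranches G)%N -> (i < nth 0%N (lengths G) j)%N ->
  white (vof j i) = ~~ odd (nth 0%N (lengths G) j - i).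
Proof.
move=> lt_j lt_i; rewrite (vof_ord lt_j lt_i) /white /code_white /=.
by have := branch_neq4 (Ordinal lt_j) => /= ->.
Qed.

Lemma sum_vof (Z : nmodType) (F : vertex G -> Z) :
  \sum_g F g = F None + \sum_(0 <= j < nbranches G)
     \sum_(0 <= i < nth 0%N (lengths G) j) F (vof j i).
Proof.
rewrite sum_vertex big_mkord; congr (_ + _); apply: eq_bigr => j _.
by rewrite big_mkord; apply: eq_bigr => i _; rewrite vofE.
Qed.

Lemma defect_whiteE (Z : comPzRingType) (x : vec G Z) :
  defect (@white G) true x = \sum_g (if white g then (delta G g)%:~R * x g else - ((delta G g)%:~R * x g)).
Proof.
rewrite [RHS](bigID (@white G)) /= /defect /wsum; congr (_ + _).
  by apply: eq_big => g; case: (white g).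
by rewrite -sumrN; apply: eq_big => g; case: (white g).
Qed.
End ZeroDefect.

Definition increasing_dim G (d : vec G int) :=
  forall j : 'I_(nbranches G),
    [/\ forall i : 'I_(len j), 0 < d (vtx i),
        forall i i' : 'I_(len j), (i < i')%N -> d (vtx i) < d (vtx i')
      & forall i : 'I_(len j), d (vtx i) < d None].

(** A longest branch has length one less than delta at the centre, so strict increase below N pins
    down that branch and N. The shorter branches of E7 and E8 follow from the defect equation, on E8
    with the help of the bounds by delta. *)
Lemma increasing_arith G (N : int) (D : nat -> nat -> int) :
  (forall j i, (j < nbranches G)%N -> (i < nth 0%N (lengths G) j)%N ->
    [/\ 0 < D j i, D j i < N & (i.+1 < nth 0%N (lengths G) j)%N -> D j i < D j i.+1]) ->
  (forall j i, (j < nbranches G)%N -> (i < nth 0%N (lengths G) j)%N ->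
    D j i <= nth 0 (nth [::] (delta_branches G) j) i) ->
  N <= delta_center G ->
  delta_center G * N + \sum_(0 <= j < nbranches G) \sum_(0 <= i < nth 0%N (lengths G) j)
    (if ~~ odd (nth 0%N (lengths G) j - i)
     then nth 0 (nth [::] (delta_branches G) j) i * D j i
     else - (nth 0 (nth [::] (delta_branches G) j) i * D j i)) = 0 ->
  N = delta_center G /\ forall j i, (j < nbranches G)%N ->
    (i < nth 0%N (lengths G) j)%N -> D j i = nth 0 (nth [::] (delta_branches G) j) i.
Proof.
case: G => dn le_dn /= le_N; rewrite /index_iota /= !(big_cons, big_nil) /= => sum0.
- have [? ? _] := dn 0%N 0%N isT isT; have [? ? _] := dn 1%N 0%N isT isT.
  have [? ? _] := dn 2%N 0%N isT isT; have [? ? _] := dn 3%N 0%N isT isT.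
  have /= ? := le_dn 0%N 0%N isT isT; have /= ? := le_dn 1%N 0%N isT isT.
  split; first by lia.
  by move=> [|[|[|[|j]]]] [|i] //= _ _; lia.
- have [? ? /(_ isT) ?] := dn 0%N 0%N isT isT; have [? ? _] := dn 0%N 1%N isT isT.
  have [? ? /(_ isT) ?] := dn 1%N 0%N isT isT; have [? ? _] := dn 1%N 1%N isT isT.
  have [? ? /(_ isT) ?] := dn 2%N 0%N isT isT; have [? ? _] := dn 2%N 1%N isT isT.
  by split; [lia|move=> [|[|[|j]]] [|[|i]] //= _ _; lia].
- have [? ? /(_ isT) ?] := dn 0%N 0%N isT isT; have [? ? /(_ isT) ?] := dn 0%N 1%N isT isT.
  have [? ? _] := dn 0%N 2%N isT isT.
  have [? ? /(_ isT) ?] := dn 1%N 0%N isT isT; have [? ? /(_ isT) ?] := dn 1%N 1%N isT isT.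
  have [? ? _] := dn 1%N 2%N isT isT; have [? ? _] := dn 2%N 0%N isT isT.
  by split; [lia|move=> [|[|[|j]]] [|[|[|i]]] //= _ _; lia].
have [? ? /(_ isT) ?] := dn 0%N 0%N isT isT; have [? ? /(_ isT) ?] := dn 0%N 1%N isT isT.
have [? ? /(_ isT) ?] := dn 0%N 2%N isT isT; have [? ? /(_ isT) ?] := dn 0%N 3%N isT isT.
have [? ? _] := dn 0%N 4%N isT isT; have [? ? /(_ isT) ?] := dn 1%N 0%N isT isT.
have [? ? _] := dn 1%N 1%N isT isT; have [? ? _] := dn 2%N 0%N isT isT.
have /= ? := le_dn 1%N 0%N isT isT; have /= ? := le_dn 1%N 1%N isT isT.
have /= ? := le_dn 2%N 0%N isT isT.
by split; [lia|move=> [|[|[|j]]] [|[|[|[|[|i]]]]] //= _ _; lia].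
Qed.

Lemma increasing_below_delta G (d : vec G int) : increasing_dim d ->
  (forall g, d g <= delta G g) -> defect (@white G) true d = 0 -> d = delta G.
Proof.
move=> incd le_d; rewrite defect_whiteE sum_vof => sum0.
have [] := @increasing_arith G (d None) (fun j i => d (vof G j i)).
- move=> j i lt_j lt_i; have [d0 dlt dN] := incd (Ordinal lt_j).
  rewrite (vof_ord lt_j lt_i); split=> // lt_i'; rewrite (vof_ord lt_j lt_i').
  exact: dlt.
- by move=> j i lt_j lt_i; rewrite -delta_vof.
- by have := le_d None; rewrite ffunE.
- rewrite -[RHS]sum0 /= {1}ffunE intz; congr (_ + _).
  rewrite big_nat [RHS]big_nat; apply: eq_bigr => j /= lt_j.
  rewrite big_nat [RHS]big_nat; apply: eq_bigr => i /= lt_i.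
  by rewrite white_vof // delta_vof // intz.
move=> dN dE; apply/ffunP => -[[j i]|]; rewrite ffunE //= -dE //.
by rewrite vofE.
Qed.

Section ZeroDefectRep.
Local Open Scope complex_scope.
Variables (R : realType) (G : ext_dynkin) (col : vertex G -> bool).
Hypothesis hcol : proper_colouring col.
Variables (d : vec G int) (f : vec G R).
Hypothesis repd : has_unitary_rep d (cvec f).
Hypothesis f_gt0 : positive f.

Lemma pairing_delta (h : vec G R) : pairing col (cvec h) (delta G) = (defect col true h)%:C.
Proof.
rewrite /pairing /defect /wsum (bigID (fun g => col g == true)) /= rmorphB !rmorph_sum /=.
rewrite -sumrN; congr (_ + _); apply: eq_big => g; try by case: (col g).
  by case: (col g) => // _; rewrite cvecE mulrC rmorphM rmorph_int.
by case: (col g) => // _; rewrite cvecE mulNr mulrC rmorphM rmorph_int.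
Qed.

Lemma pairing_dim : pairing col (cvec f) d = 0.
Proof.
have := has_rep_trace hcol true (unitary_has_rep repd) => /= trE.
transitivity (\sum_(g | col g == true) cvec f g * (d g)%:~R
              - \sum_(g | col g == false) cvec f g * (d g)%:~R).
  rewrite /pairing (bigID (fun g => col g == true)) /= -sumrN; congr (_ + _).
    by apply: eq_bigr => g /eqP->.
  by apply: eq_big => g; case: (col g) => // _; rewrite mulNr.
by rewrite trE subrr.
Qed.

(** [height_linear] applies for both starting colours. A linear function of n that stays nonnegative
    cannot decrease, so the defect of f is at most 0 for either sign. *)
Lemma zero_defect_scal (x : vec G int) : d = shift x 1 -> (forall g, 0 <= x g) ->
  quad col x <= 1 -> defect col true x = 0 -> defect col true f = 0.
Proof.
move=> dE x0 q1 def0.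
have lin b n : 0 <= height f - (2 * n)%:R * defect col b f.
  have := @height_linear R G col hcol n (~~ b) d f x repd f_gt0 dE x0 q1.
  rewrite negbK; apply; case: (b); last exact: def0.
  by rewrite defectN def0 oppr0.
have le0 b : defect col b f <= 0.
  rewrite leNgt; apply/negP => def_gt0.
  have [n lt_n] : exists n : nat, height f / defect col b f < n%:R.
    by exists (Num.trunc (height f / defect col b f)).+1; rewrite truncnS_gt.
  have := lin b n; rewrite subr_ge0 leNgt => /negP[].
  rewrite ltr_pdivrMr // in lt_n; apply: lt_le_trans lt_n _.
  by rewrite ler_pM2r // ler_nat leq_pmull.
apply/eqP; rewrite eq_le le0 /= -oppr_le0 -defectN.
exact: le0.
Qed.

Lemma zero_defect_delta : increasing_dim d -> defect col true d = 0 ->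
  d = delta G /\ defect col true f = 0.
Proof.
move=> incd def0.
have q1 := has_rep_quad hcol (unitary_has_rep repd).
have deltaE (y : vec G int) : y = delta G -> quad col y = 0.
  move=> ->; apply: (mulfI (_ : 2%:R != 0)) => //.
  rewrite mulr0 quad_bilinear // big1 // => g _.
  by rewrite /nbr_sum delta_harmonic subrr mulr0.
have [q0|qN0] := eqVneq (quad col d) 0.
  have [c dE] := quad_eq0 hcol q0.
  have c1 := unitary_delta_multiple repd dE.
  have dd : d = delta G by apply/ffunP => g; rewrite dE c1 mul1r.
  by split=> //; have := pairing_dim; rewrite dd pairing_delta => /(congr1 (@complex.Re R)).
have qd : quad col d = 1 by move: q1 qN0 (quad_ge0 hcol d); move: (quad col d) => q; lia.
exfalso; pose x := shift d (-1).
have dx : d = shift x 1 by apply/ffunP => g; rewrite !shiftE; lia.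
have qx : quad col x = 1 by rewrite quad_shift.
have defx : defect col true x = 0.
  have defB : defect col true x = defect col true d - defect col true (delta G).
    have wB b : wsum col b x = wsum col b d - wsum col b (delta G).
      by rewrite /wsum -sumrB; apply: eq_bigr => g _; rewrite shiftE; ring.
    by rewrite /defect !wB; ring.
  have d0 : defect col true (delta G) = 0.
    have cd : cox col true (delta G) = delta G.
      apply/ffunP => g; rewrite coxE; case: ifP => // _.
      by rewrite /reflect_at delta_harmonic mulr_natl mulr2n addKr.
    by have := wsum_cox hcol true (delta G); rewrite /defect cd; lia.
  by rewrite defB def0 d0 subr0.
have qx1 : quad col x <= 1 by rewrite qx.
have [x0|x0] := root_sign hcol qx1.
  apply: (no_shifted_real_root hcol (unitary_has_rep repd) dx x0 qx).
  (* f pairs to 0 with d by the trace identity and with delta by its vanishing defect, hence also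
     with x = d - delta. *)
  have /(congr1 (fun z => z%:C)) := zero_defect_scal dx x0 qx1 defx.
  rewrite /= -pairing_delta rmorph0 => pd.
  transitivity (pairing col (cvec f) d - pairing col (cvec f) (delta G)).
    rewrite /pairing -sumrB; apply: eq_bigr => g _; rewrite shiftE -mulrBr; congr (_ * _).
    by rewrite mulN1r rmorphB.
  by rewrite pairing_dim pd subrr.
have d_delta : d = delta G.
  apply: increasing_below_delta incd _ _.
    by move=> g; have := x0 g; rewrite shiftE; lia.
  by move: def0; rewrite (defect_white true d hcol); case: eqP => // _ /eqP;
    rewrite oppr_eq0 => /eqP.
by move: qd; rewrite deltaE.
Qed.
End ZeroDefectRep.

Section Hyperplane.
Variables (R : realType) (G : ext_dynkin).
Implicit Types chi : vec G R.

Lemma branch_vof (Z : Type) (x : vec G Z) (j : 'I_(nbranches G)) :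
  branch x j = [seq x (vof G j i) | i <- iota 0 (len j)].
Proof.
rewrite -val_enum_ord -map_comp; apply: eq_map => i /=.
by rewrite vofE.
Qed.

Lemma on_branches_vof (Z : zmodType) F (x : vec G Z) j i : (j < nbranches G)%N ->
  (i < nth 0%N (lengths G) j)%N ->
  on_branches F x (vof G j i) = nth 0 (F [seq x (vof G j i) | i <- iota 0 (nth 0%N (lengths G) j)]) i.
Proof. by move=> lt_j lt_i; rewrite (vof_ord lt_j lt_i) ffunE /= branch_vof. Qed.

Lemma hyperplane_arith (A : nat -> nat -> R) (N : R) :
  (delta_center G)%:~R * N + \sum_(0 <= j < nbranches G)
    \sum_(0 <= i < nth 0%N (lengths G) j)
     (let a := nth 0 (Mf_branch [seq A j i | i <- iota 0 (nth 0%N (lengths G) j)]) i in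
      let c := (nth 0 (nth [::] (delta_branches G) j) i)%:~R in
      if ~~ odd (nth 0%N (lengths G) j - i) then c * a else - (c * a)) = 0 ->
  \sum_(0 <= j < nbranches G)
      (nth 0%N (hyperplane_weights G) j)%:R * \sum_(0 <= i < nth 0%N (lengths G) j) A j i
    = (hyperplane_weight0 G)%:R * N.
Proof. by case: G; rewrite /index_iota /= !(big_cons, big_nil) /=; lra. Qed.

(** The differences in M_f chi, taken with the alternating delta weights, collect into the linear
    form that defines h_G. *)
Lemma defect_hyperplane (col : vertex G -> bool) chi : proper_colouring col ->
  defect col true (Mf chi) = 0 -> in_hyperplane chi.
Proof.
move=> hcol def0.
have {def0} : defect (@white G) true (Mf chi) = 0.
  by move: def0; rewrite (defect_white true (Mf chi) hcol); case: eqP => // _ /eqP;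
    rewrite oppr_eq0 => /eqP.
rewrite defect_whiteE sum_vof => sum0.
rewrite /in_hyperplane -(hyperplane_arith (A := fun j i => chi (vof G j i))).
  by rewrite big_mkord; apply: eq_bigr => j _; rewrite big_mkord; congr (_ * _);
    apply: eq_bigr => i _; rewrite vofE.
rewrite -[RHS]sum0; congr (_ + _); first by rewrite /= !ffunE.
rewrite big_nat [RHS]big_nat; apply: eq_bigr => j /= lt_j.
rewrite big_nat [RHS]big_nat; apply: eq_bigr => i /= lt_i.
by rewrite white_vof // delta_vof // on_branches_vof.
Qed.
End Hyperplane.

(** * Spectral resolutions and locally scalar representations *)

Section Levels.
Variable G : ext_dynkin.
Implicit Types (j : 'I_(nbranches G)).

Lemma len_cases j : len j \in [:: 1; 2; 3; 5]%N.
Proof.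
by rewrite /len; case: G j => -[[|[|[|[|j]]]] lt_j] //=.
Qed.

(* The eigenvalues of A_j in the reverse of the order in which the branch j
   splits them off, starting at the centre: 0, alpha_1, alpha_m, alpha_2, ... *)
Definition order m : seq nat :=
  match m with
  | 2 => [:: 1; 0]
  | 3 => [:: 1; 2; 0]
  | 5 => [:: 2; 3; 1; 4; 0]
  | _ => iota 0 m
  end.

(** At q = [len j] both default values apply and the result is 0. For chi this is the eigenvalue 0;
    for v it is not a multiplicity, and sums over v stop before it. *)
Definition level (Z : zmodType) (x : vec G Z) j q : Z :=
  nth 0 (branch x j) (nth (len j) (order (len j)) q).

(** The sign is 1 next to the centre and alternates outwards, like the extremes in [order]. *)
Definition sgn (Z : pzRingType) j p : Z := (-1) ^+ (len j + p.+1).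

Lemma sgnS (Z : pzRingType) j p : sgn Z j p.+1 = - sgn Z j p.
Proof. by rewrite /sgn [(_ + p.+2)%N]addnS exprS mulN1r. Qed.

Lemma sgn_last (Z : pzRingType) j : sgn Z j (len j) = -1.
Proof. by rewrite /sgn addnS exprS -signr_odd addnn odd_double mulr1. Qed.

Lemma level_vof (Z : zmodType) (x : vec G Z) j q : level x j q =
  nth 0 [seq x (vof G j i) | i <- iota 0 (len j)] (nth (len j) (order (len j)) q).
Proof. by rewrite -branch_vof. Qed.

Lemma level_last (Z : zmodType) (x : vec G Z) j : level x j (len j) = 0.
Proof.
rewrite /level [nth (len j) _ _]nth_default; first by rewrite nth_default ?size_branch.
by move: (len_cases j); rewrite !inE => /or4P[] /eqP->.
Qed.

Lemma level_vtx j q : (q < len j)%N ->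
  exists i : 'I_(len j), forall (Z : zmodType) (x : vec G Z), level x j q = x (vtx i).
Proof.
move=> lt_q; have lt_i : (nth (len j) (order (len j)) q < len j)%N.
  by move: lt_q; have := len_cases j; rewrite !inE => /or4P[] /eqP->; case: q => [|[|[|[|[|]]]]].
by exists (Ordinal lt_i) => Z x; rewrite /level -[RHS]nth_branch.
Qed.

Lemma vtx_level j (i : 'I_(len j)) :
  exists2 q, (q < len j)%N & forall (Z : zmodType) (x : vec G Z), level x j q = x (vtx i).
Proof.
have [q lt_q qi] : exists2 q, (q < len j)%N & nth (len j) (order (len j)) q = i.
  case: i => i /=; have := len_cases j; rewrite !inE => /or4P[] /eqP->;
    case: i => [|[|[|[|[|]]]]] //= _;
  by [exists 0%N|exists 1%N|exists 2|exists 3|exists 4].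
by exists q => // Z x; rewrite /level qi nth_branch.
Qed.

Lemma Md_inv_level (v : vec G int) j (i : 'I_(len j)) :
  Md_inv v (vtx i) = \sum_(0 <= q < i.+1) level v j q.
Proof.
under eq_bigr => q _ do rewrite level_vof.
rewrite -vofE [LHS]on_branches_vof // -/(len j).
case: i => i /=; have := len_cases j; rewrite !inE => /or4P[] /eqP->;
  case: i => [|[|[|[|[|]]]]] //= _;
  by rewrite /index_iota /= !(big_cons, big_nil); ring.
Qed.

Lemma Mf_level (R : comPzRingType) (chi : vec G R) j (i : 'I_(len j)) :
  Mf chi (vtx i) = sgn R j i * (level chi j i - level chi j i.+1).
Proof.
rewrite !level_vof -vofE [LHS]on_branches_vof // -/(len j) /sgn.
case: i => i /=; have := len_cases j; rewrite !inE => /or4P[] /eqP->;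
  by case: i => [|[|[|[|[|]]]]] //= _; ring.
Qed.

(** This is why the eigenvalues are split off in that order: level p+1 is alternately the least and
    the greatest of the levels up to p+1, so all earlier ones lie on the same side of it. *)
Lemma level_gap (R : realType) (chi : vec G R) j p q : parameter chi ->
  (q <= p)%N -> (p < len j)%N -> 0 < sgn R j p * (level chi j q - level chi j p.+1).
Proof.
move=> /(_ j)[chi_gt0 chi_dec] le_qp lt_p.
have pos i : (i < len j)%N -> 0 < chi (vof G j i).
  by move=> lt_i; rewrite (vofE (Ordinal lt_i)).
have dec i k : (i < k)%N -> (k < len j)%N -> 0 < chi (vof G j i) - chi (vof G j k).
  move=> lt_i lt_k; rewrite subr_gt0 (vofE (Ordinal lt_k)) (vofE (Ordinal (ltn_trans lt_i lt_k))).
  exact: chi_dec.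
rewrite !level_vof /sgn -signr_odd; pose x i := chi (vof G j i).
have {}pos i : (i < len j)%N -> 0 < x i := pos i.
have {}dec i k : (i < k)%N -> (k < len j)%N -> 0 < x i - x k := @dec i k.
rewrite -![map _ _]/(map x _); move: x pos dec lt_p => x pos dec lt_p.
have := len_cases j; rewrite !inE => /or4P[] /eqP lj; rewrite lj in pos dec lt_p *;
  have {}pos := pos _ (ltnSn _).
- by case: p q le_qp lt_p => [|[]] // [] //= _ _; lra.
- have := dec 0%N 1%N isT isT; case: p q le_qp lt_p => [|[|[]]] // [|[]] //= _ _; lra.
- have := dec 0%N 1%N isT isT; have := dec 1%N 2%N isT isT.
  by case: p q le_qp lt_p => [|[|[|[]]]] // [|[|[]]] //= _ _; lra.
have := dec 0%N 1%N isT isT; have := dec 1%N 2%N isT isT.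
have := dec 2%N 3%N isT isT; have := dec 3%N 4%N isT isT.
by case: p q le_qp lt_p => [|[|[|[|[|[]]]]]] // [|[|[|[|[]]]]] //= _ _; lra.
Qed.
End Levels.

(** * Branches as chains ending at the centre *)

Section Chains.
Variable G : ext_dynkin.
Implicit Types (g h : vertex G) (j : 'I_(nbranches G)).

Lemma len_gt0 j : (0 < len j)%N.
Proof. by have := len_cases j; rewrite !inE => /or4P[] /eqP->. Qed.

Lemma vof_len j : vof G j (len j) = None.
Proof. by rewrite /vof valK insubF // ltnn. Qed.

Lemma vertexP g : g = None \/ exists j p, (p < len j)%N /\ g = vof G j p.
Proof.
by case: g => [[j i]|]; [right; exists j, i; rewrite ltn_ord vofE|left].
Qed.

Lemma vtx_eq j j' (i : 'I_(len j)) (i' : 'I_(len j')) :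
  (vtx i == vtx i') = (j == j') && (i == i' :> nat).
Proof.
apply/eqP/andP => [eq_v|[/eqP eq_j]]; last first.
  by case: _ / eq_j i' => i' /eqP/val_inj->.
have eq_j : j = j' by case: eq_v.
case: _ / eq_j i' eq_v => i' [] /eqP; rewrite eq_Tagged /= => /eqP->.
by rewrite !eqxx.
Qed.

Lemma vof_eq j p j' q : (p < len j)%N -> (q < len j')%N ->
  (vof G j p == vof G j' q) = (j == j') && (p == q).
Proof.
by move=> lt_p lt_q; rewrite (vofE (Ordinal lt_p)) (vofE (Ordinal lt_q)) vtx_eq.
Qed.

Lemma toward_vof2 j p j' q : (p < len j)%N -> (q < len j')%N ->
  toward (vof G j p) (vof G j' q) = (j == j') && (p.+1 == q).
Proof. by move=> lt_p lt_q; rewrite (vofE (Ordinal lt_p)) (vofE (Ordinal lt_q)). Qed.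

Lemma toward_vof j p h : (p < len j)%N -> toward (vof G j p) h = (h == vof G j p.+1).
Proof.
move=> lt_p; have [eq_p|neq_p] := eqVneq p.+1 (len j).
  rewrite eq_p vof_len; case: (vertexP h) => [->|[j' [q [lt_q ->]]]].
    by rewrite (vofE (Ordinal lt_p)) /= eq_p !eqxx.
  rewrite toward_vof2 // (vofE (Ordinal lt_q)).
  by apply/negbTE/negP => /andP[/eqP eq_j /eqP]; rewrite -eq_j in lt_q; lia.
have lt_p' : (p.+1 < len j)%N by rewrite ltn_neqAle neq_p.
case: (vertexP h) => [->|[j' [q [lt_q ->]]]].
  by rewrite (vofE (Ordinal lt_p)) (vofE (Ordinal lt_p')) /= (negPf neq_p).
by rewrite toward_vof2 // vof_eq // eq_sym [q == _]eq_sym.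
Qed.

Lemma towardP g h : reflect (exists j p, [/\ (p < len j)%N, g = vof G j p & h = vof G j p.+1])
  (toward g h).
Proof.
apply: (iffP idP) => [|[j [p [lt_p -> ->]]]]; last by rewrite toward_vof.
case: (vertexP g) => [->|[j [p [lt_p ->]]]] //; rewrite toward_vof // => /eqP->.
by exists j, p.
Qed.

Lemma toward_vofr j p g : (p < len j)%N ->
  toward g (vof G j p) = (0 < p)%N && (g == vof G j p.-1).
Proof.
move=> lt_p; apply/towardP/andP => [[j' [q [lt_q -> /esym/eqP]]]|[p0 /eqP->]]; last first.
  by exists j, p.-1; rewrite prednK //; split=> //; lia.
have [eq_q|neq_q] := eqVneq q.+1 (len j').
  by rewrite eq_q vof_len (vofE (Ordinal lt_p)).
have lt_q' : (q.+1 < len j')%N by rewrite ltn_neqAle neq_q.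
by rewrite vof_eq // => /andP[/eqP -> /eqP <-].
Qed.

Lemma toward_None g : toward g None -> exists j, g = vof G j (len j).-1.
Proof.
case/towardP => j [p [lt_p -> pN]]; exists j; congr vof.
have [eq_p|neq_p] := eqVneq p.+1 (len j); first by lia.
have lt_p' : (p.+1 < len j)%N by rewrite ltn_neqAle neq_p.
by move: pN; rewrite (vofE (Ordinal lt_p')).
Qed.

Lemma sum_nbr_vof (Z : nmodType) j p (F : vertex G -> Z) : (p < len j)%N ->
  \sum_(h | adjacent (vof G j p) h) F h =
    F (vof G j p.+1) + (if p is p'.+1 then F (vof G j p') else 0).
Proof.
move=> lt_p; rewrite (bigD1 (vof G j p.+1)) /=; last by rewrite /adjacent toward_vof ?eqxx.
congr (_ + _).
rewrite (eq_bigl (fun h => (0 < p)%N && (h == vof G j p.-1))) => [|h].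
  by case: p lt_p => [|p] lt_p /=; [rewrite big_pred0 | rewrite big_pred1_eq].
rewrite /adjacent toward_vof // toward_vofr //; case: eqVneq => //= [->|_]; last by rewrite andbT.
rewrite eq_sym; case: p lt_p => //= p lt_p; apply/esym/negbTE.
have lt_p' := ltnW lt_p; have [eq_p|neq_p] := eqVneq p.+2 (len j).
  by rewrite eq_p vof_len (vofE (Ordinal lt_p')).
by rewrite vof_eq ?eqxx // ?ltn_neqAle ?neq_p //=; lia.
Qed.

Lemma sum_nbr_center (Z : nmodType) (F : vertex G -> Z) :
  \sum_(h | adjacent None h) F h = \sum_(j < nbranches G) F (vof G j (len j).-1).
Proof.
rewrite (eq_bigl (mem [set vof G j (len j).-1 | j : 'I_(nbranches G)])) => [|h].
  rewrite big_imset //= => i j _ _ /eqP.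
  by rewrite vof_eq ?prednK ?len_gt0 // => /andP[/eqP].
rewrite /adjacent /=; apply/idP/imsetP => [/toward_None[j ->]|[j _ ->]]; first by exists j.
by rewrite toward_vof ?prednK ?len_gt0 // vof_len.
Qed.
End Chains.

(** * From spectral projections to the star graph *)

Section ResolutionRep.
Local Open Scope sesquilinear_scope.
Variables (G : ext_dynkin) (C : numClosedFieldType) (N : nat).
Variables (E : 'I_(nbranches G) -> nat -> 'M[C]_N) (b : 'I_(nbranches G) -> nat -> C).
Implicit Types (j : 'I_(nbranches G)) (a : nat -> C).

Definition comb j p a : 'M[C]_N := \sum_(0 <= q < p.+1) a q *: E j q.

Record resolution : Prop := Resolution {
  res_herm : forall j q, (q <= len j)%N -> (E j q)^t* = E j q;
  res_orth : forall j q q', (q <= len j)%N -> (q' <= len j)%N ->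
    E j q *m E j q' = if q == q' then E j q else 0;
  res_sum : forall j, \sum_(0 <= q < (len j).+1) E j q = 1%:M
}.

Hypothesis res : resolution.

Lemma res_comb j p q a : (q <= p)%N -> (p <= len j)%N -> E j q *m comb j p a = a q *: E j q.
Proof.
move=> le_q le_p; have le_ql := leq_trans le_q le_p;
  rewrite /comb mulmx_sumr (bigD1_seq q) ?mem_index_iota ?iota_uniq //=.
rewrite -scalemxAr (res_orth res) ?eqxx // big_nat_cond big1 ?addr0 //.
move=> k /andP[/andP[_ le_k] kq]; rewrite -scalemxAr (res_orth res) ?(leq_trans le_q) //;
  last by lia.
by rewrite eq_sym (negPf kq) scaler0.
Qed.

Lemma comb_res j p q a : (q <= p)%N -> (p <= len j)%N -> comb j p a *m E j q = a q *: E j q.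
Proof.
move=> le_q le_p; have le_ql := leq_trans le_q le_p;
  rewrite /comb mulmx_suml (bigD1_seq q) ?mem_index_iota ?iota_uniq //=.
rewrite -scalemxAl (res_orth res) ?eqxx // big_nat_cond big1 ?addr0 //.
move=> k /andP[/andP[_ le_k] kq]; rewrite -scalemxAl (res_orth res) ?(leq_trans le_q) //;
  last by lia.
by rewrite (negPf kq) scaler0.
Qed.

Lemma comb_mul j p p' a a' : (p <= p')%N -> (p' <= len j)%N ->
  comb j p a *m comb j p' a' = comb j p (fun q => a q * a' q).
Proof.
move=> le_p le_p'; rewrite {1}/comb mulmx_suml; apply: eq_big_nat => q /andP[_ le_q].
by rewrite -scalemxAl res_comb ?scalerA // (leq_trans _ le_p).
Qed.

Lemma mul_comb j p p' a a' : (p <= p')%N -> (p' <= len j)%N ->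
  comb j p' a' *m comb j p a = comb j p (fun q => a' q * a q).
Proof.
move=> le_p le_p'; rewrite {2}/comb mulmx_sumr; apply: eq_big_nat => q /andP[_ le_q].
by rewrite -scalemxAr comb_res ?scalerA 1?mulrC // (leq_trans _ le_p).
Qed.

Lemma eq_comb j p a a' : (forall q, (q <= p)%N -> a q = a' q) -> comb j p a = comb j p a'.
Proof. by move=> eq_a; apply: eq_big_nat => q /andP[_ le_q]; rewrite eq_a. Qed.

Lemma comb_herm j p a : (p <= len j)%N -> (forall q, (q <= p)%N -> 0 <= a q) ->
  (comb j p a)^t* = comb j p a.
Proof.
move=> le_p a0; rewrite /comb !raddf_sum /=; apply: eq_big_nat => q /andP[_ le_q].
by rewrite trmxC_scale (res_herm res) ?(leq_trans _ le_p) // geC0_conj // a0.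
Qed.

Lemma comb_one j : comb j (len j) (fun=> 1) = 1%:M.
Proof. by rewrite -(res_sum res j); apply: eq_bigr => q _; rewrite scale1r. Qed.

(** The eigenvalue, on the q-th spectral subspace, of the path from position p to p+1 and back. *)
Definition coef j p q : C := sgn C j p * (b j q - b j p.+1).

Definition res_S (g : vertex G) : 'M[C]_N :=
  if g is Some u then comb (tag u) (tagged u) (fun=> 1) else 1%:M.
Definition res_X (g : vertex G) : 'M[C]_N :=
  if g is Some u then comb (tag u) (tagged u) (fun q => sqrtC (coef (tag u) (tagged u) q)) else 0.
(** Both directions of an edge carry the same self-adjoint square root, so they are adjoint to each
    other. *)
Definition res_w (g h : vertex G) := if toward g h then res_X g else res_X h.

Hypothesis coef_gt0 : forall j p q, (q <= p)%N -> (p < len j)%N -> 0 < coef j p q.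

Let X j p := comb j p (fun q => sqrtC (coef j p q)).

Lemma res_S_vof j p : (p <= len j)%N -> res_S (vof G j p) = comb j p (fun=> 1).
Proof.
rewrite leq_eqVlt => /orP[/eqP->|lt_p]; first by rewrite vof_len comb_one.
by rewrite (vofE (Ordinal lt_p)).
Qed.

Lemma res_w_in j p : (p < len j)%N -> res_w (vof G j p) (vof G j p.+1) = X j p.
Proof. by move=> lt_p; rewrite /res_w toward_vof // eqxx (vofE (Ordinal lt_p)). Qed.

Lemma res_w_out j p : (p < len j)%N -> res_w (vof G j p.+1) (vof G j p) = X j p.
Proof.
move=> lt_p; rewrite /res_w toward_vofr // (vofE (Ordinal lt_p)).
case: andP => // -[p0 /eqP]; have [eq_p|neq_p] := eqVneq p.+1 (len j).
  by rewrite eq_p vof_len (vofE (Ordinal (_ : p.-1 < len j)%N)) //; lia.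
have lt_p' : (p.+1 < len j)%N by rewrite ltn_neqAle neq_p.
by move/eqP; rewrite vof_eq // ?eqxx /=; lia.
Qed.

Lemma X_sqr j p : (p < len j)%N -> X j p *m X j p = comb j p (coef j p).
Proof.
move=> lt_p; rewrite comb_mul ?(ltnW lt_p) //; apply: eq_comb => q le_q.
by rewrite -expr2 sqrtCK.
Qed.

Lemma edgeP (g h : vertex G) : adjacent g h -> exists j p, (p < len j)%N /\
  ((g = vof G j p /\ h = vof G j p.+1) \/ (g = vof G j p.+1 /\ h = vof G j p)).
Proof.
by case/orP => /towardP[j [p [lt_p -> ->]]]; exists j, p; split=> //; [left|right].
Qed.

Variables (gam : C) (d : vec G int) (f : vec G C).
Hypothesis b_last : forall j, b j (len j) = 0.
Let A j := comb j (len j) (b j).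
Hypothesis A_sum : \sum_j A j = gam%:M.
Hypothesis fN : f None = gam.
Hypothesis fE : forall j p, (p < len j)%N -> f (vof G j p) = coef j p p.
Hypothesis dN : (d None)%:~R = N%:R :> C.
Hypothesis dE : forall j p, (p < len j)%N ->
  (d (vof G j p))%:~R = \sum_(0 <= q < p.+1) \tr (E j q).
Hypothesis N_gt0 : (0 < N)%N.
Hypothesis irr : forall V : 'M[C]_N, (forall j, (V *m A j <= V)%MS) -> V = 0 \/ (1%:M <= V)%MS.

Lemma comb_last j : A j = comb j (len j).-1 (b j).
Proof. by rewrite /A /comb big_nat_recr //= b_last scale0r addr0 prednK ?len_gt0. Qed.

Lemma coef_last j q : coef j (len j).-1 q = b j q.
Proof.
have := sgn_last C j; rewrite /coef prednK ?len_gt0 // b_last subr0.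
by rewrite -{1}(prednK (len_gt0 j)) sgnS => /oppr_inj->; rewrite mul1r.
Qed.

Lemma X_last j : X j (len j).-1 *m X j (len j).-1 = A j.
Proof.
rewrite X_sqr ?prednK ?len_gt0 // comb_last; apply: eq_comb => q _.
exact: coef_last.
Qed.

Lemma combD j p a a' : comb j p a + comb j p a' = comb j p (fun q => a q + a' q).
Proof. by rewrite -big_split; apply: eq_bigr => q _; rewrite scalerDl. Qed.

Lemma comb_recr j p a : comb j p.+1 a = comb j p a + a p.+1 *: E j p.+1.
Proof. by rewrite /comb big_nat_recr. Qed.

(** The two paths at position p contribute s_p (b_q - b_(p+1)) and s_(p-1) (b_q - b_p) with s_(p-1)
    = -s_p. So b_q cancels and the value at q = p remains. At the centre the paths are the A_j. *)
Lemma res_scal g : \sum_(h | adjacent g h) res_w g h *m res_w h g = f g *: res_S g.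
Proof.
case: (vertexP g) => [->|[j [p [lt_p ->]]]].
  rewrite sum_nbr_center fN scalemx1 -A_sum; apply: eq_bigr => j _.
  have lt_j : ((len j).-1 < len j)%N by rewrite prednK ?len_gt0.
  have := res_w_in lt_j; have := res_w_out lt_j; rewrite prednK ?len_gt0 // vof_len => -> ->.
  exact: X_last.
rewrite sum_nbr_vof // res_w_in // res_w_out // X_sqr // fE // (res_S_vof (ltnW lt_p)).
have -> : coef j p p *: comb j p (fun=> 1) = comb j p (fun=> coef j p p).
  by rewrite /comb scaler_sumr; apply: eq_bigr => q _; rewrite scalerA mulr1.
case: p lt_p => [|p] lt_p; first by rewrite addr0; apply: eq_comb => q; rewrite leqn0 => /eqP->.
rewrite res_w_in ?(ltnW lt_p) // res_w_out ?(ltnW lt_p) // X_sqr ?(ltnW lt_p) //.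
(* The added term has coefficient b_(p+1) - b_(p+1) = 0. *)
have -> : comb j p (coef j p) = comb j p.+1 (coef j p).
  by rewrite comb_recr /coef subrr mulr0 scale0r addr0.
rewrite combD; apply: eq_comb => q _; rewrite /coef sgnS; ring.
Qed.

(** At the centre the square of the last map is A_j, so irreducibility applies there; the square
    roots are invertible on the subspaces along a branch and carry the conclusion outwards. *)
Lemma res_simple : simple_rep res_S res_w.
Proof.
split; first by exists None; rewrite /= -mxrank_eq0 mxrank1 -lt0n.
move=> U leU wU; have lt_last j : ((len j).-1 < len j)%N by rewrite prednK ?len_gt0.
have adjP j p : (p < len j)%N -> adjacent (vof G j p) (vof G j p.+1).
  by move=> lt_p; rewrite /adjacent toward_vof ?eqxx.
have [j|U0|U1] := irr (V := U None).
- rewrite -X_last mulmxA.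
  have := adjP j _ (lt_last j); rewrite prednK ?len_gt0 // vof_len => adj.
  have adj' := adj; rewrite adjacentC in adj'.
  have := res_w_in (lt_last j); have := res_w_out (lt_last j); rewrite prednK ?len_gt0 // vof_len.
  move=> <- {2}<-.
  by apply: submx_trans (wU _ _ adj); apply: submxMr; apply: wU.
- left; elim/vertex_ind => // g h /towardP[j [p [lt_p -> ->]]] Uh.
  pose Y := comb j p (fun q => (sqrtC (coef j p q))^-1).
  have XY : X j p *m Y = res_S (vof G j p).
    rewrite comb_mul ?(ltnW lt_p) // res_S_vof ?(ltnW lt_p) //; apply: eq_comb => q le_q.
    by rewrite mulfV // sqrtC_eq0 gt_eqF // coef_gt0.
  have := wU _ _ (adjP j p lt_p); rewrite Uh submx0 res_w_in // => /eqP UX.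
  have /submxP[D UD] := leU (vof G j p).
  have SS : res_S (vof G j p) *m res_S (vof G j p) = res_S (vof G j p).
    by rewrite res_S_vof ?(ltnW lt_p) // comb_mul ?(ltnW lt_p) //; apply: eq_comb => q _;
      rewrite mulr1.
  by rewrite UD -SS mulmxA -UD -XY mulmxA UX mul0mx.
right; elim/vertex_ind => // g h /towardP[j [p [lt_p -> ->]]] Uh.
have adj' := adjP j p lt_p; rewrite adjacentC in adj'.
apply: submx_trans (wU _ _ adj').
apply: submx_trans (submxMr _ Uh); rewrite res_w_out // (@res_S_vof j p.+1) // mul_comb //.
have -> : res_S (vof G j p) = comb j p (fun q => (sqrtC (coef j p q))^-1) *m X j p.
  rewrite comb_mul ?(ltnW lt_p) // res_S_vof ?(ltnW lt_p) //; apply: eq_comb => q le_q.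
  by rewrite mulVf // sqrtC_eq0 gt_eqF // coef_gt0.
by rewrite [X in (_ <= X)%MS](@eq_comb j p _ (fun q => sqrtC (coef j p q))) ?submxMl // => q _;
  rewrite mul1r.
Qed.

Lemma resolution_rep : scalar_rep res_S res_w d f /\ hermitian_rep res_S res_w.
Proof.
have herm g : (res_S g)^t* = res_S g.
  case: (vertexP g) => [->|[j [p [lt_p ->]]]]; first by rewrite /= trmx1 map_mx1.
  by rewrite res_S_vof ?(ltnW lt_p) // comb_herm ?(ltnW lt_p).
have SX j p p' : (p < len j)%N -> (p <= p' <= len j)%N -> res_S (vof G j p') *m X j p = X j p.
  move=> lt_p /andP[le_p le_p']; rewrite res_S_vof // mul_comb //.
  by apply: eq_comb => q _; rewrite mul1r.
have XS j p p' : (p < len j)%N -> (p <= p' <= len j)%N -> X j p *m res_S (vof G j p') = X j p.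
  move=> lt_p /andP[le_p le_p']; rewrite res_S_vof // comb_mul //.
  by apply: eq_comb => q _; rewrite mulr1.
split; last split=> // g h /edgeP[j [p [lt_p [[-> ->]|[-> ->]]]]].
- split.
  + move=> g; case: (vertexP g) => [->|[j [p [lt_p ->]]]]; first by rewrite mulmx1.
    by rewrite res_S_vof ?(ltnW lt_p) // comb_mul ?(ltnW lt_p) //; apply: eq_comb => q _;
      rewrite mulr1.
  + move=> g h /edgeP[j [p [lt_p [[-> ->]|[-> ->]]]]].
      by rewrite res_w_in // SX // leqnn ltnW.
    by rewrite res_w_out // SX // leqnSn.
  + move=> g h /edgeP[j [p [lt_p [[-> ->]|[-> ->]]]]].
      by rewrite res_w_in // XS // leqnSn.
    by rewrite res_w_out // XS // leqnn ltnW.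
  + exact: res_scal.
  + move=> g; case: (vertexP g) => [->|[j [p [lt_p ->]]]]; first by rewrite mxtrace1 dN.
    rewrite res_S_vof ?(ltnW lt_p) // dE // /comb raddf_sum; apply: eq_bigr => q _.
    by rewrite scale1r.
  + exact: res_simple.
- rewrite res_w_in // res_w_out // comb_herm ?(ltnW lt_p) // => q le_q.
  by rewrite sqrtC_ge0 ltW // coef_gt0.
rewrite res_w_in // res_w_out // comb_herm ?(ltnW lt_p) // => q le_q.
by rewrite sqrtC_ge0 ltW // coef_gt0.
Qed.
End ResolutionRep.

(** * From the star graph back to spectral projections *)

Section RepResolution.
Local Open Scope sesquilinear_scope.
Variables (G : ext_dynkin) (C : numClosedFieldType) (n : nat).
Variables (S : vertex G -> 'M[C]_n) (w : vertex G -> vertex G -> 'M[C]_n).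
Variables (d : vec G int) (f : vec G C) (b : 'I_(nbranches G) -> nat -> C).
Implicit Types j : 'I_(nbranches G).
Hypothesis repw : scalar_rep S w d f.
Hypothesis hermw : hermitian_rep S w.
Hypothesis coef_gt0 : forall j p q, (q <= p)%N -> (p < len j)%N -> 0 < coef b j p q.
Hypothesis b_last : forall j, b j (len j) = 0.
Hypothesis fE : forall j p, (p < len j)%N -> f (vof G j p) = coef b j p p.

Let B j p : 'M[C]_n :=
  if p is p'.+1 then w (vof G j p) (vof G j p') *m w (vof G j p') (vof G j p) else 0.
Definition jump j q : int := d (vof G j q) - (if q is q'.+1 then d (vof G j q') else 0).

Lemma adjacent_vof j p : (p < len j)%N -> adjacent (vof G j p) (vof G j p.+1).
Proof. by move=> lt_p; rewrite /adjacent toward_vof ?eqxx. Qed.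

Lemma adjacent_vofC j p : (p < len j)%N -> adjacent (vof G j p.+1) (vof G j p).
Proof. by move=> lt_p; rewrite adjacentC adjacent_vof. Qed.

Lemma chain_scal j p : (p < len j)%N ->
  w (vof G j p) (vof G j p.+1) *m w (vof G j p.+1) (vof G j p)
    = coef b j p p *: S (vof G j p) - B j p.
Proof.
move=> lt_p; rewrite -fE // -(rep_scal repw) sum_nbr_vof // /B.
by case: p lt_p => [|p] lt_p; rewrite ?addr0 ?subr0 ?addrK.
Qed.

Lemma chainE j p : (0 < p)%N ->
  B j p = w (vof G j p) (vof G j p.-1) *m w (vof G j p.-1) (vof G j p).
Proof. by case: p. Qed.

Lemma chain_tgt j p : (p <= len j)%N -> B j p *m S (vof G j p) = B j p.
Proof.
case: p => [|p] lt_p; first by rewrite mul0mx.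
by rewrite /B -mulmxA (rep_tgtK repw) // adjacent_vof.
Qed.

Lemma sum_iota_if (Z : nmodType) (F : nat -> Z) p q : (q <= p)%N ->
  \sum_(0 <= k < p.+1) (if k == q then F k else 0) = F q.
Proof. by move=> le_q; rewrite -big_mkcond /= big_nat1_eq /= ltnS le_q. Qed.

(** Induction from the outer end. The two composites along the edge between p and p+1 share their
    nonzero eigenvalues, so each projection is transported and divided by its eigenvalue. What they
    miss at p+1 is the one new projection, on which B vanishes. *)
Lemma chain_resolution j p : (p <= len j)%N -> exists E : nat -> 'M[C]_n,
  [/\ forall q, (q <= p)%N -> (E q)^t* = E q,
      forall q q', (q <= p)%N -> (q' <= p)%N -> E q *m E q' = if q == q' then E q else 0,
      \sum_(0 <= q < p.+1) E q = S (vof G j p),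
      forall q, (q <= p)%N -> \tr (E q) = (jump j q)%:~R
    & forall q, (q <= p)%N -> B j p *m E q = (- sgn C j p * (b j q - b j p)) *: E q].
Proof.
have [S_herm w_herm] := hermw.
elim: p => [|p IHp] le_p.
  exists (fun _ => S (vof G j 0)); split.
  - by move=> q _; exact: S_herm.
  - by move=> q q'; rewrite !leqn0 => /eqP-> /eqP->; rewrite eqxx (rep_idem repw).
  - by rewrite big_nat1.
  - by move=> q; rewrite leqn0 => /eqP->; rewrite (rep_dim repw) /jump subr0.
  by move=> q; rewrite leqn0 => /eqP->; rewrite subrr mulr0 scale0r mul0mx.
have [E [E_herm E_orth E_sum E_tr E_B]] := IHp (ltnW le_p).
have adj := adjacent_vof le_p; have adj' := adjacent_vofC le_p.
pose c q := coef b j p q; pose wi := w (vof G j p) (vof G j p.+1).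
pose wo := w (vof G j p.+1) (vof G j p).
have wiS : wi *m S (vof G j p.+1) = wi by exact: rep_tgtK repw _ _ adj.
have woS : wo *m S (vof G j p) = wo by exact: rep_tgtK repw _ _ adj'.
have Swo : S (vof G j p.+1) *m wo = wo by exact: rep_srcK repw _ _ adj'.
have c_neq0 q : (q <= p)%N -> c q != 0 by move=> le_q; rewrite gt_eqF // coef_gt0.
have ES q : (q <= p)%N -> S (vof G j p) *m E q = E q.
  move=> le_q; rewrite -E_sum mulmx_suml -[RHS](sum_iota_if E le_q).
  by apply: eq_big_nat => k /andP[_ le_k]; rewrite E_orth.
have wiwoE q : (q <= p)%N -> wi *m wo *m E q = c q *: E q.
  move=> le_q; rewrite chain_scal // mulmxBl -scalemxAl ES // E_B // -scalerBl.
  by congr (_ *: _); rewrite /c /coef; ring.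
pose F q := (c q)^-1 *: (wo *m E q *m wi); pose T := \sum_(0 <= q < p.+1) F q.
have FF q q' : (q <= p)%N -> (q' <= p)%N -> F q *m F q' = if q == q' then F q else 0.
  move=> le_q le_q'; rewrite -scalemxAl -scalemxAr scalerA.
  rewrite -!mulmxA [wi *m (wo *m _)]mulmxA [wi *m wo *m (E q' *m _)]mulmxA wiwoE //.
  rewrite -scalemxAl -!scalemxAr scalerA mulfVK ?c_neq0 //.
  rewrite [E q *m (E q' *m _)]mulmxA E_orth //; case: eqP => _; first by rewrite /F -mulmxA.
  by rewrite mul0mx mulmx0 scaler0.
have TF q : (q <= p)%N -> T *m F q = F q.
  move=> le_q; rewrite mulmx_suml -[RHS](sum_iota_if F le_q).
  by apply: eq_big_nat => k /andP[_ le_k]; rewrite FF.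
have FT q : (q <= p)%N -> F q *m T = F q.
  move=> le_q; rewrite mulmx_sumr -[RHS](sum_iota_if F le_q).
  by apply: eq_big_nat => k /andP[_ le_k]; rewrite FF // eq_sym; case: eqP => [->|].
have SF q : S (vof G j p.+1) *m F q = F q by rewrite -scalemxAr !mulmxA Swo.
have FS q : F q *m S (vof G j p.+1) = F q by rewrite -scalemxAl -(mulmxA (wo *m E q)) wiS.
have TT : T *m T = T.
  by rewrite {1}/T mulmx_suml; apply: eq_big_nat => q /andP[_ le_q]; rewrite FT.
have ST : S (vof G j p.+1) *m T = T by rewrite mulmx_sumr; apply: eq_bigr.
have TS : T *m S (vof G j p.+1) = T by rewrite mulmx_suml; apply: eq_bigr.
have F_herm q : (q <= p)%N -> (F q)^t* = F q.
  move=> le_q; rewrite trmxC_scale !trmxC_mul E_herm // /wi /wo !w_herm // mulmxA.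
  by rewrite geC0_conj // invr_ge0 ltW // coef_gt0.
have BF q : (q <= p)%N -> B j p.+1 *m F q = c q *: F q.
  move=> le_q; rewrite /B -/wi -/wo -scalemxAr -!mulmxA [wi *m (wo *m _)]mulmxA.
  by rewrite [wi *m wo *m (E q *m _)]mulmxA wiwoE // -scalemxAl -!scalemxAr scalerA mulrC -scalerA /F mulmxA.
have BT : B j p.+1 *m T = B j p.+1.
  rewrite mulmx_sumr (eq_big_nat _ _ (F2 := fun q => wo *m E q *m wi)) => [|q /andP[_ le_q]].
    by rewrite -mulmx_suml -mulmx_sumr E_sum woS.
  by rewrite BF // scalerA mulfV ?c_neq0 // scale1r.
have BS : B j p.+1 *m S (vof G j p.+1) = B j p.+1 by rewrite /B -/wi -/wo -mulmxA wiS.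
exists (fun q => if q == p.+1 then S (vof G j p.+1) - T else F q).
have split_q q : (q <= p.+1)%N -> q = p.+1 \/ (q <= p)%N.
  by rewrite leq_eqVlt => /orP[/eqP|]; [left|right].
have neq_q q : (q <= p)%N -> (q == p.+1) = false by move=> le_q; apply/negbTE; lia.
split.
- move=> q /split_q[->|le_q]; last by rewrite neq_q // F_herm.
  rewrite eqxx trmxCB S_herm; congr (_ - _); rewrite /T !raddf_sum /=.
  by apply: eq_big_nat => k /andP[_ le_k]; apply: F_herm.
- move=> q q' /split_q[->|le_q] /split_q[->|le_q']; rewrite ?eqxx ?neq_q //.
  + by rewrite mulmxBl !mulmxBr (rep_idem repw) ST TS TT subrr subr0.
  + by rewrite eq_sym neq_q // mulmxBl SF TF // subrr.
  + by rewrite mulmxBr FS FT // subrr.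
  exact: FF.
- rewrite big_nat_recr //= eqxx (eq_big_nat _ _ (F2 := F)) => [|q /andP[_ le_q]].
    by rewrite addrC subrK.
  by rewrite neq_q.
- move=> q /split_q[->|le_q]; last first.
    rewrite neq_q // mxtraceZ /= mxtrace_mulC mulmxA wiwoE // mxtraceZ /= mulrA mulVf ?c_neq0 //.
    by rewrite mul1r E_tr.
  rewrite eqxx raddfB /= (rep_dim repw) /jump rmorphB /=; congr (_ - _).
  rewrite -(rep_dim repw) -E_sum !raddf_sum /=; apply: eq_big_nat => q' /andP[_ le_q].
  by rewrite mxtraceZ /= mxtrace_mulC mulmxA wiwoE // mxtraceZ /= mulrA mulVf ?c_neq0 // mul1r.
move=> q /split_q[->|le_q]; first by rewrite eqxx mulmxBr BS BT !subrr mulr0 scale0r.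
by rewrite neq_q // BF // sgnS opprK.
Qed.

Lemma hermitian_idem_isometry (P : 'M[C]_n) : P *m P = P -> P^t* = P ->
  exists U : 'M[C]_(\rank P, n), U *m U^t* = 1%:M /\ U^t* *m U = P.
Proof.
move=> PP P_herm; exists (schmidt (row_base P)).
have /unitarymxP UU := schmidt_unitarymx (row_base P) (rank_leq_col P).
set U := schmidt _ in UU *; split=> //.
have eqU : (U :=: P)%MS.
  by apply: eqmx_trans (eq_row_base P); apply: eqmx_schmidt_free (row_base_free P).
have [D UD] : exists D, U = D *m P by apply/submxP; rewrite eqU.
have [D' PD] : exists D', P = D' *m U by apply/submxP; rewrite eqU.
have UP : U *m P = U by rewrite UD -mulmxA PP.
have : P *m (U^t* *m U) = P by rewrite {1}PD -mulmxA (mulmxA U) UU mul1mx -PD.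
by move/(congr1 (fun M : 'M_n => M^t*)); rewrite !trmxC_mul trmxCK P_herm -mulmxA UP.
Qed.

(** An isometry onto the central space turns the operators B there into self-adjoint matrices of
    size d_0. A subspace invariant under them spreads along the branches to a subrepresentation. *)
Lemma centre_resolution : exists r (E : 'I_(nbranches G) -> nat -> 'M[C]_r),
  [/\ r = `|d None|%N, resolution E,
      \sum_j comb E j (len j) (b j) = (f None)%:M,
      forall j q, (q <= len j)%N -> \tr (E j q) = (jump j q)%:~R
    & forall V : 'M[C]_r, (forall j, (V *m comb E j (len j) (b j) <= V)%MS) ->
        V = 0 \/ (1%:M <= V)%MS].
Proof.
have [S_herm w_herm] := hermw.
have [r [U [rN UU USU]]] : exists r (U : 'M[C]_(r, n)),
    [/\ r = `|d None|%N, U *m U^t* = 1%:M & U^t* *m U = S None].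
  have [U [UU USU]] := hermitian_idem_isometry (rep_idem repw None) (S_herm None).
  by exists _, U; split=> //; have := rep_rank repw None; lia.
have /fin_all_exists[E EP] (j : 'I_(nbranches G)) := chain_resolution (leqnn (len j)).
pose E' j q := U *m E j q *m U^t*.
have ES j q : (q <= len j)%N -> S None *m E j q = E j q /\ E j q *m S None = E j q.
  move=> le_q; have [_ E_orth E_sum _ _] := EP j; rewrite -(vof_len j) -E_sum; split.
    rewrite mulmx_suml -[RHS](sum_iota_if (E j) le_q).
    by apply: eq_big_nat => k /andP[_ le_k]; rewrite E_orth.
  rewrite mulmx_sumr -[RHS](sum_iota_if (E j) le_q).
  by apply: eq_big_nat => k /andP[_ le_k]; rewrite E_orth // eq_sym; case: eqP => [->|].
have B_sum j : B j (len j) = \sum_(0 <= q < (len j).+1) b j q *: E j q.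
  have [_ _ E_sum _ E_B] := EP j.
  have <- : B j (len j) *m S None = B j (len j).
    by rewrite -(vof_len j) chain_tgt.
  rewrite -(vof_len j) -E_sum mulmx_sumr; apply: eq_big_nat => q /andP[_ le_q].
  by rewrite E_B // sgn_last opprK mul1r b_last subr0.
have combE j : comb E' j (len j) (b j) = U *m B j (len j) *m U^t*.
  rewrite B_sum mulmx_sumr mulmx_suml; apply: eq_bigr => q _.
  by rewrite -scalemxAr -scalemxAl.
have sumB : \sum_j B j (len j) = f None *: S None.
  rewrite -(rep_scal repw) sum_nbr_center; apply: eq_bigr => j _.
  by rewrite chainE ?len_gt0 // vof_len.
exists r, E'; split=> //.
- split.
  + move=> j q le_q; have [E_herm _ _ _ _] := EP j.
    by rewrite /E' !trmxC_mul trmxCK E_herm // mulmxA.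
  + move=> j q q' le_q le_q'; have [_ E_orth _ _ _] := EP j.
    rewrite /E' -!mulmxA [U^t* *m (U *m _)]mulmxA USU [S None *m (_ *m _)]mulmxA.
    have [-> _] := ES j q' le_q'; rewrite [E j q *m (_ *m _)]mulmxA E_orth //.
    by case: eqP => //; rewrite mul0mx mulmx0.
  move=> j; have [_ _ E_sum _ _] := EP j.
  by rewrite /E' -mulmx_suml -mulmx_sumr E_sum vof_len -USU !mulmxA UU mul1mx UU.
- rewrite (eq_bigr _ (fun j _ => combE j)) -mulmx_suml -mulmx_sumr sumB.
  by rewrite -scalemxAr -scalemxAl -USU !mulmxA UU mul1mx UU scalemx1.
- move=> j q le_q; have [_ _ _ E_tr _] := EP j.
  by rewrite /E' mxtrace_mulC mulmxA USU; have [-> _] := ES j q le_q; rewrite E_tr.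
move=> V VA; pose W := U^t* *m V *m U.
have WS : W *m S None = W by rewrite /W -USU !mulmxA -(mulmxA (_ *m V)) UU mulmx1.
have [path [path0 pathS]] : exists path : 'I_(nbranches G) -> nat -> 'M[C]_n,
    (forall j, path j (len j) = W) /\
    (forall j p, (p < len j)%N -> path j p = path j p.+1 *m w (vof G j p.+1) (vof G j p)).
  pose fix down j k := if k is k'.+1 then
    down j k' *m w (vof G j (len j - k')) (vof G j (len j - k'.+1)) else W.
  exists (fun j p => down j (len j - p)%N); split=> [j|j p lt_p]; first by rewrite subnn.
  rewrite -subnSK //= subKn ?subKn //.
  by rewrite subnSK // subKn // ltnW.
(* Invariance passes from the centre outwards: by [chain_scal], B at p and the path from p to p+1
   and back add up to a scalar. *)
have path_chain j p : (p <= len j)%N -> (path j p *m B j p <= path j p)%MS.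
  move=> le_p; rewrite -(subKn le_p); move: (len j - p)%N (leq_subr p (len j)) => k.
  elim: k => [|k IHk] lt_k.
    rewrite subn0 path0 -(mulmxA _ _ (B _ _)).
    have /submxP[D VD] := VA j.
    have BS : B j (len j) *m S None = B j (len j) by rewrite -(vof_len j) chain_tgt.
    have UB : U *m B j (len j) = comb E' j (len j) (b j) *m U.
      by rewrite combE -(mulmxA _ _ U) USU -mulmxA BS.
    have -> : U^t* *m V *m (U *m B j (len j)) = U^t* *m D *m U *m W.
      rewrite UB -(mulmxA _ V) (mulmxA V) VD /W !mulmxA.
      by rewrite -(mulmxA (_ *m D) U) UU mulmx1.
    exact: submxMl.
  have := IHk (ltnW lt_k); set p' := (len j - k.+1)%N.
  have p'E : (len j - k)%N = p'.+1 by rewrite /p' subnSK.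
  have lt_p' : (p' < len j)%N by rewrite /p'; lia.
  rewrite p'E => /submxP[D Dp].
  have -> : B j p' = coef b j p' p' *: S (vof G j p')
      - w (vof G j p') (vof G j p'.+1) *m w (vof G j p'.+1) (vof G j p').
    by rewrite chain_scal // opprB addrC subrK.
  rewrite mulmxBr -scalemxAr addmx_sub //;
    first by rewrite scalemx_sub // pathS // -mulmxA (rep_tgtK repw) // adjacent_vofC.
  rewrite eqmx_opp {1}(pathS _ _ lt_p') mulmxA -(mulmxA (path j p'.+1)) -[_ *m w (vof G j p') _]/(B j p'.+1).
  by rewrite Dp -mulmxA -pathS // submxMl.
pose T (g : vertex G) : 'M[C]_n := if g is Some u then path (tag u) (tagged u) else W.
have T_vof j p : (p <= len j)%N -> T (vof G j p) = path j p.
  rewrite leq_eqVlt => /orP[/eqP->|lt_p]; first by rewrite vof_len path0.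
  by rewrite (vofE (Ordinal lt_p)).
have [g|g h /edgeP[j [p [lt_p [[-> ->]|[-> ->]]]]]|T0|T1] := (rep_simple repw).2 T.
- case: (vertexP g) => [->|[j [p [lt_p ->]]]]; first by rewrite /= -WS submxMl.
  rewrite T_vof ?(ltnW lt_p) // pathS // -(rep_tgtK repw (adjacent_vofC lt_p)) mulmxA.
  exact: submxMl.
- rewrite !T_vof ?(ltnW lt_p) // pathS // -mulmxA.
  exact: path_chain.
- by rewrite !T_vof ?(ltnW lt_p) // -pathS.
- left; have /= W0 := T0 None.
  have -> : V = U *m W *m U^t* by rewrite /W !mulmxA UU mul1mx -mulmxA UU mulmx1.
  by rewrite W0 mulmx0 mul0mx.
right; have /submxP[D SD] := T1 None.
have <- : U *m S None *m U^t* = 1%:M by rewrite -USU !mulmxA UU mul1mx UU.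
rewrite SD /= /W !mulmxA -(mulmxA (_ *m V)) UU mulmx1.
exact: submxMl.
Qed.
End RepResolution.

(** * Star representations *)

Section HermitianResolution.
Local Open Scope sesquilinear_scope.
Variables (C : numClosedFieldType) (N : nat) (A : 'M[C]_N) (m : nat) (b : nat -> C).
Hypothesis A_herm : A^t* = A.
Hypothesis b_inj : forall q q', (q <= m)%N -> (q' <= m)%N -> b q = b q' -> q = q'.
Hypothesis A_eigen : forall a (v : 'rV_N), v != 0 -> v *m A = a *: v ->
  exists2 q, (q <= m)%N & a = b q.

(** The projections are indexed by the prescribed list b, not by the eigenvalues that occur, so some
    may vanish; nondegeneracy is a separate matter. *)
Lemma hermitian_resolution : exists E : nat -> 'M[C]_N,
  [/\ forall q, (q <= m)%N -> (E q)^t* = E q,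
      forall q q', (q <= m)%N -> (q' <= m)%N -> E q *m E q' = if q == q' then E q else 0,
      \sum_(0 <= q < m.+1) E q = 1%:M
    & \sum_(0 <= q < m.+1) b q *: E q = A].
Proof.
have A_normal : A \is normalmx by apply/normalmxP; rewrite A_herm.
pose P := spectralmx A; pose u := spectral_diag A.
have P_unitary : P \is unitarymx := spectral_unitarymx A.
have PP : P *m P^t* = 1%:M by apply/unitarymxP.
have P'P : P^t* *m P = 1%:M by apply: mulmx1C.
have AE : A = P^t* *m diag_mx u *m P.
  by rewrite -invmx_unitary //; exact: (orthomx_spectralP A_normal).
have uP i : exists2 q, (q <= m)%N & u 0 i = b q.
  apply: (A_eigen (v := row i P)).
    apply/eqP => Pi; have := congr1 (fun M : 'M_N => M i i) PP.
    rewrite !mxE eqxx big1 => [/eqP|k _]; first by rewrite eq_sym oner_eq0.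
    by have := congr1 (fun v : 'rV_N => v 0 k) Pi; rewrite !mxE => ->; rewrite mul0r.
  rewrite -row_mul AE !mulmxA PP mul1mx; apply/rowP => k.
  by rewrite !mxE (bigD1 i) //= !mxE eqxx mulr1n big1 ?addr0 // => l li;
    rewrite !mxE eq_sym (negPf li) mul0r.
pose K (r : 'rV[C]_N) := P^t* *m diag_mx r *m P.
have K_sum (r : nat -> 'rV_N) : \sum_(0 <= q < m.+1) K (r q) = K (\sum_(0 <= q < m.+1) r q).
  by rewrite /K -mulmx_suml -mulmx_sumr; congr (_ *m _ *m _); rewrite raddf_sum.
pose r q : 'rV[C]_N := \row_i (u 0 i == b q)%:R.
have sum_r (F : nat -> C) i q : (q <= m)%N -> u 0 i = b q ->
    \sum_(0 <= k < m.+1) F k * r k 0 i = F q.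
  move=> le_q uq; rewrite -[RHS](sum_iota_if F le_q); apply: eq_big_nat => k /andP[_ le_k].
  rewrite !mxE uq; have [->|neq_k] := eqVneq k q; first by rewrite eqxx mulr1.
  by case: eqP => [/b_inj eq_q|_]; rewrite ?mulr0 //; move: neq_k; rewrite eq_q ?eqxx.
exists (fun q => K (r q)); split.
- move=> q _; rewrite /K !trmxC_mul trmxCK mulmxA; congr (_ *m _ *m _).
  rewrite tr_diag_mx map_diag_mx; congr diag_mx; apply/rowP => i.
  by rewrite !mxE rmorph_nat.
- move=> q q' le_q le_q'; rewrite /K -!mulmxA [P *m (P^t* *m _)]mulmxA PP mul1mx.
  rewrite [diag_mx _ *m (_ *m _)]mulmxA mulmx_diag; case: eqP => [->|neq_q].
    congr (_ *m (diag_mx _ *m _)); apply/rowP => i; rewrite !mxE.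
    by case: eqP; rewrite ?mulr1 ?mulr0.
  rewrite (_ : \row_i _ = 0) ?raddf0 ?mul0mx ?mulmx0 //.
  apply/rowP => i; rewrite !mxE; case: eqP => [->|]; last by rewrite mul0r.
  by case: eqP => [/b_inj eq_q|_]; [case: neq_q; apply: eq_q | rewrite mulr0].
- rewrite K_sum -P'P /K -{2}[P^t*]mulmx1; congr (_ *m _ *m _); rewrite -diag_const_mx.
  congr diag_mx; apply/rowP => i; have [q le_q uq] := uP i.
  rewrite summxE mxE -(sum_r (fun=> 1) i q) //.
  by apply: eq_bigr => k _; rewrite mul1r.
transitivity (K (\sum_(0 <= q < m.+1) b q *: r q)).
  rewrite -K_sum; apply: eq_bigr => q _.
  by rewrite /K linearZ /= -scalemxAr -scalemxAl.
rewrite [RHS]AE /K; congr (_ *m diag_mx _ *m _); apply/rowP => i; have [q le_q uq] := uP i.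
rewrite summxE uq -(sum_r b i q) //.
by apply: eq_bigr => k _; rewrite mxE.
Qed.
End HermitianResolution.

Section ResolutionEigenspace.
Variables (G : ext_dynkin) (C : numClosedFieldType) (N : nat).
Variables (E : 'I_(nbranches G) -> nat -> 'M[C]_N) (b : 'I_(nbranches G) -> nat -> C).
Hypothesis res : resolution E.

Lemma rank_res_trace j q : (q <= len j)%N -> \tr (E j q) = (\rank (E j q))%:R.
Proof. by move=> le_q; rewrite mxtrace_idem // (res_orth res) ?eqxx. Qed.

Hypothesis b_inj : forall j q q', (q <= len j)%N -> (q' <= len j)%N -> b j q = b j q' -> q = q'.

Lemma rank_eigenspace_res j q : (q <= len j)%N ->
  \rank (eigenspace (comb E j (len j) (b j)) (b j q)) = \rank (E j q).
Proof.
move=> le_q; apply: eqmx_rank; apply/andP; split; last first.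
  by apply/eigenspaceP; rewrite res_comb.
set W := eigenspace _ _; have /eigenspaceP WA : (W <= W)%MS by [].
suff -> : W = W *m E j q by rewrite submxMl.
rewrite -[LHS]mulmx1 -(res_sum res j) mulmx_sumr -[RHS](sum_iota_if (fun k => W *m E j k) le_q).
apply: eq_big_nat => k /andP[_ le_k]; case: eqP => // neq_k; apply/eqP.
have := congr1 (mulmx^~ (E j k)) WA; rewrite -mulmxA comb_res // -scalemxAl -scalemxAr.
move/eqP; rewrite -subr_eq0 -scalerBl scaler_eq0 subr_eq0 => /orP[/eqP/b_inj eq_b|//].
by case: neq_k; apply: eq_b.
Qed.
End ResolutionEigenspace.

Section Orthonormal.
Local Open Scope sesquilinear_scope.
Variables (C : numClosedFieldType) (H : vectType C) (form : {dot H for Num.conj}).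
Import passmx.

Lemma orthonormal_basis : exists e : (\dim {:H}).-tuple H,
  basis_of {:H} e /\ forall i j : 'I_(\dim {:H}), form e`_i e`_j = (i == j)%:R.
Proof.
have [s s_size s_orth] : exists2 s : seq H, size s = \dim {:H} & orthonormal form s.
  suff ext k : (k <= \dim {:H})%N -> exists2 s : seq H, size s = k & orthonormal form s.
    exact: ext.
  elim: k => [|k IHk] lt_k; first by exists [::].
  have [s s_size s_orth] := IHk (ltnW lt_k).
  have [v v_notin] : exists v, v \notin <<s>>%VS.
    have /subvPn[v _ v_notin] : ~~ (fullv <= <<s>>)%VS; last by exists v.
    apply: contraTN lt_k => /dimvS le_dim.
    by rewrite -leqNgt (leq_trans le_dim) // (leq_trans (dim_span s)) ?s_size.
  have [X sX [Y [vE _ Y_orth]]] := orthogonal_split form s v.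
  have Y0 : Y != 0 by apply: contraNneq v_notin => Y0; rewrite vE Y0 addr0.
  have nY : form Y Y != 0 by rewrite dnorm_eq0.
  exists ((sqrtC (form Y Y))^-1 *: Y :: s); first by rewrite /= s_size.
  rewrite -cat1s orthonormal_cat s_orth; apply/and3P; split=> //.
    rewrite /orthonormal /= !andbT dnormZ normfV ger0_norm ?sqrtC_ge0 ?dnorm_ge0 //.
    by rewrite exprVn sqrtCK mulVf.
  apply/orthogonalP => x y; rewrite inE => /eqP-> ys; rewrite linearZl_LR /=.
  have /orthogonalP/(_ Y y (mem_head _ _) ys) Yy := Y_orth.
  by rewrite Yy mulr0.
have /orthonormalP[s_uniq s_dot] := s_orth.
have sz : size s == \dim {:H} by rewrite s_size.
exists (Tuple sz); split.
  rewrite basisEfree /= s_size leqnn subvf andbT /=.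
  by rewrite (orthonormal_free s_orth).
move=> i j; rewrite /= s_dot ?mem_nth ?s_size // nth_uniq ?s_size //.
Qed.

Variable e : (\dim {:H}).-tuple H.
Hypothesis e_basis : basis_of {:H} e.
Hypothesis e_orth : forall i j : 'I_(\dim {:H}), form e`_i e`_j = (i == j)%:R.

Lemma form_vecof (u v : 'rV_(\dim {:H})) : form (vecof e u) (vecof e v) = (u *m v^t*) 0 0.
Proof.
rewrite /vecof linear_sumlz mxE; apply: eq_bigr => i _.
rewrite linear_sumr (bigD1 i) //= linearZlr /= e_orth eqxx big1 => [|k ki].
  by rewrite !mxE mulr1 addr0.
by rewrite linearZlr /= e_orth eq_sym (negPf ki) !mulr0.
Qed.

Lemma self_adjoint_mxof (A : 'End(H)) :
  (forall x y, form (A x) y = form x (A y)) -> (mxof e e A)^t* = mxof e e A.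
Proof.
move=> A_adj; apply/matrixP => i j.
have AE (k : 'I_(\dim {:H})) : A e`_k = vecof e (row k (mxof e e A)).
  by rewrite rowE mul_mxof rVofK // vecof_delta.
have eE (k : 'I_(\dim {:H})) : e`_k = vecof e (delta_mx 0 k) by rewrite vecof_delta.
have := A_adj e`_i e`_j; rewrite !AE !eE !form_vecof.
rewrite [X in _ = X -> _]mxE (bigD1 i) //= big1 ?addr0 => [|k ki]; last first.
  by rewrite !mxE (negPf ki) andbF mul0r.
rewrite [X in X = _ -> _]mxE (bigD1 j) //= big1 ?addr0 => [|k kj]; last first.
  by rewrite [_^t* _ _]mxE [_^T _ _]mxE [delta_mx _ _ _ _]mxE (negPf kj) andbF conjC0 mulr0.
rewrite [_^t* _ _]mxE [_^T _ _]mxE [row _ _ _ _]mxE [delta_mx _ _ _ _]mxE !eqxx conjC1 mulr1.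
rewrite [delta_mx _ _ _ _]mxE !eqxx mul1r => ->.
by rewrite [LHS]mxE [RHS]mxE; congr (_^*); rewrite [LHS]mxE [RHS]mxE [RHS]mxE.
Qed.

Lemma hommx_self_adjoint (A : 'M[C]_(\dim {:H})) : A^t* = A ->
  forall x y, form (hommx e e A x) y = form x (hommx e e A y).
Proof.
move=> A_herm x y; rewrite -[x](rVofK e_basis) -[y](rVofK e_basis) -!vecof_mul //.
by rewrite !form_vecof trmxC_mul A_herm mulmxA.
Qed.

Lemma dim_vsof (M : 'M[C]_(\dim {:H})) : \dim (vsof e M) = \rank M.
Proof.
pose g : 'rV[C]_(\rank M) -> H := vecof e \o mulmxr (row_base M).
have gE : limg (linfun g) = vsof e M.
  apply/vspaceP => v; rewrite -rVof_sub //; apply/memv_imgP/idP => [[u _ ->]|].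
    by rewrite lfunE /= vecofK // -(eq_row_base M) submxMl.
  rewrite -(eq_row_base M) => /submxP[u uE]; exists u; first exact: memvf.
  by rewrite lfunE /= -uE rVofK.
rewrite -gE limg_dim_eq; first by rewrite dimvf dim_matrix mul1r.
apply/eqP; rewrite -subv0; apply/subvP => u; rewrite memv_cap memvf memv_ker memv0 /= lfunE /=.
rewrite vecof_eq0 // => /eqP uM.
by apply/eqP/(row_free_inj (row_base_free M)); rewrite uM mul0mx.
Qed.

Lemma dim_leigenspace (A : 'End(H)) a :
  \dim (leigenspace A a) = \rank (eigenspace (mxof e e A) a).
Proof. by rewrite (leigenspaceE e_basis) dim_vsof. Qed.

(** Positive definiteness makes the eigenspace meet its orthogonal in 0, so the projection fixes the
    eigenspace. *)
Lemma limg_spectral_proj (A : 'End(H)) a : limg (daddv_pi (leigenspace A a)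
   (orthov form (leigenspace A a))) = leigenspace A a.
Proof.
set U := leigenspace A a; have capU : (U :&: orthov form U = 0)%VS.
  apply/eqP; rewrite -subv0; apply/subvP => v /memv_capP[Uv /mem_orthovP/(_ v Uv)/eqP].
  by rewrite dnorm_eq0 memv0.
apply/vspaceP => v; apply/memv_imgP/idP => [[x _ ->]|Uv]; first exact: memv_pi.
by exists v; rewrite ?memvf // daddv_pi_id.
Qed.
End Orthonormal.

Lemma comp_eigen (F : fieldType) (H : vectType F) (A : 'End(H)) (I : Type) (r : seq I)
    (c : I -> F) a x : A x = a *: x ->
  (\big[@comp_lfun _ H H H / \1%VF]_(i <- r) (A - c i *: \1)%VF) x =
    (\prod_(i <- r) (a - c i)) *: x.
Proof.
move=> Ax; elim: r => [|i r IHr]; first by rewrite !big_nil lfunE scale1r.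
rewrite !big_cons comp_lfunE IHr linearZ /= add_lfunE opp_lfunE scale_lfunE id_lfunE Ax.
by rewrite -scalerBl scalerA mulrC.
Qed.

Section Dimensions.
Variable G : ext_dynkin.
Implicit Types (v d : vec G int) (j : 'I_(nbranches G)).

Lemma Md_inv_vof v j p : (p < len j)%N ->
  Md_inv v (vof G j p) = \sum_(0 <= q < p.+1) level v j q.
Proof. by move=> lt_p; rewrite (vofE (Ordinal lt_p)) Md_inv_level. Qed.

Lemma Md_inv_None v : Md_inv v None = v None.
Proof. by rewrite ffunE. Qed.

Lemma jump_Md_inv v j q : (q < len j)%N -> jump (Md_inv v) j q = level v j q.
Proof.
move=> lt_q; rewrite /jump Md_inv_vof //; case: q lt_q => [|q] lt_q.
  by rewrite big_nat1 subr0.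
by rewrite Md_inv_vof ?(ltnW lt_q) // big_nat_recr //= addrC addrK.
Qed.

Lemma increasing_Md_inv v : (forall j q, (q < len j)%N -> 0 < level v j q) ->
  (forall j, \sum_(0 <= q < len j) level v j q < v None) -> increasing_dim (Md_inv v).
Proof.
move=> v_gt0 v_lt j.
have le_sum p p' : (p <= p' <= len j)%N ->
    \sum_(0 <= q < p) level v j q <= \sum_(0 <= q < p') level v j q.
  move=> /andP[le_p le_p']; rewrite (@big_cat_nat _ _ _ p 0 p') //= lerDl big_nat.
  by apply: sumr_ge0 => q /andP[_ lt_q]; rewrite ltW // v_gt0 // (leq_trans lt_q).
have lt_sum p : (p < len j)%N -> \sum_(0 <= q < p) level v j q < \sum_(0 <= q < p.+1) level v j q.
  by move=> lt_p; rewrite big_nat_recr //= ltrDl v_gt0.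
split=> [i|i i' lt_i|i]; rewrite ?Md_inv_None !Md_inv_level.
- rewrite big_nat_recr //= ltr_wpDl ?v_gt0 // big_nat; apply: sumr_ge0 => q /andP[_ lt_q].
  by rewrite ltW // v_gt0 // (ltn_trans lt_q).
- apply: le_lt_trans (lt_sum i' _) => //; apply: le_sum.
  by rewrite lt_i ltnW.
by apply: le_lt_trans (v_lt j); apply: le_sum; rewrite ltn_ord leqnn.
Qed.

Lemma jump_gt0 d j q : increasing_dim d -> (q <= len j)%N -> 0 < jump d j q.
Proof.
move=> /(_ j)[d_gt0 d_inc d_lt]; rewrite /jump leq_eqVlt => /orP[/eqP->|lt_q].
  have lt_j : ((len j).-1 < len j)%N by rewrite prednK ?len_gt0.
  have := d_lt (Ordinal lt_j); rewrite -vofE /= vof_len subr_gt0.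
  by case: (len j) (len_gt0 j).
case: q lt_q => [|q] lt_q; first by rewrite subr0 (vofE (Ordinal lt_q)).
rewrite subr_gt0 (vofE (Ordinal lt_q)) (vofE (Ordinal (ltnW lt_q))).
exact: d_inc.
Qed.
End Dimensions.

Section StarLevels.
Local Open Scope complex_scope.
Variables (R : realType) (G : ext_dynkin) (chi : vec G R).
Implicit Types (j : 'I_(nbranches G)).
Hypothesis chi_par : parameter chi.

Definition blev j q : R[i] := (level chi j q)%:C.

Lemma coef_blev j p q :
  coef blev j p q = (sgn R j p * (level chi j q - level chi j p.+1))%:C.
Proof. by rewrite /coef /blev rmorphM rmorphB /sgn rmorph_sign. Qed.

Lemma coef_blev_gt0 j p q : (q <= p)%N -> (p < len j)%N -> 0 < coef blev j p q.
Proof. by move=> le_q lt_p; rewrite coef_blev ltcR level_gap. Qed.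

Lemma blev_last j : blev j (len j) = 0.
Proof. by rewrite /blev level_last. Qed.

Lemma blev_inj j q q' : (q <= len j)%N -> (q' <= len j)%N -> blev j q = blev j q' -> q = q'.
Proof.
wlog lt_q : q q' / (q < q')%N.
  by move=> IH le_q le_q' eq_b; have [/IH|/IH|//] := ltngtP q q';
    [|move=> /(_ le_q' le_q (esym eq_b))]; auto.
move=> _ le_q' /(congr1 (@complex.Re R)) /= eq_b.
case: q' lt_q le_q' eq_b => // q' lt_q le_q' eq_b.
have := @level_gap _ R chi j q' q chi_par lt_q le_q'.
by rewrite eq_b subrr mulr0 ltxx.
Qed.

Lemma cvec_Mf j p : (p < len j)%N -> cvec (Mf chi) (vof G j p) = coef blev j p p.
Proof. by move=> lt_p; rewrite cvecE coef_blev (vofE (Ordinal lt_p)) Mf_level. Qed.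

Lemma Mf_gt0_branch j p : (p < len j)%N -> 0 < Mf chi (vof G j p).
Proof. by move=> lt_p; have := coef_blev_gt0 (leqnn p) lt_p; rewrite -cvec_Mf // cvecE ltcR. Qed.

Lemma limg_eq0 (F : fieldType) (H : vectType F) (A : 'End(H)) : (limg A == 0%VS) = (A == 0).
Proof.
apply/eqP/eqP => [A0|->]; last by apply/eqP; rewrite -subv0; apply/subvP => x /memv_imgP[y _ ->];
  rewrite lfunE mem0v.
apply/lfunP => x; rewrite lfunE; apply/eqP; rewrite -memv0 -A0.
exact: memv_img (memvf x).
Qed.

Section StarToScalar.
Variables (H : vectType R[i]) (form : {dot H for Num.conj}) (pi : star_rep form chi).
Variable v : vec G int.
Hypothesis nondeg : nondegenerate_rep pi.
Hypothesis irr : irreducible pi.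
Hypothesis dimv : gen_dim pi v.
Import passmx.

(** The relations put every eigenvalue of A_j among the levels, so the spectral theorem gives a
    resolution. Nondegeneracy makes its projections nonzero, which is the strict increase of d, also
    in the last step to the centre. *)
Lemma star_unitary : has_unitary_rep (Md_inv v) (cvec (Mf chi)) /\ increasing_dim (Md_inv v).
Proof.
have [e [e_basis e_orth]] := orthonormal_basis form.
pose A j := mxof e e (pi j).
have A_eigen j a (x : 'rV_(\dim {:H})) : x != 0 -> x *m A j = a *: x ->
    exists2 q, (q <= len j)%N & a = blev j q.
  move=> x0 xA; have ax : pi j (vecof e x) = a *: vecof e x.
    by rewrite (hom_vecof _ e_basis) xA linearZ.
  have /lfunP/(_ (vecof e x)) := gen_poly pi j.
  rewrite comp_lfunE (comp_eigen _ _ ax) linearZ /= ax scalerA lfunE /= => /eqP.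
  rewrite scaler_eq0 vecof_eq0 // (negPf x0) orbF mulf_eq0 => /orP[|/eqP->]; last first.
    by exists (len j); rewrite ?blev_last.
  rewrite prodf_seq_eq0 => /hasP[i _ /=]; rewrite subr_eq0 => /eqP->.
  have [q lt_q qi] := vtx_level i; exists q; first exact: ltnW.
  by rewrite /blev qi.
have /fin_all_exists[E EP] (j : 'I_(nbranches G)) :=
  hermitian_resolution (self_adjoint_mxof e_basis e_orth (gen_adj pi j))
    (@blev_inj j) (A_eigen j).
have res : resolution E.
  split=> j; have [E_herm E_orth E_sum _] := EP j; [exact: E_herm|exact: E_orth|exact: E_sum].
have combE j : comb E j (len j) (blev j) = A j by have [_ _ _] := EP j.
have rankE j q : (q <= len j)%N -> \rank (E j q) = \dim (limg (spectral_proj form (pi j) (blev j q))).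
  move=> le_q; rewrite limg_spectral_proj (dim_leigenspace e_basis) -/(A j) -combE.
  by rewrite (rank_eigenspace_res res blev_inj).
have rank_gt0 j q : (q <= len j)%N -> (0 < \rank (E j q))%N.
  move=> le_q; rewrite rankE // lt0n dimv_eq0 limg_eq0; have [nd nd0] := nondeg j.
  move: le_q; rewrite leq_eqVlt => /orP[/eqP->|lt_q]; first by rewrite blev_last.
  by have [i iq] := level_vtx lt_q; rewrite /blev iq nd.
have levelE j q : (q < len j)%N -> level v j q = (\rank (E j q))%:Z.
  move=> lt_q; have [i iq] := level_vtx lt_q; rewrite rankE ?(ltnW lt_q) //.
  by rewrite iq dimv.1 /blev iq.
have trE j q : (q <= len j)%N -> \tr (E j q) = (\rank (E j q))%:R.
  exact: rank_res_trace.
have vN : v None = (\dim {:H})%:Z := dimv.2.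
split; last first.
  apply: increasing_Md_inv => [j q lt_q|j]; first by rewrite levelE // ltz_nat rank_gt0 // ltnW.
  rewrite vN; have := congr1 mxtrace (res_sum res j).
  rewrite mxtrace1 raddf_sum /= (eq_big_nat _ _ (F2 := fun q => (\rank (E j q))%:R)) => [|q /andP[_ le_q]]; last exact: trE.
  rewrite -natr_sum => /eqP; rewrite eqr_nat => /eqP <-.
  rewrite big_nat_recr //= PoszD (eq_big_nat _ _ (F2 := fun q => (\rank (E j q))%:Z)) => [|q /andP[_ lt_q]]; last exact: levelE.
  by rewrite (big_morph Posz PoszD (erefl (0%N : int))) ltrDl ltz_nat rank_gt0.
exists (\dim {:H}), (res_S E), (res_w E blev).
apply: (resolution_rep (gam := (chi None)%:C) res coef_blev_gt0 blev_last).
- rewrite (eq_bigr _ (fun j _ => combE j)) -linear_sum gen_sum linearZ /= mxof1 ?(basis_free e_basis) //.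
  by rewrite scalemx1.
- by rewrite cvecE ffunE.
- exact: cvec_Mf.
- by rewrite Md_inv_None vN.
- move=> j p lt_p; rewrite Md_inv_vof // rmorph_sum /=; apply: eq_big_nat => q /andP[_ le_q].
  have lt_q := leq_trans le_q lt_p.
  by rewrite levelE // trE // ltnW.
- by rewrite lt0n; case: irr.
move=> V VA; have [_ /(_ (vsof e V))] := irr; case.
- move=> j; apply/subvP => _ /memv_imgP[u uV ->]; rewrite -rVof_sub // in uV.
  by rewrite -rVof_sub // (rVof_app _ e_basis) -/(A j) -combE (submx_trans (submxMr _ uV) (VA j)).
- by move/eqP; rewrite vsof_eq0 // => /eqP; left.
move=> Vfull; right; apply/row_subP => i; rewrite -(vecofK e_basis (row i _)) rVof_sub //.
by rewrite Vfull memvf.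
Qed.
End StarToScalar.

Section ScalarToStar.
Variables (H : vectType R[i]) (form : {dot H for Num.conj}).
Variables (r : nat) (E : 'I_(nbranches G) -> nat -> 'M[R[i]]_r).
Hypothesis dimH : \dim {:H} = r.
Hypothesis r_gt0 : (0 < r)%N.
Hypothesis res : resolution E.
Hypothesis A_sum : \sum_j comb E j (len j) (blev j) = ((chi None)%:C)%:M.
Hypothesis irr : forall V : 'M[R[i]]_r,
  (forall j, (V *m comb E j (len j) (blev j) <= V)%MS) -> V = 0 \/ (1%:M <= V)%MS.
Import passmx.

Lemma resolution_star : exists pi : star_rep form chi, irreducible pi /\
  forall j q, (q <= len j)%N ->
    \dim (limg (spectral_proj form (pi j) (blev j q))) = \rank (E j q).
Proof.
subst r; have [e [e_basis e_orth]] := orthonormal_basis form.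
pose A j := comb E j (len j) (blev j); pose T j := hommx e e (A j).
have A_herm j : ((A j)^t*)%sesqui = A j.
  rewrite /A /comb !raddf_sum /=; apply: eq_big_nat => q /andP[_ le_q].
  rewrite trmxC_scale (res_herm res) //; congr (_ *: _).
  exact: conjc_real.
have T_eigen j q x : (q <= len j)%N ->
    T j (hommx e e (E j q) x) = blev j q *: hommx e e (E j q) x.
  move=> le_q; rewrite -comp_lfunE -hommx_mul // res_comb // linearZ /=.
  by rewrite scale_lfunE.
have T_adj j : self_adjoint form (T j) by apply: hommx_self_adjoint.
have T_poly j : (T j \o \big[@comp_lfun _ H H H / \1%VF]_(i < len j)
    (T j - (chi (vtx i))%:C *: \1))%VF = 0.
  (* It suffices to test eigenvectors: there either A_j or one factor of the product is zero. *)
  apply/lfunP => x; have -> : x = \sum_(0 <= q < (len j).+1) hommx e e (E j q) x.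
    rewrite -{1}[x](rVofK e_basis) -[rVof e x]mulmx1 -(res_sum res j) mulmx_sumr linear_sum.
    by apply: eq_bigr => q _; rewrite hommxE.
  rewrite linear_sum [RHS]lfunE big_nat big1 // => q /andP[_ le_q].
  rewrite /= comp_lfunE (comp_eigen _ _ (T_eigen j q x le_q)) linearZ /= T_eigen // scalerA.
  apply/eqP; rewrite scaler_eq0 mulf_eq0; apply/orP; left.
  move: le_q; rewrite ltnS leq_eqVlt => /orP[/eqP->|lt_q]; first by rewrite blev_last eqxx orbT.
  have [i iq] := level_vtx lt_q; apply/orP; left; rewrite prodf_seq_eq0; apply/hasP.
  by exists i; rewrite ?mem_index_enum //= /blev iq subrr.
have T_sum : \sum_j T j = (chi None)%:C *: \1%VF.
  by rewrite -linear_sum A_sum -scalemx1 linearZ /= hommx1.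
exists (StarRep T_adj T_poly T_sum); split; last first.
  move=> j q le_q; rewrite limg_spectral_proj (dim_leigenspace e_basis) hommxK //.
  by rewrite (rank_eigenspace_res res blev_inj).
split; first by rewrite -lt0n.
move=> U TU; have [j|U0|U1] := irr (V := msof e U).
- apply/row_subP => i; rewrite row_mul -(mem_vecof e_basis) (vecof_mul e_basis e_basis).
  have /subvP := TU j; apply; apply: memv_img.
  by rewrite mem_vecof // row_sub.
- by left; apply/eqP; rewrite -(msof_eq0 e_basis) U0.
right; apply/vspaceP => x; rewrite memvf -(rVofK e_basis x) mem_vecof //.
exact: submx_trans (submx1 _) U1.
Qed.
End ScalarToStar.

Lemma unitary_star (v : vec G int) :
  has_unitary_rep (Md_inv v) (cvec (Mf chi)) -> increasing_dim (Md_inv v) ->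
  exists (H : vectType R[i]) (form : {dot H for Num.conj}) (pi : star_rep form chi),
    [/\ irreducible pi, nondegenerate_rep pi & gen_dim pi v].
Proof.
case=> n [S [w [repw hermw]]] incd.
have [r [E [rE res A_sum trE irr]]] := centre_resolution repw hermw coef_blev_gt0 blev_last cvec_Mf.
have d_gt0 : 0 < Md_inv v None.
  have [[[j i]|] // _] := vertex_neq (None : vertex G).
  by have [/(_ i) d_gt0 _ /(_ i)] := incd j; apply: lt_trans.
have r_gt0 : (0 < r)%N by rewrite rE absz_gt0 gt_eqF.
have dimH : \dim {:'rV[R[i]]_r} = r by rewrite dimvf dim_matrix mul1r.
rewrite cvecE ffunE in A_sum.
have [pi [pi_irr pi_dim]] := resolution_star (@dotmx R[i] r) dimH r_gt0 res A_sum irr.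
exists 'rV[R[i]]_r, (@dotmx R[i] r), pi.
have rankE j q : (q <= len j)%N -> (\dim (limg (spectral_proj (@dotmx R[i] r) (pi j) (blev j q))))%:Z = jump (Md_inv v) j q.
  move=> le_q; rewrite pi_dim //; apply: (mulrIz (oner_neq0 R[i])).
  by rewrite -trE // (rank_res_trace res).
have rank_neq0 j q : (q <= len j)%N -> spectral_proj (@dotmx R[i] r) (pi j) (blev j q) != 0.
  move=> le_q; rewrite -limg_eq0 -dimv_eq0 -lt0n -ltz_nat rankE //.
  exact: jump_gt0.
split=> //.
  move=> j; split=> [i|]; last by rewrite -(blev_last j) rank_neq0.
  have [q lt_q qi] := vtx_level i; have := rank_neq0 j q (ltnW lt_q).
  by rewrite /blev qi.
split=> [j i|]; last by rewrite dimH rE -Md_inv_None gez0_abs ?ltW.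
have [q lt_q qi] := vtx_level i.
have := rankE j q (ltnW lt_q); rewrite (jump_Md_inv v lt_q) (qi _ v) => <-.
by rewrite /blev (qi _ chi).
Qed.
End StarLevels.

(** * Classification *)

Section Classification.
Local Open Scope complex_scope.
Variables (R : realType) (G : ext_dynkin) (col : vertex G -> bool) (chi : vec G R).
Hypothesis hcol : proper_colouring col.
Hypothesis chi_par : parameter chi.

(** On the branches this is the ordering of the parameters. At the centre unitarity gives gamma >=
    0, and gamma = 0 would make d simple although it is positive on the branches. *)
Lemma Mf_positive d : has_unitary_rep d (cvec (Mf chi)) -> increasing_dim d ->
  positive (Mf chi).
Proof.
move=> repd incd.
have pos (j : 'I_(nbranches G)) p : (p < len j)%N -> 0 < Mf chi (vof G j p).
  exact: (Mf_gt0_branch chi_par).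
move=> g; case: (vertexP g) => [->|[j [p [lt_p ->]]]]; last exact: pos.
have [[[j i]|] // _] := vertex_neq (None : vertex G).
have dj : 0 < d (vtx i) by have [/(_ i)] := incd j.
have dN : 0 < d None by have [_ _ /(_ i)] := incd j; apply: lt_trans.
have := unitary_scal_ge0 repd (g := None); rewrite gt_eqF // cvecE lecR => /(_ isT).
rewrite le_eqVlt => /orP[/eqP f0|//].
have dE : d = unit_vec None.
  by apply: unitary_scal_eq0 repd _ _; rewrite ?gt_eqF // cvecE -f0.
by move: dj; rewrite dE unit_vecE ltxx.
Qed.

Lemma star_walk (v : vec G int) b k t : (0 < k)%N -> nondegenerate_root (Md_inv v) ->
  cox_iter col b k (Md_inv v) = unit_vec t ->
  (pos_off t (coxd_iter col (~~ b) k (Md_inv v) (Mf chi)) <->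
   exists (H : vectType R[i]) (form : {dot H for Num.conj}) (pi : star_rep form chi),
     [/\ irreducible pi, nondegenerate_rep pi & gen_dim pi v]).
Proof.
move=> k_gt0 [_ incd] dt; set d := Md_inv v in incd dt *; split=> [f_pos|].
  apply: unitary_star => //.
  (* Otherwise walking back starts by sending e_t to -e_t and ends at negative height, against d >=
     0. *)
  have tb : col t = b (+) odd k.
    apply/eqP; apply: contraT => tb.
    have d_lt0 : height d < 0.
      rewrite -(cox_iterK hcol b k d) dt; apply: height_unit_cox => //.
      by move: tb; case: (col t); case: (_ (+) _).
    have : 0 <= height d; last by rewrite leNgt d_lt0.
    apply: height_ge0 => -[[j i]|]; first by have [/(_ i)/ltW] := incd j.
    have [[[j i]|] // _] := vertex_neq (None : vertex G).
    by have [/(_ i) d_gt0 _ /(_ i)] := incd j => /(lt_trans d_gt0)/ltW.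
  by have [] := unitary_walk_back hcol tb dt f_pos.
case=> H [form [pi [pi_irr pi_nd pi_dim]]].
have [repd _] := star_unitary chi_par pi_nd pi_irr pi_dim.
exact: (unitary_walk hcol repd (Mf_positive repd incd) k_gt0 dt).
Qed.

Lemma star_dichotomy (H : vectType R[i]) (form : {dot H for Num.conj})
    (pi : star_rep form chi) (v : vec G int) (d := Md_inv v) :
  nondegenerate_rep pi -> irreducible pi -> gen_dim pi v ->
  (in_hyperplane chi /\ v = Md (delta G)) \/
  exists b k t, [/\ (0 < k)%N, pos_off t (coxd_iter col (~~ b) k d (Mf chi))
    & cox_iter col b k d = unit_vec t].
Proof.
move=> pi_nd pi_irr pi_dim; have [repd incd] := star_unitary chi_par pi_nd pi_irr pi_dim.
have f_gt0 := Mf_positive repd incd.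
have [def0|defN0] := eqVneq (defect col true d) 0.
  left; have [dd f0] := zero_defect_delta hcol repd f_gt0 incd def0.
  by split; [exact: defect_hyperplane f0 | rewrite -dd Md_invK].
right; have [b def_gt0] : exists b, 0 < defect col b d.
  have [|le0] := ltP 0 (defect col true d); first by exists true.
  by exists false; rewrite (defectN col true) oppr_gt0 lt_neqAle defN0.
have [k [t [k_gt0 dt]]] := walk_terminates hcol repd f_gt0 def_gt0.
by exists b, k, t; split=> //; apply: unitary_walk.
Qed.
End Classification.

Local Open Scope complex_scope.

Theorem theorem2 (R : realType) (G : ext_dynkin) (col : vertex G -> bool)
    (hcol : proper_colouring col) :
  (forall (chi : vec G R) (H : vectType R[i]) (form : {dot H for Num.conj})
      (pi : star_rep form chi) (v : vec G int),
    parameter chi ->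
    nondegenerate_rep pi -> irreducible pi -> gen_dim pi v ->
    let d := Md_inv v in
    (in_hyperplane chi /\ v = Md (delta G)) \/
    (exists (k : nat) (t : vertex G), (0 < k)%N /\
      ((pos_off t (coxd_iter col bullet k d (Mf chi)) /\
        cox_iter col circ k d = unit_vec t) \/
       (pos_off t (coxd_iter col circ k d (Mf chi)) /\
        cox_iter col bullet k d = unit_vec t)))) /\
  (forall (chi : vec G R) (v : vec G int) (k : nat) (t : vertex G),
    parameter chi -> (0 < k)%N ->
    let d := Md_inv v in
    nondegenerate_root d ->
    (cox_iter col circ k d = unit_vec t ->
      (pos_off t (coxd_iter col bullet k d (Mf chi)) <->
       exists (H : vectType R[i]) (form : {dot H for Num.conj})
              (pi : star_rep form chi),
         [/\ irreducible pi, nondegenerate_rep pi & gen_dim pi v])) /\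
    (cox_iter col bullet k d = unit_vec t ->
      (pos_off t (coxd_iter col circ k d (Mf chi)) <->
       exists (H : vectType R[i]) (form : {dot H for Num.conj})
              (pi : star_rep form chi),
         [/\ irreducible pi, nondegenerate_rep pi & gen_dim pi v]))).
Proof.
split=> [chi H form pi v chi_par pi_nd pi_irr pi_dim|chi v k t chi_par k_gt0 d root_d].
  have [|[b [k [t [k_gt0 f_pos dt]]]]] := star_dichotomy hcol chi_par pi_nd pi_irr pi_dim.
    by left.
  by right; exists k, t; split=> //; case: b f_pos dt; [left|right].
split=> dt; first exact: (star_walk hcol chi_par (b := true) k_gt0 root_d dt).
exact: (star_walk hcol chi_par (b := false) k_gt0 root_d dt).
Qed.
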